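(* The set $\bigl\{\bigl((\prod_{i\in I}\partial_{s_i})\bullet F_{\mathcal N}(x,s)\bigr)_{|s=0}: I\subset\{1,\dots,m-1\}\bigr\}$ forms a basis of solutions of $M_A(0)$.
   Context: $\mathbb N=\{0,1,2,\dots\}$. Let $m$ be a positive integer, $e_0,\dots,e_m$ the standard basis of $\mathbb Z^{m+1}$, and let $A$ be the matrix with the $2m$ columns $a_i=e_0+e_i$, $a_{-i}=e_0-e_i$ ($i=1,\dots,m$); coordinates and variables are indexed by $\{\pm1,\dots,\pm m\}$. $L=\{u\in\mathbb Z^{2m}:Au=0\}$. $I_A=\langle\partial^u-\partial^{u'}:u,u'\in\mathbb N^{2m},Au=Au'\rangle$; $H_A(0)$ is the left ideal of the Weyl algebra $D$ in $x_{\pm i},\partial_{\pm i}$ generated by $I_A$ and the Euler operators given by the rows of $A\theta$ ($\theta_j=x_j\partial_j$), and $M_A(0)=D/H_A(0)$. A basis of solutions is a $\mathbb C$-basis of the solution space of $M_A(0)$ (whose dimension is the holonomic rank), on a common domain of convergence of the series. $w$ is a generic weight with $w_1+w_{-1}>w_2+w_{-2}>\cdots>w_m+w_{-m}$. Put $g^{(i)}=e_i+e_{-i}-e_m-e_{-m}$ for $i=1,\dots,m-1$ (here $e_j$ denote unit vectors of $\mathbb Z^{2m}$); the reduced Gröbner basis of $I_A$ with respect to $w$ is $\{\partial_i\partial_{-i}-\partial_m\partial_{-m}:1\le i\le m-1\}$ with initial terms $\partial_i\partial_{-i}$. $C(w)=\sum_i\mathbb Ng^{(i)}$. $B=\{g^{(1)},\dots,g^{(m-1)}\}$,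 a basis of $L$; $s=(s_1,\dots,s_{m-1})$ are indeterminates and $Bs=\sum_is_ig^{(i)}$. For $u\in L$, write $u=u_+-u_-$ (nonnegative entries, disjoint supports), and $I_u=\{j:u_j<0\}$, the negative support of $v+u$ for $v=0$. $\mathcal N=\{I_u:u\in L,\text{ and every }u'\in L\text{ with }I_{u'}=I_u\text{ lies in }C(w)\}$, $L'=\{u\in L:I_u\in\mathcal N\}$. With $[y]_u=\prod_jy_j(y_j-1)\cdots(y_j-u_j+1)$, $$F_{\mathcal N}(x,s)=\sum_{u\in L'}\frac{[Bs]_{u_-}}{[Bs+u]_{u_+}}x^{Bs+u},$$ where $x^{Bs+u}$ is regarded as $x^u\exp\bigl(\sum_j(\log x_j)(Bs)_j\bigr)$; differentiation in $s$ and evaluation at $s=0$ are termwise. *)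

(* Defs.v *)
From HB Require Import structures.
From mathcomp Require Import all_boot all_order all_algebra finmap.
From mathcomp Require Import complex.
From mathcomp Require Import boolp classical_sets functions filter reals.
From mathcomp Require Import topology normedtype sequences derive exp trigo.
From mathcomp Require Export summability.

Set Implicit Arguments.
Unset Strict Implicit.
Unset Printing Implicit Defensive.

Import Order.TTheory GRing.Theory Num.Theory.
Import numFieldNormedType.Exports.

Local Open Scope classical_set_scope.
Local Open Scope ring_scope.

(* The topology and norm of the complex numbers are the ones every
   numFieldType carries as a module over itself. *)
#[warnings="-redundant-canonical-projection"]
HB.instance Definition _ (R : realType) := NormedModule.copy R[i] R[i]^o.

Definition cexp (R : realType) (z : R[i]) : R[i] :=
  (expR (complex.Re z))%:C%C
  * (cos (complex.Im z) +i* sin (complex.Im z))%C.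

(* Sums over arbitrary index sets are limits of the net of finite partial sums
   ([totally]); in finite dimension this is absolute convergence. *)
Definition has_sum (I : choiceType) (R : realType) (a : I -> R[i]) (l : R[i]) :=
  partial_sum a @ totally --> l.

Section ComplexDomains.
Variables (R : realType) (N : nat).
Local Notation C := R[i].

Definition domain (U : set 'cV[C]_N) := [/\ open U, connected U & U !=set0].

Definition holomorphic (U : set 'cV[C]_N) (f : 'cV[C]_N -> C) :=
  forall a, U a -> exists (c : 'cV[nat]_N -> C) (r : C), 0 < r /\
    forall x, `|x - a| < r ->
      has_sum (fun p => c p * \prod_j (x j 0 - a j 0) ^+ p j 0) (f x).

(* [lam j x] is the value at x of a branch of log x_j, so U avoids the
   coordinate hyperplanes. *)
Definition log_branches (U : set 'cV[C]_N) (lam : 'I_N -> 'cV[C]_N -> C) :=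
  forall j x, U x -> {for x, continuous (lam j)} /\ cexp (lam j x) = x j 0.

Definition pd (f : 'cV[C]_N -> C) (j : 'I_N) : 'cV[C]_N -> C :=
  'D_(delta_mx j 0) f.

End ComplexDomains.

(* The Weyl algebra D: noncommutative expressions in constants, x_j and d_j,
   modulo the congruence [weyl_eq]. *)
Inductive weyl (K : Type) (N : nat) : Type :=
| WC of K
| WX of 'I_N
| WD of 'I_N
| WAdd of weyl K N & weyl K N
| WMul of weyl K N & weyl K N.
Arguments WC {K N}.
Arguments WX {K N}.
Arguments WD {K N}.

Section Weyl.
Variables (K : fieldType) (N : nat).
Local Notation W := (weyl K N).

Inductive weyl_eq : W -> W -> Prop :=
| weq_refl P : weyl_eq P P
| weq_sym P Q : weyl_eq P Q -> weyl_eq Q P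
| weq_trans P Q S : weyl_eq P Q -> weyl_eq Q S -> weyl_eq P S
| weq_add P P' Q Q' :
    weyl_eq P P' -> weyl_eq Q Q' -> weyl_eq (WAdd P Q) (WAdd P' Q')
| weq_mul P P' Q Q' :
    weyl_eq P P' -> weyl_eq Q Q' -> weyl_eq (WMul P Q) (WMul P' Q')
| weq_addA P Q S : weyl_eq (WAdd P (WAdd Q S)) (WAdd (WAdd P Q) S)
| weq_addC P Q : weyl_eq (WAdd P Q) (WAdd Q P)
| weq_add0 P : weyl_eq (WAdd (WC 0) P) P
| weq_addN P : weyl_eq (WAdd P (WMul (WC (-1)) P)) (WC 0)
| weq_mulA P Q S : weyl_eq (WMul P (WMul Q S)) (WMul (WMul P Q) S)
| weq_mul1 P : weyl_eq (WMul (WC 1) P) P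
| weq_mulDl P Q S : weyl_eq (WMul (WAdd P Q) S) (WAdd (WMul P S) (WMul Q S))
| weq_mulDr P Q S : weyl_eq (WMul P (WAdd Q S)) (WAdd (WMul P Q) (WMul P S))
| weq_constD a b : weyl_eq (WC (a + b)) (WAdd (WC a) (WC b))
| weq_constM a b : weyl_eq (WC (a * b)) (WMul (WC a) (WC b))
| weq_constC a P : weyl_eq (WMul (WC a) P) (WMul P (WC a))
| weq_XX i j : weyl_eq (WMul (WX i) (WX j)) (WMul (WX j) (WX i))
| weq_DD i j : weyl_eq (WMul (WD i) (WD j)) (WMul (WD j) (WD i))
| weq_DX i j :
    weyl_eq (WMul (WD i) (WX j)) (WAdd (WMul (WX j) (WD i)) (WC (i == j)%:R)).

(* The left ideal, inside the subring S of D, generated by G. *)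
Inductive left_ideal (S G : set W) : set W :=
| li_gen P : G P -> left_ideal S G P
| li_zero : left_ideal S G (WC 0)
| li_add P Q :
    left_ideal S G P -> left_ideal S G Q -> left_ideal S G (WAdd P Q)
| li_mul P Q : S P -> left_ideal S G Q -> left_ideal S G (WMul P Q)
| li_eq P Q : weyl_eq P Q -> left_ideal S G P -> left_ideal S G Q.

Fixpoint const_coef (P : W) : Prop :=
  match P with
  | WC _ | WD _ => True
  | WX _ => False
  | WAdd P Q | WMul P Q => const_coef P /\ const_coef Q
  end.

Definition dmonomial (u : 'cV[nat]_N) : W :=
  \big[@WMul K N/WC 1]_j iter (u j 0) (WMul (WD j)) (WC 1).

Definition toric_ideal d (A : 'M[int]_(d, N)) : set W :=
  left_ideal [set P | const_coef P]
    [set P | exists u u' : 'cV[nat]_N,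
       A *m map_mx Posz u = A *m map_mx Posz u' /\
       P = WAdd (dmonomial u) (WMul (WC (-1)) (dmonomial u'))].

Definition euler d (A : 'M[int]_(d, N)) (i : 'I_d) : W :=
  \big[@WAdd K N/WC 0]_j WMul (WC (A i j)%:~R) (WMul (WX j) (WD j)).

(* H_A(beta) for beta = 0. *)
Definition hypergeometric_ideal d (A : 'M[int]_(d, N)) : set W :=
  left_ideal setT (toric_ideal A `|` range (euler A)).

End Weyl.

Fixpoint weyl_act (R : realType) (N : nat) (P : weyl R[i] N)
    (f : 'cV[R[i]]_N -> R[i]) : 'cV[R[i]]_N -> R[i] :=
  match P with
  | WC c => fun x => c * f x
  | WX j => fun x => x j 0 * f x
  | WD j => pd f j
  | WAdd P Q => fun x => weyl_act P f x + weyl_act Q f x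
  | WMul P Q => weyl_act P (weyl_act Q f)
  end.

Section Solutions.
Variables (R : realType) (N d : nat) (A : 'M[int]_(d, N)).
Local Notation C := R[i].

(* Hom_D(D / H_A(0), O(U)), a morphism being identified with the image f of
   the class of 1. *)
Definition solution (U : set 'cV[C]_N) (f : 'cV[C]_N -> C) :=
  holomorphic U f /\
  forall P, hypergeometric_ideal A P -> forall x, U x -> weyl_act P f x = 0.

Definition solution_basis (T : finType) (U : set 'cV[C]_N)
    (phi : T -> 'cV[C]_N -> C) :=
  [/\ forall t, solution U (phi t),
      forall c : T -> C, (forall x, U x -> \sum_t c t * phi t x = 0) ->
        forall t, c t = 0
    & forall f, solution U f ->
        exists c : T -> C, forall x, U x -> f x = \sum_t c t * phi t x].

End Solutions.

(* From here on m = n.+1.  The coordinate i of {1..m} is [pos i] and -i is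
   [neg i], with i : 'I_n.+1 shifted by one, so that m is [ord_max] and the
   index set {1..m-1} is 'I_n, embedded by [lift ord_max]. *)
Section CrossPolytope.
Variable n : nat.
Local Notation N := (n.+1 + n.+1)%N.

Definition pos (i : 'I_n.+1) : 'I_N := lshift n.+1 i.
Definition neg (i : 'I_n.+1) : 'I_N := rshift n.+1 i.

Definition Amx : 'M[int]_(1 + n.+1, N) :=
  block_mx (const_mx 1) (const_mx 1) 1%:M (- 1%:M).

Definition inL (u : 'cV[int]_N) := Amx *m u = 0.

(* Such a w is automatically generic for I_A: its initial ideal is the monomial
   ideal generated by the d_i d_{-i}, i < m. *)
Definition decreasing_weight (R : realType) (w : 'cV[R]_N) :=
  forall i j : 'I_n.+1, (i < j)%N ->
    w (pos j) 0 + w (neg j) 0 < w (pos i) 0 + w (neg i) 0.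

Definition g (i : 'I_n) : 'cV[int]_N :=
  delta_mx (pos (lift ord_max i)) 0 + delta_mx (neg (lift ord_max i)) 0
  - delta_mx (pos ord_max) 0 - delta_mx (neg ord_max) 0.

(* C(w) is the same for all decreasing weights w: the reduced Groebner basis
   consists of the binomials d_i d_{-i} - d_m d_{-m} attached to the g i. *)
Definition inCw (u : 'cV[int]_N) :=
  exists k : 'I_n -> nat, u = \sum_i g i *+ k i.

Definition nsupp (u : 'cV[int]_N) : {set 'I_N} := [set j | u j 0 < 0].

Definition inN (I : {set 'I_N}) :=
  (exists2 u, inL u & nsupp u = I) /\
  forall u', inL u' -> nsupp u' = I -> inCw u'.

Definition inL' (u : 'cV[int]_N) := inL u /\ inN (nsupp u).

(* u_+ ; u_- is [pospart (- u)]. *)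
Definition pospart (u : 'cV[int]_N) : 'cV[nat]_N :=
  map_mx (fun a : int => `|Num.max a 0|%N) u.

Section Series.
Variable R : realType.
Local Notation C := R[i].

Definition falling (y : 'cV[C]_N) (u : 'cV[nat]_N) : C :=
  \prod_j \prod_(k < u j 0) (y j 0 - k%:R).

Definition Bs (s : 'cV[C]_n) : 'cV[C]_N :=
  \sum_i s i 0 *: map_mx intr (g i).

(* The term of F_N(x, s) of index u; l j stands for log x_j. *)
Definition Fterm (x l : 'cV[C]_N) (u : 'cV[int]_N) (s : 'cV[C]_n) : C :=
  falling (Bs s) (pospart (- u)) / falling (Bs s + map_mx intr u) (pospart u)
  * ((\prod_j x j 0 ^ u j 0) * cexp (\sum_j l j 0 * Bs s j 0)).

(* The iterated partial derivative along the product of the d_{s_i}, i in I. *)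
Definition pds (I : {set 'I_n}) (f : 'cV[C]_n -> C) : 'cV[C]_n -> C :=
  foldr (fun i h => pd h i) f (enum I).

Definition dFterm (I : {set 'I_n}) (x l : 'cV[C]_N) (u : 'cV[int]_N) : C :=
  if `[< inL' u >] then pds I (Fterm x l u) 0 else 0.

Definition converges (I : {set 'I_n}) (x l : 'cV[C]_N) :=
  cvg (partial_sum (dFterm I x l) @ totally).

Definition dF (lam : 'I_N -> 'cV[C]_N -> C) (I : {set 'I_n}) (x : 'cV[C]_N) : C :=
  summability.sum (dFterm I x (\col_j lam j x)).

Definition convergence_domain (U : set 'cV[C]_N) (lam : 'I_N -> 'cV[C]_N -> C) :=
  [/\ domain U, log_branches U lam &
      forall I x, U x -> converges I x (\col_j lam j x)].

End Series.
End CrossPolytope.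

(* Main.v *)
(* The vectors of L' are the sums of the k_i g^(i), k in N^(m-1), and in the variables
   z_i = log x_i + log x_-i - log x_m - log x_-m the corresponding term of F_N is
     H_k(z, s) = prod_(j < |k|) (|s| + j)^2 / prod_i prod_(1 <= j <= k_i) (s_i + j)^2
                 * exp(sum_i (s_i + k_i) z_i).
   Let G_I(z) be the sum over k of the derivatives of H_k along I at s = 0.
   Solutions: (s_i + k_i + 1)^2 H_(k + e_i) = e^(z_i) (|s| + |k|)^2 H_k, hence
   d_i^2 G_I = e^(z_i) (sum_j d_j)^2 G_I, which is the action of the binomial
   d_i d_-i - d_m d_-m on the pullback of G_I; pullbacks are killed by the Euler operators.
   Independence: translating z_i by 2 pi i multiplies H_k by exp(2 pi i s_i), so that
   G_I(z + 2 pi i e_i) - G_I(z) is 2 pi i G_(I \ i)(z) if i is in I and 0 otherwise, while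
   G_0 = 1; a linear relation continues to a strip around the imaginary directions, and
   such translations reduce it to the trivial one by induction on the size of I.
   Spanning: for m > 2, convergence of the second derivatives forces
   sum_i |e^(z_i)|^(1/2) < 1. The Euler derivatives of a solution at a point satisfy
   theta_i^2 = e^(z_i) (sum_j theta_j)^2, and this inequality turns these relations into a
   contraction on words of given length, so a solution is determined by its 2^(m-1)
   square-free Euler derivatives at one point. For m = 2 the series terminates and any
   point with e^(z_1) <> 1 will do. *)
Require Import Defs.
From mathcomp Require Import all_boot all_order all_algebra finmap.
From mathcomp Require Import complex ring lra zify.
From mathcomp Require Import boolp classical_sets functions reals.
From mathcomp Require Import topology normedtype sequences derive exp trigo realfun.

Set Implicit Arguments.
Unset Strict Implicit.
Unset Printing Implicit Defensive.

Import Order.TTheory GRing.Theory Num.Theory.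
Import numFieldNormedType.Exports.
Import Normc.

Local Open Scope classical_set_scope.
Local Open Scope ring_scope.

(** * Unconditional sums *)

(** Convergence is assumed on [U] only pointwise and at s = 0, while differentiating the sum in z
    and s needs a margin around each point. The margin comes from moving inside the open set [U] to
    larger real parts of the z_i. For k <> 0 the numerator of H_k contains |s|^2, so its derivative
    along two distinct s_i, s_j at s = 0 is twice a term whose modulus is the weight of k; absolute
    convergence of this one series at the larger point dominates every series near the original one.
    For m = 2 there is no such pair: the convergence hypothesis then says nothing about e^(z_1), and
    the test point may have to be moved off e^(z_1) = 1. The strip is used because [U] need not be
    stable under translation of z by 2 pi i, whereas the margin condition depends on real parts
    only. Functions are measured by weighted l^1 norms of their Taylor coefficients, so that
    products, composition and termwise differentiation reduce to rearranging absolutely convergent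
    sums. Spanning is a count: 2^(m-1) independent solutions against 2^(m-1) functionals that
    separate solutions give an invertible square matrix. *)

Section Normc.
Variable R : realType.
Implicit Types (x y z : R[i]) (r : R).

Lemma normE z : `|z| = (normc z)%:C%C.
Proof. by case: z. Qed.

Lemma normc_ge0 z : 0 <= normc z.
Proof. by rewrite -lecR -normE normr_ge0. Qed.

Lemma normc_eq0 z : (normc z == 0) = (z == 0).
Proof.
apply/eqP/eqP => [/eq0_normc //|->]; exact: normc0.
Qed.

Lemma normcR r : normc r%:C%C = `|r|.
Proof. by rewrite /normc /= expr0n /= addr0 sqrtr_sqr. Qed.

Lemma normcX z k : normc (z ^+ k) = normc z ^+ k.
Proof. by elim: k => [|k IH]; rewrite ?expr0 ?normc1 // !exprS normcM IH. Qed.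

Lemma normc_nat k : normc k%:R = k%:R :> R.
Proof. by rewrite -(rmorph_nat (real_complex R)) normcR normr_nat. Qed.

Lemma normc_prod (I : Type) (s : seq I) (P : pred I) (F : I -> R[i]) :
  normc (\prod_(i <- s | P i) F i) = \prod_(i <- s | P i) normc (F i).
Proof. exact: (big_morph _ (@normcM R) (@normc1 R)). Qed.

Lemma normc_sum (I : Type) (s : seq I) (P : pred I) (F : I -> R[i]) :
  normc (\sum_(i <- s | P i) F i) <= \sum_(i <- s | P i) normc (F i).
Proof.
elim/big_rec2: _ => [|i x y _ H]; first by rewrite normc0.
exact: le_trans (le_normcD _ _) (lerD _ _).
Qed.

Lemma normc_distC x y : normc (x - y) = normc (y - x).
Proof. by rewrite -normcN opprB. Qed.

Lemma normc_Re z : `|complex.Re z| <= normc z.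
Proof. by rewrite -lecR -normE normc_ge_Re. Qed.

Lemma normc_Im z : `|complex.Im z| <= normc z.
Proof.
case: z => a b; rewrite /normc /= -[leLHS]ger0_norm // -sqrtr_sqr.
by apply: ler_wsqrtr; rewrite real_normK ?num_real // lerDr sqr_ge0.
Qed.

Lemma normc_le_ReIm z : normc z <= `|complex.Re z| + `|complex.Im z|.
Proof.
rewrite [z in normc z]complexE; apply: le_trans (le_normcD _ _) _.
by rewrite normcM !normcR /normc /= expr0n expr1n add0r sqrtr1 mul1r.
Qed.

End Normc.

Section Sums.
Variable R : realType.
Local Notation C := R[i].

(** The epsilon form of [has_sum], with moduli in [R] rather than in [R[i]] so that real arithmetic
    applies; the two agree by [has_sumE]. *)
Definition hs (I : choiceType) (a : I -> C) (l : C) :=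
  forall e : R, 0 < e -> exists F0 : {fset I}, forall F : {fset I},
    (F0 `<=` F)%fset -> normc (\sum_(i <- F) a i - l) < e.

Definition absb (I : choiceType) (a : I -> C) (M : R) :=
  forall F : {fset I}, \sum_(i <- F) normc (a i) <= M.

Lemma partial_sumE (I : choiceType) (a : I -> C) F :
  partial_sum a F = \sum_(i <- F) a i.
Proof. by rewrite /partial_sum big_seq_fsetE. Qed.

Lemma has_sumE (I : choiceType) (a : I -> C) l : has_sum a l <-> hs a l.
Proof.
rewrite /has_sum; split=> [H e e0|H].
  have e0' : 0 < e%:C%C by rewrite ltcR.
  move/cvgrPdist_lt: H => /(_ (@totally_filter I) _ e0')[F0 _ HF]; exists F0 => F FF.
  have := HF F FF; rewrite partial_sumE /= normE ltcR normc_distC //.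
apply/(@cvgrPdist_lt _ _ _ _ (@totally_filter I)) => e e0.
have Re : e = (complex.Re e)%:C%C by rewrite RRe_real // gtr0_real.
rewrite Re ltcR in e0 *; have [F0 HF0] := H _ e0.
exists F0 => // F /= FF; rewrite partial_sumE normE ltcR normc_distC; exact: HF0.
Qed.

Section OneFamily.
Variable I : choiceType.
Implicit Types (a b : I -> C) (F G : {fset I}) (l : C) (M : R).

Lemma normc_small_eq0 (z : C) : (forall e, 0 < e -> normc z <= e) -> z = 0.
Proof.
move=> H; apply/eqP; rewrite -normc_eq0; apply/eqP/le_anti.
rewrite normc_ge0 andbT; apply/ler_addgt0Pr => e e0; rewrite add0r; exact: H.
Qed.

Lemma hs_uniq a l l' : hs a l -> hs a l' -> l = l'.
Proof.
move=> H H'; apply/eqP; rewrite -subr_eq0; apply/eqP/normc_small_eq0 => e e0.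
have e20 : 0 < e / 2 by rewrite divr_gt0.
have [F0 H0] := H _ e20; have [F1 H1] := H' _ e20.
have {}H0 := H0 (F0 `|` F1)%fset (fsubsetUl _ _).
have {}H1 := H1 (F0 `|` F1)%fset (fsubsetUr _ _).
set S := \sum_(i <- _) _ in H0 H1.
have -> : l - l' = (S - l') - (S - l) by ring.
apply: le_trans (le_normcD _ _) _; rewrite normcN; lra.
Qed.

Lemma hs_ext a b l : a =1 b -> hs a l -> hs b l.
Proof. by move=> /funext ->. Qed.

Lemma hsD a b l m : hs a l -> hs b m -> hs (fun i => a i + b i) (l + m).
Proof.
move=> H H' e e0; have e20 : 0 < e / 2 by rewrite divr_gt0.
have [F0 H0] := H _ e20; have [F1 H1] := H' _ e20.
exists (F0 `|` F1)%fset => F; rewrite fsubUset => /andP[/H0 h0 /H1 h1].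
rewrite big_split /= opprD addrACA.
apply: le_lt_trans (le_normcD _ _) _; lra.
Qed.

Lemma hsZ a l c : hs a l -> hs (fun i => c * a i) (c * l).
Proof.
move=> H e e0; have c0 : 0 < normc c + 1 by have := normc_ge0 c; lra.
have [F0 H0] := H _ (divr_gt0 e0 c0).
exists F0 => F /H0 h; rewrite -mulr_sumr -mulrBr normcM.
rewrite ltr_pdivlMr // in h.
apply: le_lt_trans h; rewrite mulrC ler_wpM2l ?normc_ge0 //; lra.
Qed.

Lemma hsN a l : hs a l -> hs (fun i => - a i) (- l).
Proof.
by move=> /(hsZ (-1)); rewrite mulN1r; apply: hs_ext => i; rewrite mulN1r.
Qed.

Lemma hsB a b l m : hs a l -> hs b m -> hs (fun i => a i - b i) (l - m).
Proof. by move=> H /hsN; apply: hsD. Qed.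

Lemma hs0 : hs (fun _ : I => 0 : C) 0.
Proof.
by move=> e e0; exists fset0 => F _; rewrite big1 // subr0 normc0.
Qed.

Lemma hs_sum (T : Type) (s : seq T) (P : pred T) (f : T -> I -> C) (l : T -> C) :
  (forall t, P t -> hs (f t) (l t)) ->
  hs (fun i => \sum_(t <- s | P t) f t i) (\sum_(t <- s | P t) l t).
Proof.
move=> H; elim: s => [|t s IH].
  by rewrite big_nil; apply: hs_ext hs0 => i; rewrite big_nil.
rewrite big_cons; case: ifP => Pt.
  by apply: hs_ext (hsD (H t Pt) IH) => i; rewrite big_cons Pt.
by apply: hs_ext IH => i; rewrite big_cons Pt.
Qed.

Lemma hs_fin F a : (forall i, i \notin F -> a i = 0) -> hs a (\sum_(i <- F) a i).
Proof.
move=> H e e0; exists F => G FG.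
suff -> : \sum_(i <- G) a i = \sum_(i <- F) a i by rewrite subrr normc0.
by symmetry; apply: big_fset_incl => // i _ /H.
Qed.

Lemma hs1 i0 a : (forall i, i != i0 -> a i = 0) -> hs a (a i0).
Proof.
move=> H; rewrite -[a i0](big_seq_fset1 GRing.add i0).
by apply: hs_fin => i; rewrite inE => /H.
Qed.

Lemma ler_sum_fset (a : I -> R) F G : (forall i, 0 <= a i) -> (F `<=` G)%fset ->
  \sum_(i <- F) a i <= \sum_(i <- G) a i.
Proof.
move=> a0 FG; rewrite (big_fsetID _ (mem F) G) /=.
have -> : [fset x in G | x \in F]%fset = F.
  by apply/fsetP => x; rewrite !inE /= andb_idl // => /(fsubsetP FG).
by rewrite lerDl sumr_ge0.
Qed.

Lemma absb_ge0 a M : absb a M -> 0 <= M.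
Proof. by move/(_ fset0); rewrite big_nil. Qed.

Lemma absb_le a M M' : absb a M -> M <= M' -> absb a M'.
Proof. by move=> H MM F; exact: le_trans (H F) MM. Qed.

Lemma absb_le_fun a b M : (forall i, normc (b i) <= normc (a i)) -> absb a M ->
  absb b M.
Proof. by move=> H Ha F; apply: le_trans (Ha F); apply: ler_sum. Qed.

Lemma absb_norm a M l : absb a M -> hs a l -> normc l <= M.
Proof.
move=> Ha Hl; apply/ler_addgt0Pr => e e0; have [F HF] := Hl _ e0.
have {}HF := HF _ (fsubset_refl _).
have -> : l = \sum_(i <- F) a i - (\sum_(i <- F) a i - l) by ring.
apply: le_trans (le_normcD _ _) _; rewrite normcN; apply: lerD (ltW HF).
exact: le_trans (normc_sum _ _ _) (Ha F).
Qed.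

Lemma absb_hs_pos (b : I -> R) M : (forall i, 0 <= b i) ->
  (forall F : {fset I}, \sum_(i <- F) b i <= M) ->
  exists l : R, hs (fun i => (b i)%:C%C) l%:C%C.
Proof.
move=> b0 Hb; pose E := [set x | exists F : {fset I}, x = \sum_(i <- F) b i].
have E_sup : has_sup E.
  split; first by exists 0; exists fset0; rewrite big_nil.
  by exists M => _ [F ->].
exists (sup E) => e e0; have [_ [F0 ->] HF0] := sup_adherent e0 E_sup.
exists F0 => F FF; rewrite -rmorph_sum -rmorphB normcR.
have H1 := ler_sum_fset b0 FF.
have H2 : \sum_(i <- F) b i <= sup E by apply: ub_le_sup; [case: E_sup|exists F].
by rewrite ler0_norm ?opprB; lra.
Qed.

(** The positive and negative parts of the real and imaginary parts are four nonnegative families,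
    each summed by its supremum. *)
Lemma absb_hs a M : absb a M -> exists l, hs a l.
Proof.
move=> Ha.
have P (f : C -> R) : (forall z, 0 <= f z <= normc z) ->
    exists l : R, hs (fun i => (f (a i))%:C%C) l%:C%C.
  move=> Hf; apply: (@absb_hs_pos _ M) => [i|F]; first by case/andP: (Hf (a i)).
  by apply: le_trans (Ha F); apply: ler_sum => i _; case/andP: (Hf (a i)).
have mx (x y : R) : `|x| <= y -> 0 <= Num.max x 0 <= y.
  by move=> H; rewrite le_max lexx orbT ge_max (le_trans (ler_norm x) H)
    (le_trans (normr_ge0 x) H).
have [|l1 H1] := P (fun z => Num.max (complex.Re z) 0).
  by move=> z; apply: mx; exact: normc_Re.
have [|l2 H2] := P (fun z => Num.max (- complex.Re z) 0).
  by move=> z; apply: mx; rewrite normrN; exact: normc_Re.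
have [|l3 H3] := P (fun z => Num.max (complex.Im z) 0).
  by move=> z; apply: mx; exact: normc_Im.
have [|l4 H4] := P (fun z => Num.max (- complex.Im z) 0).
  by move=> z; apply: mx; rewrite normrN; exact: normc_Im.
exists (l1%:C%C - l2%:C%C + 'i%C * (l3%:C%C - l4%:C%C)).
apply: hs_ext (hsD (hsB H1 H2) (hsZ 'i%C (hsB H3 H4))) => i /=.
have E (x : R) : Num.max x 0 - Num.max (- x) 0 = x.
  by rewrite /Num.max; case: (ltrP x 0); case: (ltrP (- x) 0); lra.
by rewrite -!rmorphB /= !E -complexE.
Qed.

(** Finite sums disjoint from [F0] have modulus at most 2. Keeping only the indices where the real
    (or imaginary) part has a given sign makes such a sum equal to the sum of absolute values; four
    such parts give the constant 8. *)
Lemma hs_absb a l : hs a l -> exists M, absb a M.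
Proof.
move=> H; have [F0 H0] := H _ ltr01.
pose S := \sum_(i <- F0) normc (a i).
have tail G : [disjoint F0 & G]%fset -> normc (\sum_(i <- G) a i) <= 2.
  move=> dis; have h0 := H0 _ (fsubset_refl F0).
  have h1 := H0 _ (fsubsetUl F0 G).
  have EU : \sum_(i <- (F0 `|` G)%fset) a i = \sum_(i <- F0) a i + \sum_(i <- G) a i.
    rewrite (big_fsetID _ (mem F0)) /=; congr (_ + _); apply: eq_fbigl => x.
      by rewrite !inE; case: (x \in F0); rewrite ?andbF.
    rewrite !inE; case: (boolP (x \in F0)) => [xF|_]; rewrite ?andbT //.
    by rewrite andbF; apply/esym/negbTE; move/fdisjointP: dis; apply.
  rewrite EU in h1.
  set s := \sum_(i <- F0) _ in h0 h1; set t := \sum_(i <- G) _ in h1 *.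
  have -> : t = (s + t - l) - (s - l) by ring.
  by apply: le_trans (le_normcD _ _) _; rewrite normcN; lra.
have part (f : C -> R) (c : R) : (f = @complex.Re R \/ f = @complex.Im R) -> `|c| = 1 ->
    forall G, [disjoint F0 & G]%fset ->
    \sum_(i <- G) Num.max (c * f (a i)) 0 <= 2.
  move=> Hf Hc G dis; pose G' := [fset i in G | 0 <= c * f (a i)]%fset.
  have dis' : [disjoint F0 & G']%fset.
    by apply: fdisjointWr dis; apply/fsubsetP => i; rewrite !inE => /andP[].
  apply: le_trans (tail _ dis').
  have -> : \sum_(i <- G) Num.max (c * f (a i)) 0 = \sum_(i <- G') c * f (a i).
    rewrite -big_fset_condE /=.
    rewrite [LHS](bigID (fun i => 0 <= c * f (a i))) /= [X in _ + X]big1 ?addr0.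
      by apply: eq_bigr => i h; rewrite max_l.
    by move=> i; rewrite -ltNge => h; rewrite max_r // ltW.
  rewrite -mulr_sumr; apply: le_trans (ler_norm _) _; rewrite normrM Hc mul1r.
  by case: Hf => ->; rewrite -raddf_sum; [exact: normc_Re|exact: normc_Im].
have E (x : R) : `|x| = Num.max (1 * x) 0 + Num.max (-1 * x) 0.
  rewrite mul1r mulN1r /Num.max; case: (ler0P x); case: (ltrP x 0);
  by case: (ltrP (- x) 0); lra.
exists (S + 8%:R) => G; rewrite (big_fsetID _ (mem F0)) /=; apply: lerD.
  apply: ler_sum_fset => [i|]; first exact: normc_ge0.
  by apply/fsubsetP => i; rewrite !inE => /andP[].
set G' := [fset _ in _ | _]%fset.
have dis : [disjoint F0 & G']%fset.
  by apply/fdisjointP => i iF; rewrite !inE /= iF andbF.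
apply: le_trans (_ : \sum_(i <- G') (`|complex.Re (a i)| + `|complex.Im (a i)|) <= _).
  by apply: ler_sum => i _; exact: normc_le_ReIm.
rewrite big_split /=.
under eq_bigr do rewrite E; rewrite big_split /=.
under [X in _ + X]eq_bigr do rewrite E; rewrite big_split /=.
have n1 : `|1 : R| = 1 by rewrite normr1.
have nN1 : `|-1 : R| = 1 by rewrite normrN1.
have h1 := part _ _ (or_introl erefl) n1 _ dis.
have h2 := part _ _ (or_introl erefl) nN1 _ dis.
have h3 := part _ _ (or_intror erefl) n1 _ dis.
have h4 := part _ _ (or_intror erefl) nN1 _ dis.
lra.
Qed.

Lemma absb_tail a M : absb a M -> forall e, 0 < e ->
  exists F0 : {fset I}, absb (fun i => if i \in F0 then 0 else a i) e.
Proof.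
move=> Ha e e0; pose E := [set x | exists F : {fset I}, x = \sum_(i <- F) normc (a i)].
have E_sup : has_sup E.
  split; first by exists 0; exists fset0; rewrite big_nil.
  by exists M => _ [F ->].
have [_ [F0 ->] HF0] := sup_adherent e0 E_sup; exists F0 => G.
have : \sum_(i <- (F0 `|` G)%fset) normc (a i) <= sup E.
  by apply: ub_le_sup; [case: E_sup|exists (F0 `|` G)%fset].
rewrite (big_fsetID _ (mem F0)) /=.
have -> : [fset x in (F0 `|` G)%fset | x \in F0]%fset = F0.
  by apply/fsetP => x; rewrite !inE; case: (x \in F0); rewrite ?andbF.
have -> : [fset x in (F0 `|` G)%fset | x \notin F0]%fset = [fset x in G | x \notin F0]%fset.
  by apply/fsetP => x; rewrite !inE; case: (x \in F0); rewrite ?andbF.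
move=> h; rewrite (big_fsetID _ (mem F0) G) /= [X in X + _]big1_seq ?add0r; last first.
  by move=> i /andP[_]; rewrite !inE => /andP[_ /= ->]; rewrite normc0.
rewrite (_ : \sum_(i <- [fset x in G | x \notin F0]%fset) normc (if i \in F0 then 0 else a i)
  = \sum_(i <- [fset x in G | x \notin F0]%fset) normc (a i)); first by lra.
by apply: eq_fbigr => i; rewrite !inE => /andP[_ /= /negbTE ->].
Qed.

Lemma absb_fin F a : (forall i, i \notin F -> a i = 0) ->
  absb a (\sum_(i <- F) normc (a i)).
Proof.
move=> H G; rewrite (big_fsetID _ (mem F)) /= [X in _ + X]big1_seq ?addr0.
  apply: ler_sum_fset => [i|]; first exact: normc_ge0.
  by apply/fsubsetP => i; rewrite !inE => /andP[].
by move=> i /andP[_]; rewrite !inE => /andP[_ /= /H ->]; rewrite normc0.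
Qed.

Lemma absbD a b M M' : absb a M -> absb b M' -> absb (fun i => a i + b i) (M + M').
Proof.
move=> H H' F; apply: le_trans (lerD (H F) (H' F)); rewrite -big_split /=.
by apply: ler_sum => i _; exact: le_normcD.
Qed.

Lemma absbZ a M c : absb a M -> absb (fun i => c * a i) (normc c * M).
Proof.
move=> H F; under eq_bigr do rewrite normcM.
by rewrite -mulr_sumr ler_wpM2l ?normc_ge0.
Qed.

End OneFamily.

Lemma absb_inj (I J : choiceType) (f : J -> I) (a : I -> C) M :
  injective f -> absb a M -> absb (a \o f) M.
Proof.
move=> inj_f Ha F; have := Ha [fset f x | x in F]%fset.
rewrite big_imfset //= => x y _ _; exact: inj_f.
Qed.

(** Summation by fibres. For finite [G] the error is itself an unconditional sum, of the family that
    is 0 where [p i] lies in [G] and [- a i] elsewhere; if [G] contains the image of [F0] this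
    family is dominated by the tail of [a] off [F0]. *)
Lemma hs_fiber (I J : choiceType) (p : I -> J) (a : I -> C) l (b : J -> C) :
  hs a l -> (forall j, hs (fun i => if p i == j then a i else 0) (b j)) -> hs b l.
Proof.
move=> Hl Hb e e0; have [M Ha] := hs_absb Hl.
have [F0 H0] := absb_tail Ha (divr_gt0 e0 (ltr0n _ 2)).
exists [fset p i | i in F0]%fset => G FG.
have {}Hb := hs_sum (enum_fset G) (P := predT) (fun j _ => Hb j).
have := hsB Hb Hl => Hd; apply: le_lt_trans (absb_norm _ Hd) (_ : e / 2 < e); last lra.
apply: absb_le_fun H0 => i; case: (boolP (p i \in G)) => [pG|pG].
  rewrite (bigD1_seq (p i)) ?fset_uniq //= eqxx big1 ?addr0 ?subrr ?normc0 ?normc_ge0 //.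
  by move=> j /negbTE; rewrite eq_sym => ->.
have -> : i \in F0 = false.
  by apply: contraNF pG => iF; apply: (fsubsetP FG); apply/imfsetP; exists i.
rewrite big1_seq ?sub0r ?normcN // => j /andP[_ jG].
by case: eqP => // pij; rewrite pij jG in pG.
Qed.

(** Multiplying each [b j] by a number [u (b j)] of modulus at most 1 turns the sum of the moduli
    into a single sum dominated by [a]. *)
Lemma absb_fiber (I J : choiceType) (p : I -> J) (a : I -> C) M (b : J -> C) :
  absb a M -> (forall j, hs (fun i => if p i == j then a i else 0) (b j)) -> absb b M.
Proof.
move=> Ha Hb G; pose u z : C := if z == 0 then 0 else (normc z)%:C%C / z.
have uE z : u z * z = (normc z)%:C%C.
  by rewrite /u; case: eqP => [->|/eqP z0]; rewrite ?mul0r ?normc0 // divfK.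
have u1 z : normc (u z) <= 1.
  rewrite /u; case: eqP => [_|/eqP z0]; first by rewrite normc0.
  by rewrite normcM normcV normcR ger0_norm ?normc_ge0 // divff // normc_eq0.
have H := hs_sum (enum_fset G) (P := predT) (fun j _ => hsZ (u (b j)) (Hb j)).
have {H} := absb_norm _ H => /(_ M).
under [X in normc X]eq_bigr do rewrite uE.
rewrite -rmorph_sum normcR ger0_norm; last by apply: sumr_ge0 => j _; exact: normc_ge0.
apply; apply: absb_le_fun Ha => i; case: (boolP (p i \in G)) => [pG|pG].
  rewrite (bigD1_seq (p i)) ?fset_uniq //= eqxx big1 ?addr0.
    by rewrite normcM ler_piMl ?normc_ge0.
  by move=> j /negbTE; rewrite eq_sym => ->; rewrite mulr0.
rewrite big1_seq ?normc0 ?normc_ge0 // => j /andP[_ jG].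
by case: eqP => [pij|]; rewrite ?mulr0 //; rewrite pij jG in pG.
Qed.

Lemma hs_inj (I J : choiceType) (f : J -> I) (a : I -> C) l :
  injective f -> (forall i, (forall j, f j != i) -> a i = 0) ->
  hs (a \o f) l -> hs a l.
Proof.
move=> inj_f H0 Hl; apply: (hs_fiber (p := f) Hl) => i.
have [[j fj]|Hn] := pselect (exists j, f j = i).
  rewrite -fj; have := @hs1 J j (fun j' => if f j' == f j then (a \o f) j' else 0).
  by rewrite eqxx; apply => j' /negbTE jj; rewrite (inj_eq inj_f) jj.
rewrite H0 => [|j]; last by apply/eqP => fj; apply: Hn; exists j.
apply: hs_ext (@hs0 _) => j; case: eqP => // fj; by case: Hn; exists j.
Qed.

Lemma absb_pair (I J : choiceType) (a : I -> J -> C) (m : I -> R) M :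
  (forall i, absb (a i) (m i)) -> (forall F : {fset I}, \sum_(i <- F) m i <= M) ->
  absb (fun p : I * J => a p.1 p.2) M.
Proof.
move=> Ha Hm F.
pose F1 := [fset p.1 | p in F]%fset; pose F2 := [fset p.2 | p in F]%fset.
apply: le_trans (Hm F1); rewrite (partition_big_imfset _ (fun p : I * J => p.1)) /=.
apply: ler_sum => i _; apply: le_trans (Ha i [fset p.2 | p in F & p.1 == i]%fset).
rewrite big_imfset /=; last first.
  by move=> [i1 j1] [i2 j2] /= /andP[_ /eqP /= ->] /andP[_ /eqP /= ->] /= ->.
rewrite /= big_mkcond [leRHS]big_filter_cond /= -big_mkcondr /=.
under [leRHS]eq_bigl do rewrite andbT.
by apply: ler_sum => p /eqP ->.
Qed.

End Sums.

(** * Power series in several variables *)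

Section PowerSeries.
Variables (R : realType) (N : nat).
Local Notation C := R[i].
Local Notation V := 'cV[C]_N.
Local Notation MI := 'cV[nat]_N.
Implicit Types (a b x y : V) (p q : MI) (r d M : R) (f g : V -> C) (c : MI -> C).

Definition mono y p : C := \prod_j y j 0 ^+ p j 0.

Definition deg p : nat := (\sum_j p j 0%R)%N.

Definition mdl (j : 'I_N) (k : nat) : MI := \col_i (if i == j then k else 0)%N.

Definition close a r x := forall j, normc (x j 0 - a j 0) <= r.

(** [M] bounds the l^1 norm of the coefficients with weights r^|p|. This norm is submultiplicative
    and bounds the supremum on the closed polydisc, so radius and bound can be tracked together
    through every construction. *)
Definition PS a r M c f :=
  [/\ 0 < r, absb (fun p => c p * (r ^+ deg p)%:C%C) M &
      forall x, close a r x -> hs (fun p => c p * mono (x - a) p) (f x)].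

Definition PB a r M f := exists c, PS a r M c f.

Definition hol_at a f := exists r M, PB a r M f.

Lemma monoD y p q : mono y (p + q) = mono y p * mono y q.
Proof. by rewrite -big_split /=; apply: eq_bigr => j _; rewrite mxE exprD. Qed.

Lemma degD p q : deg (p + q) = (deg p + deg q)%N.
Proof. by rewrite -big_split /=; apply: eq_bigr => j _; rewrite mxE. Qed.

Lemma mono0 y : mono y 0 = 1.
Proof. by rewrite /mono big1 // => j _; rewrite mxE expr0. Qed.

Lemma deg0 : deg 0 = 0%N.
Proof. by rewrite /deg big1 // => j _; rewrite mxE. Qed.

Lemma mono_mdl y j k : mono y (mdl j k) = y j 0 ^+ k.
Proof.
rewrite /mono (bigD1 j) //= big1 ?mulr1 => [|i /negbTE ij].
  by rewrite mxE eqxx.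
by rewrite mxE ij expr0.
Qed.

Lemma deg_mdl j k : deg (mdl j k) = k.
Proof.
rewrite /deg (bigD1 j) //= big1 ?addn0 => [|i /negbTE ij].
  by rewrite mxE eqxx.
by rewrite mxE ij.
Qed.

Lemma deg_eq0 p : (deg p == 0%N) = (p == 0).
Proof.
apply/idP/eqP => [|->]; last by rewrite deg0.
rewrite /deg sum_nat_eq0 => /forallP H; apply/colP => j; rewrite mxE.
exact/eqP/(implyP (H j)).
Qed.

Lemma mdl_split p j : (0 < p j 0%R)%N -> exists q, p = q + mdl j 1.
Proof.
move=> H; exists (\col_i (if i == j then (p i 0).-1 else p i 0)).
apply/colP => i; rewrite !mxE; case: eqP => [->|_]; last by rewrite [RHS]addn0.
by rewrite [RHS]addn1 prednK.
Qed.

Lemma deg_gt0 p : (0 < deg p)%N -> exists j q, p = q + mdl j 1.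
Proof.
rewrite lt0n /deg sum_nat_eq0 negb_forall => /existsP[j]; rewrite -lt0n.
by move=> /mdl_split[q ->]; exists j, q.
Qed.

Lemma normc_mono y p r : (forall j, normc (y j 0) <= r) -> normc (mono y p) <= r ^+ deg p.
Proof.
move=> H; rewrite normc_prod -prodrXr; apply: ler_prod => j _.
by rewrite normc_ge0 normcX lerXn2r // ?nnegrE ?normc_ge0 // (le_trans (normc_ge0 _) (H j)).
Qed.

Lemma closexx a r : 0 <= r -> close a r a.
Proof. by move=> r0 j; rewrite subrr normc0. Qed.

Lemma close_trans a b x r d : close a r b -> close b d x -> close a (r + d) x.
Proof.
move=> H1 H2 j; have -> : x j 0 - a j 0 = (b j 0 - a j 0) + (x j 0 - b j 0) by ring.
exact: le_trans (le_normcD _ _) (lerD (H1 j) (H2 j)).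
Qed.

Lemma close_sym a x r : close a r x -> close x r a.
Proof. by move=> H j; rewrite normc_distC. Qed.

Lemma close_le a x r d : r <= d -> close a r x -> close a d x.
Proof. by move=> H K j; exact: le_trans (K j) H. Qed.

Lemma nbhs_close a (P : set V) : nbhs a P <-> exists2 r, 0 < r & forall x, close a r x -> P x.
Proof.
split=> [/nbhs_ballP[e /= e0 H]|[r r0 H]].
  have Re : e = (complex.Re e)%:C%C by rewrite RRe_real // gtr0_real.
  rewrite Re ltcR in e0; exists (complex.Re e / 2); first by rewrite divr_gt0.
  move=> x Hx; apply: H; split => [|i j]; first by rewrite Re ltcR.
  rewrite (ord1 j) /ball /= Re normE ltcR normc_distC.
  by apply: le_lt_trans (Hx i) _; rewrite ltr_pdivrMr // ltr_pMr ?ltr1n.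
apply/nbhs_ballP; exists r%:C%C => /=; first by rewrite ltcR.
move=> x [_ Hx]; apply: H => j; have := Hx j 0.
by rewrite /ball /= normE ltcR normc_distC => /ltW.
Qed.

Lemma open_close (U : set V) a : open U -> U a ->
  exists2 r, 0 < r & forall x, close a r x -> U x.
Proof. by move=> oU Ua; apply/nbhs_close; exact: open_nbhs_nbhs. Qed.

Lemma close_open (U : set V) :
  (forall a, U a -> exists2 r, 0 < r & forall x, close a r x -> U x) -> open U.
Proof.
by move=> H; rewrite openE => a /H; rewrite -(nbhs_close a U).
Qed.

Lemma absb_sub (I : choiceType) (P : pred I) (u : I -> C) M :
  absb u M -> absb (fun i => if P i then u i else 0) M.
Proof. by apply: absb_le_fun => i; case: ifP => // _; rewrite normc0 normc_ge0. Qed.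

(** Here a monomial may occur many times: grouping by the exponent [e] turns any absolutely
    convergent family of monomials into a power series of the same norm bound. *)
Lemma gps (I : choiceType) (c0 : I -> C) (e : I -> MI) a r M f : 0 < r ->
  absb (fun i => c0 i * (r ^+ deg (e i))%:C%C) M ->
  (forall x, close a r x -> hs (fun i => c0 i * mono (x - a) (e i)) (f x)) ->
  exists2 c, PS a r M c f & forall p, hs (fun i => if e i == p then c0 i else 0) (c p).
Proof.
move=> r0 Ha Hf.
have rp p : (r ^+ deg p)%:C%C != 0 by rewrite fmorph_eq0 expf_neq0 // gt_eqF.
have H p : exists l, hs (fun i => if e i == p then c0 i else 0) l.
  apply: (@absb_hs _ _ _ (normc ((r ^+ deg p)%:C%C)^-1 * M)).
  apply: absb_le_fun (absbZ ((r ^+ deg p)%:C%C)^-1 (absb_sub (fun i => e i == p) Ha)) => i.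
  by case: eqP => [->|_]; rewrite ?mulr0 // mulrC mulfK.
have [c Hc] := choice H; exists c => //; split=> //.
  apply: (absb_fiber (p := e) Ha) => p; rewrite mulrC.
  apply: hs_ext (hsZ (r ^+ deg p)%:C%C (Hc p)) => i.
  by case: eqP => [->|_]; rewrite ?mulr0 // mulrC.
move=> x /Hf Hx; apply: (hs_fiber (p := e) Hx) => p; rewrite mulrC.
apply: hs_ext (hsZ _ (Hc p)) => i.
by case: eqP => [->|_]; rewrite ?mulr0 // mulrC.
Qed.

Lemma PS_ext a r M c f g : (forall x, close a r x -> f x = g x) ->
  PS a r M c f -> PS a r M c g.
Proof. by move=> E [r0 Ha Hf]; split=> // x Hx; rewrite -E //; exact: Hf. Qed.

Lemma PB_ext a r M f g : (forall x, close a r x -> f x = g x) ->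
  PB a r M f -> PB a r M g.
Proof. by move=> E [c /(PS_ext E)]; exists c. Qed.

Lemma PB_eq a r M f g : f =1 g -> PB a r M f -> PB a r M g.
Proof. by move=> E; apply: PB_ext. Qed.

Lemma PB_gt0 a r M f : PB a r M f -> 0 < r.
Proof. by case=> c []. Qed.

Lemma PS_le a r M M' c f : PS a r M c f -> M <= M' -> PS a r M' c f.
Proof. by move=> [r0 Ha Hf] MM; split=> //; exact: absb_le Ha MM. Qed.

Lemma PB_le a r M M' f : PB a r M f -> M <= M' -> PB a r M' f.
Proof. by move=> [c H] MM; exists c; exact: PS_le H MM. Qed.

Lemma PB_ge0 a r M f : PB a r M f -> 0 <= M.
Proof. by case=> c [_ /absb_ge0]. Qed.

Lemma PS_shrink a r d M c f : 0 < d -> d <= r -> PS a r M c f -> PS a d M c f.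
Proof.
move=> d0 dr [r0 Ha Hf]; split=> //.
  apply: absb_le_fun Ha => p; rewrite !normcM ler_wpM2l ?normc_ge0 // !normcR.
  by rewrite !ger0_norm ?exprn_ge0 ?(ltW d0, ltW r0) // lerXn2r // ?nnegrE ltW.
by move=> x Hx; apply: Hf; exact: close_le Hx.
Qed.

(** Without constant term each weight d^|p| is at most (d / r) r^|p|; this makes inner functions
    small enough to be substituted into a power series. *)
Lemma PS_shrink0 a r d M c f : 0 < d -> d <= r -> PS a r M c f -> c 0 = 0 ->
  PS a d (M * (d / r)) c f.
Proof.
move=> d0 dr H c0; have [_ Ha' Hf'] := PS_shrink d0 dr H; split=> //.
case: H => r0 Ha _; rewrite mulrC; have dr0 : 0 <= d / r by rewrite divr_ge0 ?ltW.
rewrite -(ger0_norm dr0) -normcR; apply: absb_le_fun (absbZ (d / r)%:C%C Ha) => p.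
have [->|p0] := eqVneq p 0; first by rewrite c0 !mul0r normc0 normc_ge0.
rewrite mulrCA !normcM ler_wpM2l ?normc_ge0 // !normcR -normrM.
rewrite !ger0_norm ?mulr_ge0 ?invr_ge0 ?exprn_ge0 ?(ltW d0, ltW r0) //.
have : deg p != 0%N by rewrite deg_eq0.
case: (deg p) => // k _; rewrite !exprS mulrA divfK ?gt_eqF //.
by rewrite ler_wpM2l ?(ltW d0) // lerXn2r // ?nnegrE ltW.
Qed.

Lemma hs_pair_fst (I J : choiceType) (u : I -> J -> C) (m : I -> R) M (l : I -> C) L :
  (forall i, absb (u i) (m i)) -> (forall F : {fset I}, \sum_(i <- F) m i <= M) ->
  (forall i, hs (u i) (l i)) -> hs l L -> hs (fun p : I * J => u p.1 p.2) L.
Proof.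
move=> Hu Hm Hl HL; have Ha := absb_pair Hu Hm; have [L' HL'] := absb_hs Ha.
suff -> : L = L' by [].
apply: hs_uniq HL (hs_fiber (p := fst) HL' _) => i.
apply: (hs_inj (f := fun j => (i, j))) => [j j' []//|[i' j] H|].
  by case: eqP => //= ii; move: (H j); rewrite ii eqxx.
by apply: hs_ext (Hl i) => j /=; rewrite eqxx.
Qed.

(** The Weierstrass criterion for these norms. The coefficientwise conclusion is what yields
    termwise derivatives, since a first derivative at the centre is a coefficient. *)
Lemma PS_series (K : choiceType) (fk : K -> V -> C) (Mk : K -> R) (ck : K -> MI -> C)
    a r M f : 0 < r -> (forall k, PS a r (Mk k) (ck k) (fk k)) ->
  (forall F : {fset K}, \sum_(k <- F) Mk k <= M) ->
  (forall x, close a r x -> hs (fun k => fk k x) (f x)) ->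
  exists2 c, PS a r M c f & forall p, hs (fun k => ck k p) (c p).
Proof.
move=> r0 Hk HM Hf.
have Ha : absb (fun i : K * MI => ck i.1 i.2 * (r ^+ deg i.2)%:C%C) M.
  apply: (@absb_pair _ _ _ (fun k p => ck k p * (r ^+ deg p)%:C%C) Mk _ _ HM) => k.
  by case: (Hk k).
have Hs x : close a r x -> hs (fun i : K * MI => ck i.1 i.2 * mono (x - a) i.2) (f x).
  move=> Hx; apply: (@hs_pair_fst _ _ (fun k p => ck k p * mono (x - a) p) Mk _ _ _ _ HM _ (Hf x Hx)) => k; case: (Hk k) => _ Hak Hfk; last exact: Hfk.
  apply: absb_le_fun Hak => p; rewrite !normcM ler_wpM2l ?normc_ge0 //.
  rewrite normcR ger0_norm ?exprn_ge0 ?(ltW r0) //; apply: normc_mono => j; rewrite !mxE; exact: Hx.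
have [c Hc Hcp] := gps r0 Ha Hs; exists c => // p.
apply: (hs_fiber (p := fst) (Hcp p)) => k.
have := @hs1 _ _ (k, p) (fun i : K * MI => if i.1 == k then if i.2 == p then ck i.1 i.2 else 0 else 0).
rewrite /= !eqxx => H1; apply: hs_ext (H1 _) => [[k' p'] //|[k' p']] /=.
by rewrite xpair_eqE; case: eqP => // _; case: eqP.
Qed.

Lemma PB_series (K : choiceType) (fk : K -> V -> C) (Mk : K -> R) a r M f : 0 < r ->
  (forall k, PB a r (Mk k) (fk k)) -> (forall F : {fset K}, \sum_(k <- F) Mk k <= M) ->
  (forall x, close a r x -> hs (fun k => fk k x) (f x)) -> PB a r M f.
Proof.
move=> r0 /choice[ck Hk] HM Hf.
by have [c Hc _] := PS_series r0 Hk HM Hf; exists c.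
Qed.

Lemma PS_cst a r z : 0 < r -> PS a r (normc z) (fun p => if p == 0 then z else 0) (fun=> z).
Proof.
move=> r0; have E0 (w : MI -> C) p : p != 0 -> (if p == 0 then z else 0) * w p = 0.
  by move=> /negbTE ->; rewrite mul0r.
split=> // [|x _].
  apply: absb_le (absb_fin (F := [fset 0]%fset) _) _ => [p|]; first by rewrite inE => /(E0 (fun p => (r ^+ deg p)%:C%C)).
  by rewrite big_seq_fset1 eqxx deg0 expr0 mulr1.
have := hs1 (E0 (mono (x - a))); by rewrite eqxx mono0 mulr1.
Qed.

Lemma PB_cst a r z : 0 < r -> PB a r (normc z) (fun=> z).
Proof. by move=> r0; eexists; exact: PS_cst. Qed.

Lemma PB_univ i (cs : nat -> C) (h : C -> C) a r M : 0 < r ->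
  absb (fun k => cs k * (r ^+ k)%:C%C) M ->
  (forall u, normc u <= r -> hs (fun k => cs k * u ^+ k) (h u)) ->
  PB a r M (fun x => h (x i 0 - a i 0)).
Proof.
move=> r0 Ha Hh.
have [||c Hc _] := @gps nat cs (mdl i) a r M (fun x => h (x i 0 - a i 0)) r0.
- by apply: absb_le_fun Ha => k; rewrite deg_mdl.
- by move=> x Hx; apply: hs_ext (Hh _ (Hx i)) => k; rewrite mono_mdl !mxE.
- by exists c.
Qed.

Lemma PB_coord i a r z : 0 < r -> PB a r (normc (a i 0 - z) + r) (fun x => x i 0 - z).
Proof.
move=> r0; pose cs k : C := if k == 0%N then a i 0 - z else if k == 1%N then 1 else 0.
have cs0 (w : nat -> C) k : k \notin [fset 0%N; 1%N]%fset -> cs k * w k = 0.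
  by rewrite !inE /cs; case: k => [|[|k]] // _; rewrite mul0r.
have E (f : nat -> C) : \sum_(k <- [fset 0%N; 1%N]%fset) f k = f 0%N + f 1%N.
  by rewrite big_fsetU1 ?big_seq_fset1 // inE.
apply: PB_eq (@PB_univ i cs (fun u => a i 0 - z + u) a r _ r0 _ _) => [x /=|F|u _].
- by ring.
- apply: le_trans (absb_fin (cs0 _) F) _.
  rewrite big_fsetU1 ?inE // big_seq_fset1.
  have [-> ->] : cs 0%N = a i 0 - z /\ cs 1%N = 1 by [].
  rewrite !normcM !normcR expr0 expr1 !normr1 mulr1 mul1r.
  by rewrite ger0_norm // ltW.
- have := hs_fin (cs0 (fun k => u ^+ k)); by rewrite E /cs /= expr0 mulr1 mul1r expr1.
Qed.

Lemma PB_add a r M M' f g : PB a r M f -> PB a r M' g ->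
  PB a r (M + M') (fun x => f x + g x).
Proof.
move=> [c [r0 Ha Hf]] [d [_ Hb Hg]]; exists (fun p => c p + d p); split=> //.
  by apply: absb_le_fun (absbD Ha Hb) => p; rewrite mulrDl.
by move=> x Hx; apply: hs_ext (hsD (Hf x Hx) (Hg x Hx)) => p; rewrite mulrDl.
Qed.

Lemma PB_mul a r M M' f g : PB a r M f -> PB a r M' g ->
  PB a r (M * M') (fun x => f x * g x).
Proof.
move=> [c [r0 Ha Hf]] [d [_ Hb Hg]].
have H : absb (fun i : MI * MI => c i.1 * d i.2 * (r ^+ deg (i.1 + i.2))%:C%C) (M * M').
  apply: absb_le_fun (@absb_pair _ _ _ (fun p q => (c p * (r ^+ deg p)%:C%C) * (d q * (r ^+ deg q)%:C%C))
    (fun p => normc (c p * (r ^+ deg p)%:C%C) * M') _ _ _) => [[p q]|p|F] /=.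
  - by rewrite degD exprD rmorphM mulrACA.
  - exact: absbZ.
  - by rewrite -mulr_suml ler_wpM2r ?(absb_ge0 Hb).
have [|e He _] := @gps _ (fun i : MI * MI => c i.1 * d i.2) (fun i => i.1 + i.2) a r _
  (fun x => f x * g x) r0 H; last by exists e.
move=> x Hx.
apply: hs_ext (@hs_pair_fst _ _ (fun p q => c p * mono (x - a) p * (d q * mono (x - a) q))
    (fun p => normc (c p * (r ^+ deg p)%:C%C) * M') (M * M') (fun p => c p * mono (x - a) p * g x) _ _ _ _ _).
- by move=> [p q] /=; rewrite monoD mulrACA.
- have E (h : MI -> C) p : normc (h p * mono (x - a) p) <= normc (h p * (r ^+ deg p)%:C%C).
    rewrite !normcM ler_wpM2l ?normc_ge0 // normcR ger0_norm ?exprn_ge0 ?(ltW r0) //.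
    by apply: normc_mono => j; rewrite !mxE; exact: Hx.
  move=> p; apply: absb_le (absbZ _ (absb_le_fun (E d) Hb)) _.
  by rewrite ler_wpM2r ?(absb_ge0 Hb).
- by move=> F; rewrite -mulr_suml ler_wpM2r ?(absb_ge0 Hb).
- by move=> p; apply: hsZ; exact: Hg.
- rewrite mulrC; apply: hs_ext (hsZ (g x) (Hf x Hx)) => p; exact: mulrC.
Qed.

Lemma PB_prod (T : Type) (s : seq T) (P : pred T) (h : T -> V -> C) (m : T -> R) a r : 0 < r ->
  (forall t, P t -> PB a r (m t) (h t)) ->
  PB a r (\prod_(t <- s | P t) m t) (fun x => \prod_(t <- s | P t) h t x).
Proof.
move=> r0 H; elim: s => [|t s IH].
  rewrite big_nil; apply: PB_eq (PB_le (PB_cst a 1 r0) _) => [x|]; rewrite ?big_nil //.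
  by rewrite normc1.
rewrite big_cons; case: ifP => Pt.
  by apply: PB_eq (PB_mul (H t Pt) IH) => x; rewrite big_cons Pt.
by apply: PB_eq IH => x; rewrite big_cons Pt.
Qed.

Lemma PB_sum (T : Type) (s : seq T) (P : pred T) (h : T -> V -> C) (m : T -> R) a r : 0 < r ->
  (forall t, P t -> PB a r (m t) (h t)) ->
  PB a r (\sum_(t <- s | P t) m t) (fun x => \sum_(t <- s | P t) h t x).
Proof.
move=> r0 H; elim: s => [|t s IH].
  rewrite big_nil; apply: PB_eq (PB_le (PB_cst a 0 r0) _) => [x|]; rewrite ?big_nil //.
  by rewrite normc0.
rewrite big_cons; case: ifP => Pt.
  by apply: PB_eq (PB_add (H t Pt) IH) => x; rewrite big_cons Pt.
by apply: PB_eq IH => x; rewrite big_cons Pt.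
Qed.

Lemma PB_exp a r M f k : PB a r M f -> PB a r (M ^+ k) (fun x => f x ^+ k).
Proof.
move=> H; have := @PB_prod _ (index_enum 'I_k) predT _ _ _ _ (PB_gt0 H) (fun _ _ => H).
by rewrite prodr_const card_ord; apply: PB_eq => x; rewrite prodr_const card_ord.
Qed.

Lemma PB_mono a b r d p : 0 < r -> close b d a ->
  PB a r ((d + r) ^+ deg p) (fun x => mono (x - b) p).
Proof.
move=> r0 Hd; rewrite -prodrXr.
apply: PB_prod => // j _; apply: PB_exp; apply: PB_eq (PB_le (PB_coord j a (b j 0) r0) _) => [x|].
  by rewrite !mxE.
by rewrite lerD2r; exact: Hd.
Qed.

Lemma PB_norm a r M f x : PB a r M f -> close a r x -> normc (f x) <= M.
Proof.
move=> [c [r0 Ha Hf]] Hx; apply: absb_norm (Hf x Hx); apply: absb_le_fun Ha => p.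
rewrite !normcM ler_wpM2l ?normc_ge0 // normcR ger0_norm ?exprn_ge0 ?(ltW r0) //.
by apply: normc_mono => j; rewrite !mxE; exact: Hx.
Qed.

(** About [b], the monomial (x - a)^p has norm at most (d + (r - d))^|p| = r^|p| on radius [r - d],
    so the bound [M] is unchanged. *)
Lemma PB_recenter a b r d M f : PB a r M f -> close a d b -> 0 <= d -> d < r ->
  PB b (r - d) M f.
Proof.
move=> [c [r0 Ha Hf]] Hb d0 dr; have rd0 : 0 < r - d by rewrite subr_gt0.
apply: (@PB_series _ (fun p x => c p * mono (x - a) p) (fun p => normc (c p) * r ^+ deg p)) => //.
- move=> p; apply: PB_mul (PB_cst _ _ rd0) _.
  by have := PB_mono p rd0 Hb; rewrite subrKC.
- move=> F; apply: le_trans (Ha F); apply: ler_sum => p _.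
  by rewrite normcM normcR ger0_norm // exprn_ge0 // ltW.
- by move=> x Hx; apply: Hf; have := close_trans Hb Hx; rewrite subrKC.
Qed.

End PowerSeries.

(** * Differentiation of power series *)

Section Derivatives.
Variables (R : realType) (N : nat).
Local Notation C := R[i].
Local Notation V := 'cV[C]_N.
Local Notation MI := 'cV[nat]_N.
Implicit Types (a x : V) (p q : MI) (r d M : R) (f g : V -> C) (c : MI -> C).

Lemma PS_val a r M c f : PS a r M c f -> f a = c 0.
Proof.
move=> [r0 _ /(_ a (closexx _ (ltW r0))) H]; apply: hs_uniq H _.
have := @hs1 _ _ 0 (fun p => c p * mono (a - a) p); rewrite mono0 mulr1; apply => p p0.
have : (0 < deg p)%N by rewrite lt0n deg_eq0.
by move=> /deg_gt0[j [q ->]]; rewrite subrr monoD mono_mdl mxE expr1 !mulr0.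
Qed.

(** Only degrees at least 2 remain after the subtraction, and there d^|p| <= (d / r)^2 r^|p| because
    d <= r. *)
Lemma PS_taylor a r M c f d x : PS a r M c f -> 0 <= d -> d <= r -> close a d x ->
  normc (f x - f a - \sum_j c (mdl j 1) * (x j 0 - a j 0)) <= M * (d / r) ^+ 2.
Proof.
move=> H d0 dr Hx; rewrite (PS_val H); case: H => r0 Ha Hf.
have {}Hf := Hf x (close_le dr Hx).
have H0 : hs (fun p => if p == 0 then c p else 0) (c 0).
  by have := @hs1 _ _ 0 (fun p => if p == 0 then c p else 0); rewrite eqxx; apply => p /negbTE ->.
have Hj j : hs (fun p => if p == mdl j 1 then c p * (x j 0 - a j 0) else 0)
    (c (mdl j 1) * (x j 0 - a j 0)).
  have := @hs1 _ _ (mdl j 1) (fun p => if p == mdl j 1 then c p * (x j 0 - a j 0) else 0).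
  by rewrite eqxx; apply => p /negbTE ->.
have := hsB (hsB Hf H0) (hs_sum (index_enum 'I_N) (P := predT) (fun j _ => Hj j)).
set u := (fun p => _); move=> Hu; apply: absb_norm Hu; rewrite mulrC.
have dr0 : 0 <= (d / r) ^+ 2 by rewrite sqr_ge0.
rewrite -(ger0_norm dr0) -normcR; apply: absb_le_fun (absbZ _ Ha) => p; rewrite /u.
have sum0 : (forall j, p != mdl j 1) ->
    \sum_j (if p == mdl j 1 then c p * (x j 0 - a j 0) else 0) = 0.
  by move=> K; rewrite big1 // => j _; rewrite (negbTE (K j)).
have [p0|p0] := eqVneq p 0.
  subst p; rewrite mono0 mulr1 subrr sub0r sum0 ?oppr0 ?normc0 ?normc_ge0 //.
  by move=> j; rewrite eq_sym -deg_eq0 deg_mdl.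
have [p1|p1] := eqVneq (deg p) 1%N.
  have [|j [q E]] := @deg_gt0 _ p; first by rewrite p1.
  move: p1; rewrite E degD deg_mdl addn1 => -[/eqP]; rewrite deg_eq0 => /eqP ->.
  rewrite add0r subr0 mono_mdl expr1 !mxE (bigD1 j) //= eqxx big1 ?addr0.
    by rewrite subrr normc0 normc_ge0.
  move=> i /negbTE ij; case: eqP => // /colP /(_ j); rewrite !mxE eqxx eq_sym ij.
  by [].
rewrite subr0 sum0 ?subr0; last by move=> j; apply: contra_neq p1 => ->; rewrite deg_mdl.
rewrite mulrCA !normcM ler_wpM2l ?normc_ge0 // !normcR.
have Hm : normc (mono (x - a) p) <= d ^+ deg p.
  by apply: normc_mono => j; rewrite !mxE; exact: Hx.
apply: (le_trans Hm).
rewrite !ger0_norm ?dr0 ?exprn_ge0 ?(ltW r0) //.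
have : deg p != 0%N by rewrite deg_eq0.
case: (deg p) p1 => [|[|k]] // _ _.
have E z : z ^+ k.+2 = z ^+ 2 * z ^+ k :> R by rewrite -exprD.
rewrite !E mulrA; have -> : (d / r) ^+ 2 * r ^+ 2 = d ^+ 2.
  by rewrite -exprMn divfK // gt_eqF.
by rewrite ler_wpM2l ?exprn_ge0 // lerXn2r // ?nnegrE // ltW.
Qed.

Lemma PS_is_derive a r M c f j : PS a r M c f ->
  is_derive a (delta_mx j 0 : V) f (c (mdl j 1)).
Proof.
move=> H; have r0 : 0 < r by case: H.
have M0 : 0 <= M by case: H => _ /absb_ge0.
have E (h : C) : normc h <= r ->
    normc (f (h *: (delta_mx j 0 : V) + a) - f a - c (mdl j 1) * h) <= M * (normc h / r) ^+ 2.
  move=> hr; have := PS_taylor H (normc_ge0 h) hr (x := h *: delta_mx j 0 + a).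
  have -> : \sum_i c (mdl i 1) * ((h *: (delta_mx j 0 : V) + a) i 0 - a i 0) = c (mdl j 1) * h.
    rewrite (bigD1 j) //= big1 ?addr0 => [|i /negbTE ij]; rewrite !mxE.
      by rewrite !eqxx mulr1 addrK.
    by rewrite ij /= mulr0 add0r subrr mulr0.
  apply; move=> i; rewrite !mxE addrK eqxx andbT; case: (i == j).
    by rewrite mulr1.
  by rewrite mulr0 normc0 normc_ge0.
suff L : (fun h => h^-1 *: ((f \o shift a) (h *: (delta_mx j 0 : V)) - f a)) @ 0^' --> c (mdl j 1).
  by split; [apply/cvg_ex; exists (c (mdl j 1))|apply: cvg_lim L].
apply/cvgrPdist_le => e e0.
have Re : e = (complex.Re e)%:C%C by rewrite RRe_real // gtr0_real.
rewrite Re ltcR in e0; pose K := M / r ^+ 2.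
have K0 : 0 <= K by rewrite divr_ge0 // sqr_ge0.
have d0 : 0 < Num.min r (complex.Re e / (K + 1)).
  by rewrite lt_min r0 divr_gt0 // ltr_wpDl.
have Hn : \forall h \near (0 : C)^', `|h| < (Num.min r (complex.Re e / (K + 1)))%:C%C.
  by apply: dnbhs0_lt; rewrite ltcR.
near=> h.
have h0 : h != 0 by near: h; exact: nbhs_dnbhs_neq.
have : `|h| < (Num.min r (complex.Re e / (K + 1)))%:C%C by near: h.
rewrite normE ltcR lt_min => /andP[/ltW hr he]; rewrite Re normE lecR normc_distC.
have -> : h^-1 *: ((f \o shift a) (h *: (delta_mx j 0 : V)) - f a) - c (mdl j 1) =
    h^-1 * (f (h *: (delta_mx j 0 : V) + a) - f a - c (mdl j 1) * h).
  by rewrite [RHS]mulrBr mulrCA mulVf // mulr1.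
rewrite normcM normcV.
have nh : 0 < normc h by rewrite lt0r normc_eq0 h0 normc_ge0.
apply: le_trans (_ : (normc h)^-1 * (M * (normc h / r) ^+ 2) <= _).
  by rewrite ler_wpM2l ?invr_ge0 ?normc_ge0 //; exact: E.
have -> : (normc h)^-1 * (M * (normc h / r) ^+ 2) = K * normc h.
  by rewrite /K; field; rewrite !gt_eqF.
rewrite ltr_pdivlMr ?ltr_wpDl // in he.
apply: le_trans (ltW he); rewrite mulrC ler_wpM2l ?normc_ge0 //; lra.
Unshelve. all: by end_near.
Qed.

Lemma PS_pd1 a r M c f j : PS a r M c f -> pd f j a = c (mdl j 1).
Proof. by move=> /(PS_is_derive j) H; rewrite /pd derive_val. Qed.

Lemma hol_is_derive a f j : hol_at a f -> is_derive a (delta_mx j 0 : V) f (pd f j a).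
Proof. by move=> [r [M [c H]]]; rewrite (PS_pd1 j H); exact: PS_is_derive H. Qed.

Lemma pd_is_derive a f j l : is_derive a (delta_mx j 0 : V) f l -> pd f j a = l.
Proof. by move=> H; rewrite /pd derive_val. Qed.

Lemma pdD a f g j : hol_at a f -> hol_at a g ->
  pd (fun x => f x + g x) j a = pd f j a + pd g j a.
Proof.
move=> /(hol_is_derive j) Hf /(hol_is_derive j) Hg; exact: pd_is_derive.
Qed.

Lemma pdM a f g j : hol_at a f -> hol_at a g ->
  pd (fun x => f x * g x) j a = f a * pd g j a + pd f j a * g a.
Proof.
move=> /(hol_is_derive j) Hf /(hol_is_derive j) Hg; by rewrite [pd f j a * _]mulrC; exact: pd_is_derive.
Qed.

End Derivatives.

Section Calculus.
Variables (R : realType) (N : nat).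
Local Notation C := R[i].
Local Notation V := 'cV[C]_N.
Local Notation MI := 'cV[nat]_N.
Implicit Types (a b x y : V) (p q : MI) (r d M : R) (f g : V -> C) (c : MI -> C).

Lemma pd_near a r f g j : 0 < r -> (forall x, close a r x -> f x = g x) ->
  pd f j a = pd g j a.
Proof.
by move=> r0 E; apply: near_eq_derive; apply/nbhs_close; exists r.
Qed.

Lemma hol_near a r f g : 0 < r -> (forall x, close a r x -> f x = g x) ->
  hol_at a f -> hol_at a g.
Proof.
move=> r0 E [d [M [c H]]]; exists (Num.min r d), M, c.
have d0 : 0 < d by case: H.
apply: PS_ext (PS_shrink _ _ H) => [x Hx||]; last by rewrite ge_min lexx orbT.
  by apply: E; apply: close_le Hx; rewrite ge_min lexx.
by rewrite lt_min r0.
Qed.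

Lemma hol_eq a f g : f =1 g -> hol_at a f -> hol_at a g.
Proof. by move=> E; apply: (hol_near ltr01). Qed.

Lemma hol_cst a z : hol_at a (fun=> z).
Proof. by exists 1, (normc z); exact: PB_cst. Qed.

Lemma hol_coord a j : hol_at a (fun x => x j 0).
Proof.
exists 1, (normc (a j 0 - 0) + 1); apply: PB_eq (PB_coord j a 0 ltr01) => x.
by rewrite subr0.
Qed.

Lemma PB_common a f g r M r' M' : PB a r M f -> PB a r' M' g ->
  exists d, PB a d M f /\ PB a d M' g.
Proof.
move=> Hf Hg; exists (Num.min r r').
have d0 : 0 < Num.min r r' by rewrite lt_min (PB_gt0 Hf) (PB_gt0 Hg).
case: Hf Hg => [c Hf] [c' Hg]; split; [exists c|exists c'].
  by apply: PS_shrink Hf => //; rewrite ge_min lexx.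
by apply: PS_shrink Hg => //; rewrite ge_min lexx orbT.
Qed.

Lemma hol_add a f g : hol_at a f -> hol_at a g -> hol_at a (fun x => f x + g x).
Proof.
move=> [r [M Hf]] [r' [M' Hg]]; have [d [H H']] := PB_common Hf Hg.
by exists d, (M + M'); exact: PB_add.
Qed.

Lemma hol_mul a f g : hol_at a f -> hol_at a g -> hol_at a (fun x => f x * g x).
Proof.
move=> [r [M Hf]] [r' [M' Hg]]; have [d [H H']] := PB_common Hf Hg.
by exists d, (M * M'); exact: PB_mul.
Qed.

Lemma hol_scale a z f : hol_at a f -> hol_at a (fun x => z * f x).
Proof. by apply: hol_mul; exact: hol_cst. Qed.

Lemma hol_sub a f g : hol_at a f -> hol_at a g -> hol_at a (fun x => f x - g x).
Proof.
move=> Hf Hg; apply: hol_eq (hol_add Hf (hol_scale (-1) Hg)) => x.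
by rewrite mulN1r.
Qed.

Lemma hol_sum (T : Type) (s : seq T) (P : pred T) (h : T -> V -> C) a :
  (forall t, P t -> hol_at a (h t)) -> hol_at a (fun x => \sum_(t <- s | P t) h t x).
Proof.
move=> H; elim: s => [|t s IH].
  by apply: hol_eq (hol_cst a 0) => x; rewrite big_nil.
case Pt : (P t); last by apply: hol_eq IH => x; rewrite big_cons Pt.
by apply: hol_eq (hol_add (H t Pt) IH) => x; rewrite big_cons Pt.
Qed.

Lemma hol_prod (T : Type) (s : seq T) (P : pred T) (h : T -> V -> C) a :
  (forall t, P t -> hol_at a (h t)) -> hol_at a (fun x => \prod_(t <- s | P t) h t x).
Proof.
move=> H; elim: s => [|t s IH].
  by apply: hol_eq (hol_cst a 1) => x; rewrite big_nil.
case Pt : (P t); last by apply: hol_eq IH => x; rewrite big_cons Pt.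
by apply: hol_eq (hol_mul (H t Pt) IH) => x; rewrite big_cons Pt.
Qed.

Lemma hol_exp a f k : hol_at a f -> hol_at a (fun x => f x ^+ k).
Proof.
move=> Hf; elim: k => [|k IH]; first exact: hol_eq (hol_cst a 1).
by apply: hol_eq (hol_mul Hf IH) => x; rewrite exprS.
Qed.

Lemma pd_dir f j a : (forall h : C, f (h *: (delta_mx j 0 : V) + a) = f a) -> pd f j a = 0.
Proof.
move=> H; rewrite /pd /derive.
have -> : (fun h => h^-1 *: ((f \o shift a) (h *: (delta_mx j 0 : V)) - f a)) = (fun=> 0).
  by apply/funext => h /=; rewrite H subrr scaler0.
exact: lim_cst.
Qed.

Lemma pd_cst z j a : pd (fun=> z) j a = 0.
Proof. exact: pd_dir. Qed.

Lemma pd_coord i j a : pd (fun x => x i 0) j a = (i == j)%:R.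
Proof.
have H := PS_pd1 j (@PS_cst _ _ a _ 0 ltr01).
have [c Hc] := PB_coord i a (a i 0) ltr01.
have [E|/negbTE nE] := eqVneq i j; last first.
  by apply: pd_dir => h; rewrite !mxE nE /= mulr0 add0r.
rewrite -E /pd /derive; apply: cvg_lim => //.
apply: cvg_near_cst; near=> h; rewrite /= !mxE !eqxx mulr1 addrK.
apply: mulVf; near: h; exact: nbhs_dnbhs_neq.
Unshelve. all: by end_near.
Qed.

Lemma pdZ a z f j : hol_at a f -> pd (fun x => z * f x) j a = z * pd f j a.
Proof. by move=> Hf; rewrite (pdM j (hol_cst a z) Hf) pd_cst mul0r addr0. Qed.

Lemma pdB a f g j : hol_at a f -> hol_at a g ->
  pd (fun x => f x - g x) j a = pd f j a - pd g j a.
Proof.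
move=> Hf Hg; rewrite (_ : (fun x => _) = (fun x => f x + -1 * g x)).
  by rewrite (pdD j Hf (hol_scale (-1) Hg)) pdZ // mulN1r.
by apply/funext => x; rewrite mulN1r.
Qed.

Lemma pd_sum (T : Type) (s : seq T) (P : pred T) (h : T -> V -> C) a j :
  (forall t, P t -> hol_at a (h t)) ->
  pd (fun x => \sum_(t <- s | P t) h t x) j a = \sum_(t <- s | P t) pd (h t) j a.
Proof.
move=> H; elim: s => [|t s IH].
  by rewrite big_nil -[RHS](pd_cst 0 j a); congr (pd _ j a); apply/funext => x; rewrite big_nil.
rewrite big_cons -IH.
case Pt : (P t); last by congr (pd _ j a); apply/funext => x; rewrite big_cons Pt.
rewrite -(pdD j (H t Pt) (hol_sum _ H)); congr (pd _ j a).
by apply/funext => x; rewrite big_cons Pt.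
Qed.

Lemma pdX a f j k : hol_at a f -> pd (fun x => f x ^+ k) j a = k%:R * f a ^+ k.-1 * pd f j a.
Proof.
move=> Hf; elim: k => [|k IH]; first by rewrite !mul0r -[RHS](pd_cst 1 j a).
rewrite (_ : (fun x => _) = (fun x => f x * f x ^+ k)); last by apply/funext => x; rewrite exprS.
rewrite (pdM j Hf (hol_exp k Hf)) IH /=.
case: k {IH} => [|k]; first by rewrite expr0; ring.
by rewrite exprS /= -[k.+2%:R]natr1; ring.
Qed.

Definition dec j p : MI := \col_i (if i == j then (p i 0%R).-1 else p i 0%R).

Lemma pd_mono a b j p : pd (fun x => mono (x - a) p) j b =
  (p j 0)%:R * mono (b - a) (dec j p).
Proof.
have E x q : mono (x - a) q = (x j 0 - a j 0) ^+ q j 0 *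
    \prod_(i | i != j) (x i 0 - a i 0) ^+ q i 0.
  rewrite /mono (bigD1 j) //= !mxE; congr (_ * _).
  by apply: eq_bigr => i _; rewrite !mxE.
have Hc i : hol_at b (fun x => x i 0 - a i 0) by apply: hol_sub; [exact: hol_coord|exact: hol_cst].
rewrite (_ : (fun x => _) = (fun x => (x j 0 - a j 0) ^+ p j 0 *
    \prod_(i | i != j) (x i 0 - a i 0) ^+ p i 0)); last by apply/funext => x; rewrite E.
rewrite pdM; last 2 first.
- exact: hol_exp.
- by apply: hol_prod => i _; exact: hol_exp.
rewrite pd_dir ?mulr0 ?add0r; last first.
  move=> h; apply: eq_bigr => i /negbTE ij.
  by rewrite !mxE ij /= mulr0 add0r.
rewrite pdX // pdB; [|exact: hol_coord|exact: hol_cst].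
rewrite pd_coord pd_cst eqxx subr0 mulr1 E !mxE eqxx -!mulrA; congr (_ * (_ * _)).
by apply: eq_bigr => i /negbTE ij; rewrite mxE ij.
Qed.

Lemma pd_hs a r M c f j b d : PS a r M c f -> close a d b -> 0 <= d -> d < r ->
  hs (fun p => c p * (p j 0)%:R * mono (b - a) (dec j p)) (pd f j b).
Proof.
move=> [r0 Ha Hf] Hb d0 dr; have rd0 : 0 < r - d by rewrite subr_gt0.
have Hk p : PB b (r - d) (normc (c p) * r ^+ deg p) (fun x => c p * mono (x - a) p).
  apply: PB_mul (PB_cst _ _ rd0) _.
  by have := PB_mono p rd0 Hb; rewrite subrKC.
have [ck Hck] := choice Hk.
have [|x Hx|c' Hc' Hcp] := PS_series rd0 Hck (M := M) (f := f).
- move=> F; apply: le_trans (Ha F); apply: ler_sum => p _.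
  by rewrite normcM normcR ger0_norm // exprn_ge0 // ltW.
- by apply: Hf; have := close_trans Hb Hx; rewrite subrKC.
rewrite (PS_pd1 j Hc'); apply: hs_ext (Hcp (mdl j 1)) => p.
rewrite -(PS_pd1 j (Hck p)) pdZ ?pd_mono ?mulrA //.
by eexists; eexists; exact: PB_mono rd0 Hb.
Qed.

Lemma dec_add j q : dec j (q + mdl j 1) = q.
Proof.
apply/colP => i; rewrite !mxE; case: eqP => // _.
  by rewrite [(_ + 1%N)%R]addn1.
by rewrite [LHS]addn0.
Qed.

(** Halving the radius compensates the factor [p j 0]: with p = q + e_j one has q_j + 1 <= 2^|q|,
    which leaves exactly the loss 1 / r. *)
Lemma PS_pd a r M c f j : PS a r M c f -> exists2 c', PS a (r / 2) (M / r) c' (pd f j) &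
  forall p, c' p = (p j 0).+1%:R * c (p + mdl j 1).
Proof.
move=> H; have r0 : 0 < r by case: H.
have r20 : 0 < r / 2 by rewrite divr_gt0.
have [|x Hx|c' Hc' Hcp] := @gps _ _ _ (fun p => c p * (p j 0)%:R) (dec j) a (r / 2) (M / r) (pd f j) r20.
- case: H => _ Ha _; rewrite [M / r]mulrC -[r^-1]ger0_norm ?invr_ge0 ?(ltW r0) // -normcR.
  apply: absb_le_fun (absbZ r^-1%:C%C Ha) => p; rewrite mulrCA -mulrA !normcM.
  rewrite ler_wpM2l ?normc_ge0 // normc_nat !normcR.
  rewrite !ger0_norm ?exprn_ge0 ?invr_ge0 ?(ltW r0) ?(ltW r20) //.
  have [p0|] := posnP (p j 0); first by rewrite p0 mul0r mulr_ge0 ?exprn_ge0 ?invr_ge0 ?(ltW r0).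
  move=> /mdl_split[q ->]; rewrite dec_add degD deg_mdl addn1 exprS mulKf ?gt_eqF //.
  rewrite mxE mxE eqxx [(_ + 1%N)%R]addn1 expr_div_n mulrCA ler_piMr ?exprn_ge0 ?(ltW r0) //.
  rewrite ler_pdivrMr ?exprn_gt0 // mul1r -natrX ler_nat.
  apply: leq_ltn_trans (_ : (deg q < _)%N); last exact: ltn_expl.
  by rewrite /deg (bigD1 j) //= leq_addr.
- apply: pd_hs H Hx _ _; lra.
exists c' => // p; apply: hs_uniq (Hcp p) _.
have := @hs1 _ _ (p + mdl j 1) (fun q => if dec j q == p then c q * (q j 0)%:R else 0).
rewrite dec_add eqxx mxE mxE eqxx [(_ + 1%N)%R]addn1 mulrC; apply => q Hq.
have [q0|] := posnP (q j 0); first by rewrite q0 mulr0; case: ifP.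
by move=> /mdl_split[q' E]; move: Hq; rewrite E dec_add; case: (eqVneq q' p) => [->|//]; rewrite eqxx.
Qed.

Lemma PB_pd a r M f j : PB a r M f -> PB a (r / 2) (M / r) (pd f j).
Proof. by move=> [c /(PS_pd j)[c' H _]]; exists c'. Qed.

Lemma hol_pd a f j : hol_at a f -> hol_at a (pd f j).
Proof. by move=> [r [M /(PB_pd j) H]]; exists (r / 2), (M / r). Qed.

Lemma pd_comm a f i j : hol_at a f -> pd (pd f i) j a = pd (pd f j) i a.
Proof.
move=> [r [M [c H]]]; have [ci Hi Ei] := PS_pd i H; have [cj Hj Ej] := PS_pd j H.
apply: (etrans (PS_pd1 j Hi)); apply: (etrans _ (esym (PS_pd1 i Hj))).
have E1 : mdl j 1 i 0 = mdl i 1 j 0 by rewrite !mxE eq_sym.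
have E2 : mdl j 1 + mdl i 1 = mdl i 1 + mdl j 1 by exact: addrC.
by rewrite Ei Ej E1 E2.
Qed.

End Calculus.

(** Both difference quotients are literally the same function of [t], so [F] may be arbitrary. *)
Lemma pd_affine (R : realType) (m N : nat) (h : 'cV[R[i]]_m -> 'cV[R[i]]_N) (F : 'cV[R[i]]_N -> R[i])
    i j (z : 'cV[R[i]]_m) :
  (forall t, h (t *: (delta_mx i 0 : 'cV_m) + z) = t *: (delta_mx j 0 : 'cV_N) + h z) ->
  pd (fun x => F (h x)) i z = pd F j (h z).
Proof.
move=> H; rewrite /pd /derive.
have -> : (fun t : R[i] => t^-1 *: (((fun x => F (h x)) \o shift z) (t *: (delta_mx i 0 : 'cV_m)) - F (h z))) =
    (fun t => t^-1 *: ((F \o shift (h z)) (t *: (delta_mx j 0 : 'cV_N)) - F (h z))).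
  by apply/funext => t /=; rewrite H.
by [].
Qed.

(** * Iterated derivatives and the identity theorem *)

(* Unification attempts on [pd] would otherwise unfold it down to limits. *)
Opaque pd.

Section Words.
Variables (R : realType) (N : nat).
Local Notation C := R[i].
Local Notation V := 'cV[C]_N.
Local Notation MI := 'cV[nat]_N.
Implicit Types (a b x y : V) (p q : MI) (r d M : R) (f g : V -> C) (c : MI -> C).
Implicit Types (U : set V) (l : seq 'I_N).

Definition pdw l f : V -> C := foldr (fun j h => pd h j) f l.

Definition holU U f := forall a, U a -> hol_at a f.

Lemma pdw_cat l l' f : pdw (l ++ l') f = pdw l (pdw l' f).
Proof. exact: foldr_cat. Qed.

Lemma hol_pdw a l f : hol_at a f -> hol_at a (pdw l f).
Proof. by move=> Hf; elim: l => [//|j l IH]; exact: hol_pd. Qed.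

Lemma pd_open U f g j a : open U -> (forall x, U x -> f x = g x) -> U a ->
  pd f j a = pd g j a.
Proof.
move=> oU E Ua; have [r r0 H] := open_close oU Ua.
by apply: (pd_near (r := r)) => // x /H /E.
Qed.

Lemma pdw_open U f g l : open U -> (forall x, U x -> f x = g x) ->
  forall x, U x -> pdw l f x = pdw l g x.
Proof.
move=> oU E.
elim: l => [|j l IH] x Ux.
  exact: E.
exact: (pd_open j oU IH Ux).
Qed.

Lemma pdw_near a r f g l : 0 < r -> (forall x, close a r x -> f x = g x) ->
  pdw l f a = pdw l g a.
Proof.
move=> r0 E; have oU : open [set x | exists2 d, d < r & close a d x].
  apply: close_open => x [d dr Hx]; exists ((r - d) / 2); first by rewrite divr_gt0 ?subr_gt0.
  move=> y Hy; exists (d + (r - d) / 2); first lra.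
  exact: close_trans Hx Hy.
apply: (pdw_open l oU) => [x [d dr Hx]|]; last by exists 0 => //; exact: closexx.
by apply: E; apply: close_le Hx; exact: ltW.
Qed.

Lemma pdw_pd_comm U f l j : open U -> holU U f ->
  forall x, U x -> pdw l (pd f j) x = pd (pdw l f) j x.
Proof.
move=> oU Hf; elim: l => [|i l IH] x Ux; first by [].
apply: (etrans (pd_open i oU IH Ux)); apply: pd_comm; apply: hol_pdw; exact: Hf.
Qed.

Lemma pdw_perm U f l l' : open U -> holU U f -> perm_eq l l' ->
  forall x, U x -> pdw l f x = pdw l' f x.
Proof.
move=> oU Hf; elim: l l' => [|j l IH] l' P x Ux.
  by move: P; rewrite perm_sym => /perm_nilP ->.
have jl' : j \in l' by rewrite -(perm_mem P) mem_head.
case/splitPr: jl' P => l1 l2; rewrite -[j :: l2]cat1s perm_sym perm_catCA /= perm_cons perm_sym => P.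
rewrite pdw_cat; apply: (etrans (pd_open j oU (IH _ P) Ux)).
have H := pdw_pd_comm l1 j oU (f := pdw l2 f) _ Ux; apply: etrans (esym (H _)).
  by rewrite pdw_cat.
by move=> y Uy; apply: hol_pdw; exact: Hf.
Qed.

Definition flat a f := forall l, pdw l f a = 0.

Lemma flat_pd a f j : flat a f -> flat a (pd f j).
Proof. by move=> H l; have := H (rcons l j); rewrite /pdw foldr_rcons. Qed.

(** By induction on the degree: a coefficient of index q + e_j is, up to a nonzero integer, the
    coefficient of index q of a partial derivative, which is again flat. *)
Lemma flat_PS a r M c f : PS a r M c f -> flat a f -> forall p, c p = 0.
Proof.
move=> H F p; have [k] := ubnP (deg p); elim: k p r M c f H F => // k IH p r M c f H F.
rewrite ltnS => pk; have [|] := posnP (deg p).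
  by move/eqP; rewrite deg_eq0 => /eqP ->; rewrite -(PS_val H); exact: (F [::]).
move=> /deg_gt0[j [q E]]; have [c' H' E'] := PS_pd j H.
have := IH q _ _ _ _ H' (flat_pd j F); rewrite E'; move: pk.
rewrite E degD deg_mdl addn1 => qk /(_ qk) /eqP; rewrite mulf_eq0 pnatr_eq0 /= => /eqP.
by [].
Qed.

Lemma flat_PB a r M f x : PB a r M f -> flat a f -> close a r x -> f x = 0.
Proof.
move=> [c H] F Hx; have c0 := flat_PS H F; case: H => _ _ /(_ x Hx) Hf.
by apply: hs_uniq Hf (hs_ext _ (@hs0 _ _)) => p; rewrite c0 mul0r.
Qed.

Lemma near0_flat a r f : 0 < r -> (forall x, close a r x -> f x = 0) -> flat a f.
Proof.
move=> r0 H l; rewrite (pdw_near l r0 H); move: a {H}.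
elim: l => [//|j l IH a]; apply: pd_dir => h; exact: etrans (IH _) (esym (IH _)).
Qed.

(** The flat points form a nonempty subset that is open and closed in [U]. For closedness, the
    expansion at a limit point [x] is recentred at a nearby flat point, and its polydisc still
    covers a neighbourhood of [x]. *)
Lemma identity_theorem U f a : open U -> connected U -> holU U f -> U a -> flat a f ->
  forall x, U x -> f x = 0.
Proof.
move=> oU cU Hf Ua Fa; pose B := [set x | U x /\ flat x f].
suff BU : B = U by move=> x; rewrite -BU => -[_ /(_ [::])].
apply: cU; first by exists a.
- exists B; last by apply/seteqP; split=> x [].
  apply: close_open => x [Ux Fx]; have [r r0 Hr] := open_close oU Ux.
  have [d [M H]] := Hf _ Ux; have d0 := PB_gt0 H.
  exists (Num.min r (d / 2)); first by rewrite lt_min r0 divr_gt0.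
  move=> y Hy; split; first by apply: Hr; apply: close_le Hy; rewrite ge_min lexx.
  apply: (near0_flat (r := d / 2)) => [|z Hz]; first by rewrite divr_gt0.
  apply: flat_PB H Fx _; rewrite [d]splitr; apply: close_trans Hz.
  by apply: close_le Hy; rewrite ge_min lexx orbT.
- exists (closure B); first exact: closed_closure.
  apply/seteqP; split=> [x Bx|x [Ux clx]]; first by split; [case: Bx|exact: subset_closure].
  split=> //; have [r [M H]] := Hf _ Ux; have r0 := PB_gt0 H.
  have [|y [[Uy Fy] Hy]] := clx [set y | close x (r / 4) y].
    by apply/nbhs_close; exists (r / 4) => //; rewrite divr_gt0.
  apply: (near0_flat (r := r / 4)) => [|z Hz]; first by rewrite divr_gt0.
  have Hr : PB y (r - r / 4) M f by apply: PB_recenter H Hy _ _; lra.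
  apply: flat_PB Hr Fy _.
  apply: close_le (close_trans (close_sym Hy) Hz); lra.
Qed.

Lemma norm_close x r : 0 < r -> `|x| < r%:C%C <-> forall j, normc (x j 0) < r.
Proof.
move=> r0; have r0' : 0 < r%:C%C by rewrite ltcR.
split=> [H j|H].
  have : ball (0 : V) r%:C%C x by rewrite mx_norm_ball /ball_ /= sub0r normrN.
  by move=> [_ /(_ j 0)]; rewrite /ball /= mxE sub0r normrN normE ltcR.
have : ball (0 : V) r%:C%C x.
  by split=> // i j; rewrite (ord1 j) /ball /= mxE sub0r normrN normE ltcR.
by rewrite mx_norm_ball /ball_ /= sub0r normrN.
Qed.

Lemma holomorphicE U f : holomorphic U f <-> holU U f.
Proof.
have E (c : MI -> C) a x : (fun p : MI => c p * \prod_j (x j 0 - a j 0) ^+ p j 0) =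
    (fun p => c p * mono (x - a) p).
  by apply/funext => p; congr (_ * _); apply: eq_bigr => j _; rewrite !mxE.
split=> H a Ua.
  have [c [e [e0 Hc]]] := H a Ua.
  have Re : e = (complex.Re e)%:C%C by rewrite RRe_real // gtr0_real.
  rewrite Re ltcR in e0; rewrite Re in Hc; pose r := complex.Re e / 2.
  have r0 : 0 < r by rewrite divr_gt0.
  have Hc' x : close a r x -> hs (fun p => c p * mono (x - a) p) (f x).
    move=> Hx; apply/has_sumE; rewrite -E; apply: Hc; apply/norm_close => // j.
    by rewrite !mxE; apply: le_lt_trans (Hx j) _; rewrite /r; lra.
  (* Convergence at the corner a + (r, ..., r) of the polydisc is absolute, and its terms are
     exactly the weighted coefficients. *)
  have [M HM] : exists M, absb (fun p => c p * (r ^+ deg p)%:C%C) M.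
    have [|M HM] := hs_absb (Hc' (a + const_mx r%:C%C) _).
      by move=> j; rewrite !mxE addrAC subrr add0r normcR ger0_norm // ltW.
    exists M; apply: absb_le_fun HM => p; rewrite addrAC subrr add0r.
    rewrite /mono (_ : \prod_j _ = (r ^+ deg p)%:C%C) // rmorphXn /= -prodrXr.
    by apply: eq_bigr => j _; rewrite mxE.
  by exists r, M, c.
have [r [M [c [r0 _ Hf]]]] := H a Ua.
exists c, r%:C%C; split; first by rewrite ltcR.
move=> x /norm_close Hx; apply/has_sumE; rewrite E; apply: Hf => j.
by have := Hx r0 j; rewrite !mxE => /ltW.
Qed.

Lemma hol_continuous a f : hol_at a f -> {for a, continuous f}.
Proof.
move=> [r [M [c H]]]; have r0 : 0 < r by case: H.
have M0 : 0 <= M by case: H => _ /absb_ge0.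
apply/(@cvgrPdist_le _ _ _ (nbhs a) (nbhs_filter a)) => e e0.
have Re : e = (complex.Re e)%:C%C by rewrite RRe_real // gtr0_real.
rewrite Re ltcR in e0; pose K := M + \sum_j normc (c (mdl j 1)) * r.
have K0 : 0 <= K.
  by rewrite addr_ge0 // sumr_ge0 // => j _; rewrite mulr_ge0 ?normc_ge0 ?(ltW r0).
pose d := Num.min 1 (complex.Re e / (K + 1)).
have d0 : 0 < d by rewrite lt_min ltr01 divr_gt0 // ltr_wpDl.
have d1 : d <= 1 by rewrite ge_min lexx.
apply/nbhs_close; exists (d * r); first by rewrite mulr_gt0.
move=> x Hx; rewrite Re normE lecR normc_distC.
have dr : d * r <= r by rewrite ler_piMl ?(ltW r0).
have := PS_taylor H (mulr_ge0 (ltW d0) (ltW r0)) dr Hx; rewrite mulfK ?gt_eqF //.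
set S := \sum_j _ => HT.
have HS : normc S <= d * (\sum_j normc (c (mdl j 1)) * r).
  apply: le_trans (normc_sum _ _ _) _; rewrite mulr_sumr; apply: ler_sum => j _.
  by rewrite normcM mulrCA ler_wpM2l ?normc_ge0 //; exact: Hx.
have -> : f x - f a = (f x - f a - S) + S by rewrite subrK.
apply: le_trans (le_normcD _ _) _; apply: le_trans (lerD HT HS) _.
apply: le_trans (_ : d * (K + 1) <= _); last first.
  by rewrite -ler_pdivlMr ?ltr_wpDl // ge_min lexx orbT.
rewrite mulrC expr2 -mulrA -mulrDr ler_wpM2l ?(ltW d0) // /K.
have : d * M <= M by rewrite ler_piMl.
lra.
Qed.

End Words.

(** * Exponential and logarithm *)

Section Composition.
Variables (R : realType) (N m : nat).
Local Notation C := R[i].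
Local Notation V := 'cV[C]_N.

Lemma fin_radius (T : finType) (P : T -> R -> Prop) :
  (forall t, exists2 r, 0 < r & forall d, 0 < d -> d <= r -> P t d) ->
  exists2 r, 0 < r & forall t, P t r.
Proof.
move=> H; have [r Hr] := choice (fun t => let: ex_intro2 r a b := H t in ex_intro _ r (conj a b)).
exists (\big[Num.min/1]_t r t).
  by elim/big_ind: _ => // [x y|t _]; [rewrite lt_min => -> ->|case: (Hr t)].
move=> t; case: (Hr t) => r0; apply; last by rewrite (bigD1 t) //= ge_min lexx.
by elim/big_ind: _ => // [x y|t' _]; [rewrite lt_min => -> ->|case: (Hr t')].
Qed.

(** On a small polydisc the increments of the [h i] have norm at most [r], the radius of [g], so the
    substituted series keeps the bound [M]. Among its terms only those of degree 1 in the increments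
    have a nonzero derivative at [a], which is the chain rule. *)
Lemma hol_comp_pd (g : 'cV[C]_m -> C) (h : 'I_m -> V -> C) (a : V) :
  (forall i, hol_at a (h i)) -> hol_at (\col_i h i a) g ->
  hol_at a (fun x => g (\col_i h i x)) /\
  forall j, pd (fun x => g (\col_i h i x)) j a =
    \sum_i pd g i (\col_i h i a) * pd (h i) j a.
Proof.
set b : 'cV[C]_m := \col_i h i a => Hh [r [M [c Hg]]]; have r0 : 0 < r by case: Hg.
have Hhb i : hol_at a (fun x => h i x - h i a) by apply: hol_sub; [|exact: hol_cst].
have [d d0 Hd] : exists2 d, 0 < d & forall i, PB a d r (fun x => h i x - h i a).
  apply: fin_radius => i; have [d [K [ci Hi]]] := Hhb i; have d0 : 0 < d by case: Hi.
  have K0 : 0 <= K by case: Hi => _ /absb_ge0.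
  exists (Num.min d (r * d / (K + 1))).
    by rewrite lt_min d0 divr_gt0 ?mulr_gt0 // ltr_wpDl.
  move=> e e0; rewrite le_min => /andP[ed er]; exists ci.
  apply: PS_le (PS_shrink0 e0 ed Hi _) _; first by rewrite -(PS_val Hi) subrr.
  rewrite ler_pdivlMr ?ltr_wpDl // in er.
  rewrite mulrA ler_pdivrMr //; apply: le_trans er; rewrite mulrC ler_wpM2l ?(ltW e0) //; lra.
have bE i : b i 0 = h i a by rewrite mxE.
have Hk p : PB a d (normc (c p) * r ^+ deg p) (fun x => c p * mono (\col_i h i x - b) p).
  apply: PB_mul (PB_cst _ _ d0) _; rewrite -prodrXr.
  by apply: PB_prod => // i _; apply: PB_exp; apply: PB_eq (Hd i) => x; rewrite !mxE.
have [ck Hck] := choice Hk.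
have [||c' Hc' Hcp] := PS_series d0 Hck (M := M) (f := fun x => g (\col_i h i x)).
- case: Hg => _ Ha _ F; apply: le_trans (Ha F); apply: ler_sum => p _.
  by rewrite normcM normcR ger0_norm // exprn_ge0 // ltW.
- move=> x Hx; case: Hg => _ _; apply=> i; rewrite !mxE.
  exact: PB_norm (Hd i) Hx.
split; first by exists d, M, c'.
move=> j; apply: (etrans (PS_pd1 j Hc')).
have Hs : hs (fun p => \sum_i if p == mdl i 1 then c p * pd (h i) j a else 0)
    (\sum_i pd g i b * pd (h i) j a).
  apply: hs_sum => i _; rewrite (PS_pd1 i Hg).
  have := @hs1 _ _ (mdl i 1) (fun p => if p == mdl i 1 then c p * pd (h i) j a else 0).
  by rewrite eqxx; apply => p /negbTE ->.
apply: hs_uniq Hs; apply: hs_ext (Hcp (mdl j 1)) => p.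
apply: (etrans (esym (PS_pd1 j (Hck p)))).
have Hm q : hol_at a (fun x => mono (\col_i h i x - b) q).
  by apply: hol_prod => i _; apply: hol_exp; apply: hol_eq (Hhb i) => x; rewrite !mxE.
rewrite (pdZ (c p) j (Hm p)).
have [/eqP p0|/deg_gt0[i [q pE]]] := posnP (deg p).
  rewrite deg_eq0 in p0; rewrite (eqP p0) big1 => [|i _].
    rewrite (_ : (fun x => _) = (fun=> 1)) ?pd_cst ?mulr0 //.
    by apply/funext => x; rewrite mono0.
  by case: eqP => // /(congr1 (@deg m)) ; rewrite deg0 deg_mdl.
have -> : pd (fun x => mono (\col_i h i x - b) p) j a = mono 0 q * pd (h i) j a.
  rewrite (_ : (fun x => _) = (fun x => mono (\col_i h i x - b) q * (h i x - h i a))); last first.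
    by apply/funext => x; rewrite pE monoD mono_mdl expr1 !mxE.
  apply: (etrans (pdM j (Hm q) (Hhb i))).
  rewrite (pdB j (Hh i) (hol_cst _ _)) pd_cst subr0 -/b [b - b]subrr.
  by rewrite [h i a - h i a]subrr mulr0 addr0.
have [q0|q0] := eqVneq q 0.
  rewrite q0 mono0 mul1r pE q0 add0r (bigD1 i) //= eqxx big1 ?addr0 // => k ki.
  case: eqP => // /colP/(_ k); rewrite !mxE eqxx; move/negbTE: ki => ->.
  by [].
have -> : mono (0 : 'cV[C]_m) q = 0.
  have : (0 < deg q)%N by rewrite lt0n deg_eq0.
  by move=> /deg_gt0[k [q' ->]]; rewrite monoD mono_mdl mxE expr1 mulr0.
rewrite mul0r mulr0 big1 // => k _; case: eqP => // /(congr1 (@deg m)).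
rewrite pE degD !deg_mdl addn1 => -[/eqP]; rewrite deg_eq0 => /eqP q1.
by rewrite q1 eqxx in q0.
Qed.

Lemma hol_comp (g : 'cV[C]_m -> C) (h : 'I_m -> V -> C) (a : V) :
  (forall i, hol_at a (h i)) -> hol_at (\col_i h i a) g ->
  hol_at a (fun x => g (\col_i h i x)).
Proof. by move=> Hh Hg; case: (hol_comp_pd Hh Hg). Qed.

Lemma pd_comp (g : 'cV[C]_m -> C) (h : 'I_m -> V -> C) (a : V) j :
  (forall i, hol_at a (h i)) -> hol_at (\col_i h i a) g ->
  pd (fun x => g (\col_i h i x)) j a = \sum_i pd g i (\col_i h i a) * pd (h i) j a.
Proof. by move=> Hh Hg; case: (hol_comp_pd Hh Hg). Qed.

End Composition.

Section Cexp.
Variable R : realType.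
Local Notation C := R[i].
Implicit Types z w : C.

Lemma cexpD z w : cexp (z + w) = cexp z * cexp w.
Proof.
case: z w => [a b] [c d]; rewrite /cexp /= expRD cosD sinD rmorphM mulrACA.
by congr (_ * _); simpc; congr (_ +i* _)%C; ring.
Qed.

Lemma cexp0 : cexp (0 : C) = 1.
Proof. by rewrite /cexp /= expR0 cos0 sin0 mul1r. Qed.

Lemma normc_cexp z : normc (cexp z) = expR (complex.Re z).
Proof.
rewrite /cexp normcM normcR ger0_norm ?expR_ge0 // [X in _ * X](_ : _ = 1) ?mulr1 //.
by rewrite /normc cos2Dsin2 sqrtr1.
Qed.

Lemma cexp_neq0 z : cexp z != 0.
Proof. by rewrite -normc_eq0 normc_cexp gt_eqF // expR_gt0. Qed.

Lemma cexpN z : cexp (- z) = (cexp z)^-1.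
Proof.
by apply: (mulfI (cexp_neq0 z)); rewrite -cexpD subrr cexp0 divff // cexp_neq0.
Qed.

Lemma cexp_sum (T : Type) (s : seq T) (P : pred T) (f : T -> C) :
  cexp (\sum_(t <- s | P t) f t) = \prod_(t <- s | P t) cexp (f t).
Proof. exact: (big_morph _ cexpD cexp0). Qed.

Lemma cexpMn z k : cexp (z *+ k) = cexp z ^+ k.
Proof.
by elim: k => [|k IH]; [rewrite mulr0n cexp0|rewrite mulrS cexpD IH exprS].
Qed.

Lemma cexp_2pi : cexp (0 +i* (pi *+ 2))%C = 1 :> C.
Proof. by rewrite /cexp /= expR0 cos2pi sin2pi mul1r. Qed.

Lemma cexp_real (x : R) : cexp x%:C%C = (expR x)%:C%C.
Proof. by rewrite /cexp /= cos0 sin0 mulr1. Qed.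

(** This makes branches of the logarithm locally unique. Modulus 1 gives a vanishing real part, and
    the sine has no zero in (-1, 1) except 0. *)
Lemma cexp_eq1_small z : cexp z = 1 -> normc z < 1 -> z = 0.
Proof.
move=> E z1; have := congr1 (@normc R) E; rewrite normc_cexp normc1 => /eqP.
rewrite -expR0 => /eqP/expR_inj Re0; move: E z1; case: z Re0 => a b /= ->.
rewrite /cexp /= expR0 mul1r => -[_ sb] nb.
have {nb} : `|b| < 1.
  by apply: le_lt_trans nb; exact: (normc_Im (Complex 0 b)).
have pi2 := @pi_ge2 R.
have [b0|b0|-> //] := ltgtP b 0; rewrite ltr_norml => /andP[b1 b2].
  have /sin_gt0_pi : 0 < - b < pi by apply/andP; split; lra.
  by rewrite sinN sb oppr0 ltxx.
have /sin_gt0_pi : 0 < b < pi by apply/andP; split; lra.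
by rewrite sb ltxx.
Qed.

Lemma exp_coeff_le (x : R) n : 0 <= x -> \sum_(0 <= k < n) x ^+ k / k`!%:R <= expR x.
Proof.
move=> x0; have -> : \sum_(0 <= k < n) x ^+ k / k`!%:R = series (exp_coeff x) n by [].
rewrite /expR; apply: nondecreasing_cvgn_le; last exact: is_cvg_series_exp_coeff.
apply/nondecreasing_seqP => k; rewrite /series /= big_nat_recr //= lerDl.
by rewrite /exp_coeff /= divr_ge0 ?exprn_ge0.
Qed.

Lemma absb_exp (x : R) : 0 <= x -> absb (fun k => (k`!%:R : C)^-1 * (x ^+ k)%:C%C) (expR x).
Proof.
move=> x0 F; pose n := (\max_(k <- F) k).+1.
have H k : normc ((k`!%:R : C)^-1 * (x ^+ k)%:C%C) = x ^+ k / k`!%:R.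
  by rewrite normcM normcV normc_nat normcR ger0_norm ?exprn_ge0 // mulrC.
under eq_bigr do rewrite H.
apply: le_trans (exp_coeff_le n x0).
rewrite big_mkord.
have -> : \sum_(k < n) x ^+ k / k`!%:R = \sum_(k <- [fset (val k) | k in 'I_n]%fset) x ^+ k / k`!%:R.
  by rewrite big_imfset //= ?big_enum // => i j _ _; exact: val_inj.
apply: ler_sum_fset => [k|]; first by rewrite divr_ge0 ?exprn_ge0.
apply/fsubsetP => k kF; have kn : (k < n)%N by rewrite ltnS; apply: leq_bigmax_seq.
by apply/imfsetP; exists (Ordinal kn).
Qed.

Lemma gps1 (cs : nat -> C) (h : C -> C) (a : 'cV[C]_1) (r M : R) : 0 < r ->
  absb (fun k => cs k * (r ^+ k)%:C%C) M ->
  (forall u, normc u <= r -> hs (fun k => cs k * u ^+ k) (h u)) ->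
  PS a r M (fun p => cs (p 0 0)) (fun x => h (x 0 0 - a 0 0)).
Proof.
move=> r0 Ha Hh.
have E (p : 'cV[nat]_1) : p = mdl 0 (p 0 0) by apply/colP => i; rewrite (ord1 i) mxE.
have inj_mdl : injective (fun p : 'cV[nat]_1 => p 0 0).
  by move=> p q pq; rewrite (E p) (E q) pq.
have D (p : 'cV[nat]_1) : deg p = p 0 0 by rewrite {1}(E p) deg_mdl.
split=> // [|x Hx].
  by apply: absb_le_fun (absb_inj inj_mdl Ha) => p; rewrite /= D.
apply: (hs_inj (f := mdl 0)) => [k k' /colP/(_ 0)|p H|].
- by rewrite !mxE.
- by have := H (p 0 0); rewrite -E eqxx.
- apply: hs_ext (Hh _ (Hx 0)) => k /=; by rewrite mono_mdl !mxE.
Qed.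

Lemma real_is_derive (F : R -> C) (t : R) (l : C) (K d : R) : 0 < d ->
  (forall e, `|e| <= d -> normc (F (t + e) - F t - e%:C%C * l) <= K * e ^+ 2) ->
  is_derive t (1 : R) (fun s => complex.Re (F s)) (complex.Re l) /\
  is_derive t (1 : R) (fun s => complex.Im (F s)) (complex.Im l).
Proof.
move=> d0 H.
have K0 : 0 <= K.
  have := H d; rewrite ger0_norm ?(ltW d0) // lexx => /(_ isT) /(le_trans (normc_ge0 _)).
  by rewrite pmulr_lge0 // exprn_gt0.
have L (f : C -> R) : (forall z, `|f z| <= normc z) ->
    (forall z w, f (z - w) = f z - f w) -> (forall (e : R) z, f (e%:C%C * z) = e * f z) ->
    is_derive t (1 : R) (fun s => f (F s)) (f l).
  move=> f1 f2 f3.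
  suff Lm : (fun h => h^-1 *: (((fun s => f (F s)) \o shift t) (h *: (1 : R)) - f (F t))) @ 0^' --> f l.
    by split; [apply/cvg_ex; exists (f l)|apply: cvg_lim Lm].
  apply/cvgrPdist_le => e e0; pose D := Num.min d (e / (K + 1)).
  have D0 : 0 < D by rewrite lt_min d0 divr_gt0 // ltr_wpDl.
  have Hn : \forall h \near (0 : R)^', `|h| < D by apply: dnbhs0_lt.
  near=> h; have h0 : h != 0 by near: h; exact: nbhs_dnbhs_neq.
  have : `|h| < D by near: h.
  rewrite lt_min => /andP[/ltW hd he]; rewrite /= distrC.
  have -> : h^-1 *: (f (F (h *: (1 : R) + t)) - f (F t)) - f l =
      h^-1 * f (F (t + h) - F t - h%:C%C * l).
    rewrite !f2 f3 [RHS]mulrBr mulKf // [t + h]addrC.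
    by rewrite (_ : h *: (1 : R) = h) // /GRing.scale /= mulr1.
  rewrite normrM normfV; have nh : 0 < `|h| by rewrite normr_gt0.
  rewrite mulrC ler_pdivrMr //; apply: le_trans (f1 _) _.
  apply: le_trans (H _ hd) _; rewrite -real_normK ?num_real // expr2 mulrA.
  rewrite ler_wpM2r // ltW //; rewrite ltr_pdivlMr ?ltr_wpDl // in he.
  apply: le_lt_trans he; rewrite mulrC ler_wpM2l //; lra.
split; apply: L.
- exact: normc_Re.
- by case=> [? ?] [? ?].
- by move=> e [x y] /=; rewrite mul0r subr0.
- exact: normc_Im.
- by case=> [? ?] [? ?].
- by move=> e [x y] /=; rewrite mul0r addr0.
Unshelve. all: by end_near.
Qed.

(** Stated for an arbitrary sum [E] of the exponential series, because the identification of [E]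
    with [cexp] is deduced from this differential equation. *)
Lemma exp_series (E : C -> C) : (forall z, hs (fun k => (k`!%:R)^-1 * z ^+ k) (E z)) ->
  let f := fun x : 'cV[C]_1 => E (x 0 0) in
  (forall x, hol_at x f) /\ (forall x, pd f 0 x = f x).
Proof.
move=> HE f.
have PSf r : 0 < r -> PS 0 r (expR r) (fun p : 'cV[nat]_1 => ((p 0 0)`!%:R)^-1) f.
  move=> r0; apply: PS_ext (gps1 0 (h := E) r0 (absb_exp (ltW r0)) _) => [x _|u _].
    by rewrite mxE subr0.
  exact: HE.
split=> x.
  have r0 : 0 < normc (x 0 0) + 1 by rewrite ltr_wpDl ?normc_ge0.
  have Hx : close 0 (normc (x 0 0)) x by move=> j; rewrite (ord1 j) mxE subr0.
  eexists; eexists; apply: PB_recenter Hx _ _; [by eexists; apply: PSf r0|exact: normc_ge0|lra].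
pose r := 2 * (normc (x 0 0) + 1).
have r0 : 0 < r by rewrite mulr_gt0 // ltr_wpDl ?normc_ge0.
have Hx : close 0 (r / 2) x.
  by move=> j; rewrite (ord1 j) mxE subr0 /r mulrC mulKf //; lra.
have [c' [_ _ H1] E'] := PS_pd 0 (PSf r r0).
have [_ _ H2] := PSf r r0.
apply: hs_uniq (H1 x Hx) (hs_ext _ (H2 x _)) => [p|].
  rewrite E' !mxE eqxx [(_ + 1%N)%R]addn1 factS natrM invfM mulrA divff ?mul1r //.
  by rewrite pnatr_eq0.
by apply: close_le Hx; rewrite ler_pdivrMr // ler_pMr // ler1n.
Qed.

(** [cexp] is built from the real exponential, cosine and sine. Along t -> t z the sum of the series
    satisfies F' = z F, so e^(-t z) F(t) is constant; comparing t = 0 and t = 1 gives the claim. *)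
Lemma hs_cexp z : hs (fun k => (k`!%:R)^-1 * z ^+ k) (cexp z).
Proof.
have Hz w : exists l, hs (fun k => (k`!%:R)^-1 * w ^+ k) l.
  apply: (@absb_hs _ _ _ (expR (normc w))).
  apply: absb_le_fun (absb_exp (normc_ge0 w)) => k; rewrite !normcM normcX normcR ger0_norm //.
  by rewrite exprn_ge0 // normc_ge0.
have [E HE] := choice Hz; suff -> : cexp z = E z by exact: HE.
have [_ pdf] := exp_series HE.
have [holf _] := exp_series HE.
have [a [b zE]] : exists a b, z = (a +i* b)%C by case: z => a b; exists a, b.
pose F (t : R) := E (t%:C%C * z).
have HF t : exists K d, 0 < d /\ forall e, `|e| <= d ->
    normc (F (t + e) - F t - e%:C%C * (z * F t)) <= K * e ^+ 2.
  have [r [M [c H]]] := holf (const_mx (t%:C%C * z)); have r0 : 0 < r by case: H.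
  exists (M * (normc z / r) ^+ 2), (r / (normc z + 1)).
  have z1 : 0 < normc z + 1 by rewrite ltr_wpDl ?normc_ge0.
  split=> [|e]; first by rewrite divr_gt0.
  rewrite ler_pdivlMr // => er.
  have er' : normc z * `|e| <= r by apply: le_trans er; rewrite mulrC ler_wpM2l //; lra.
  have ez : 0 <= normc z * `|e| by rewrite mulr_ge0 ?normc_ge0.
  have := PS_taylor H ez er' (x := const_mx ((t + e)%:C%C * z)).
  rewrite big_ord1 -(PS_pd1 0 H) pdf !mxE -mulrBl -rmorphB [t + e - t]addrAC subrr add0r.
  rewrite -/(F t) -/(F (t + e)) => Ht.
  have -> : e%:C%C * (z * F t) = F t * (e%:C%C * z) by ring.
  have -> : M * (normc z / r) ^+ 2 * e ^+ 2 = M * (normc z * `|e| / r) ^+ 2.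
    by rewrite -(real_normK (num_real e)); field; rewrite gt_eqF.
  apply: Ht => j; rewrite !mxE -mulrBl -rmorphB [t + e - t]addrAC subrr add0r.
  by rewrite normcM normcR mulrC.
have D t : is_derive t (1 : R) (fun s => complex.Re (F s)) (complex.Re (z * F t)) /\
    is_derive t (1 : R) (fun s => complex.Im (F s)) (complex.Im (z * F t)).
  by have [K [d [d0 H]]] := HF t; exact: real_is_derive d0 H.
pose p t := complex.Re (F t); pose q t := complex.Im (F t).
have Dp t : is_derive t (1 : R) p (a * p t - b * q t).
  by have [H _] := D t; apply: is_derive_eq H _; rewrite zE /p /q; case: (F t).
have Dq t : is_derive t (1 : R) q (a * q t + b * p t).
  by have [_ H] := D t; apply: is_derive_eq H _; rewrite zE /p /q; case: (F t).
have De t : is_derive t (1 : R) (fun s : R => expR (- a * s)) (- a * expR (- a * t)).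
  have : is_derive t (1 : R) (expR \o (fun s : R => - a * s)) (expR (- a * t) * (- a * 1)).
    apply: is_derive1_comp; apply: is_deriveZ.
  by move=> H; apply: is_derive_eq H _; rewrite mulr1 mulrC.
have Dc t : is_derive t (1 : R) (fun s : R => cos (b * s)) (- b * sin (b * t)).
  have : is_derive t (1 : R) (cos \o (fun s : R => b * s)) (- sin (b * t) * (b * 1)).
    apply: is_derive1_comp; apply: is_deriveZ.
  by move=> H; apply: is_derive_eq H _; ring.
have Ds t : is_derive t (1 : R) (fun s : R => sin (b * s)) (b * cos (b * t)).
  have : is_derive t (1 : R) (sin \o (fun s : R => b * s)) (cos (b * t) * (b * 1)).
    apply: is_derive1_comp; apply: is_deriveZ.
  by move=> H; apply: is_derive_eq H _; ring.
(* With z = a + i b, [u] and [v] are the real and imaginary parts of e^(-s z) F(s). *)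
pose u (s : R) := expR (- a * s) * (p s * cos (b * s) + q s * sin (b * s)).
pose v (s : R) := expR (- a * s) * (q s * cos (b * s) - p s * sin (b * s)).
have Du t : is_derive t (1 : R) u 0.
  have H := is_deriveM (De t) (is_deriveD (is_deriveM (Dp t) (Dc t)) (is_deriveM (Dq t) (Ds t))).
  apply: is_derive_eq H _; rewrite /GRing.scale /=.
  rewrite (_ : (_ + _) t = p t * cos (b * t) + q t * sin (b * t)) //; ring.
have Dv t : is_derive t (1 : R) v 0.
  have H := is_deriveM (De t) (is_deriveB (is_deriveM (Dq t) (Dc t)) (is_deriveM (Dp t) (Ds t))).
  apply: is_derive_eq H _; rewrite /GRing.scale /=.
  rewrite (_ : (_ - _) t = q t * cos (b * t) - p t * sin (b * t)) //; ring.
have E0 : E 0 = 1.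
  have := HE 0 => H0; apply: hs_uniq H0 _.
  have := @hs1 R _ 0%N (fun k => (k`!%:R)^-1 * 0 ^+ k : C); rewrite fact0 invr1 mul1r expr0.
  by apply => k /negbTE k0; rewrite expr0n k0 mulr0.
have F0 : F 0 = 1 by rewrite /F mul0r.
have F1 : F 1 = E z by rewrite /F mul1r.
have := is_derive_0_is_cst 1 0 Du; rewrite /u /p /q F0 F1 !mulr0 !mulr1 expR0 cos0 sin0 /=.
have := is_derive_0_is_cst 1 0 Dv; rewrite /v /p /q F0 F1 !mulr0 !mulr1 expR0 cos0 sin0 /=.
have -> : 1 * (0 * 1 - 1 * 0) = 0 :> R by ring.
have -> : 1 * (1 + 0) = 1 :> R by ring.
rewrite zE expRN; case: (E _) => x y /= Hv Hu; have ea := expR_gt0 a; have cs := cos2Dsin2 b.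
rewrite /cexp /=.
have {}Hv : y * cos b - x * sin b = 0.
  by move/eqP: Hv; rewrite mulf_eq0 invr_eq0 (gt_eqF ea) => /eqP.
have {}Hu : x * cos b + y * sin b = expR a by rewrite -[LHS](mulVKf (lt0r_neq0 ea)) Hu mulr1.
have {}Hv : y * cos b = x * sin b by apply/eqP; rewrite -subr_eq0 Hv.
apply/eqP; rewrite eq_complex /= -Hu !mul0r subr0 addr0; apply/andP; split; apply/eqP.
  rewrite -[RHS]mulr1 -cs [LHS](_ : _ = x * cos b ^+ 2 + (y * cos b) * sin b); last by ring.
  by rewrite Hv; ring.
rewrite -[RHS]mulr1 -cs [LHS](_ : _ = (x * sin b) * cos b + y * sin b ^+ 2); last by ring.
by rewrite -Hv; ring.
Qed.

End Cexp.

Section CexpComposition.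
Variables (R : realType) (N : nat).
Local Notation C := R[i].
Local Notation V := 'cV[C]_N.
Implicit Types (a b x : V) (r M : R) (f : V -> C).

Lemma PB_cexp a r M f : PB a r M f -> PB a r (expR M) (fun x => cexp (f x)).
Proof.
move=> H; have r0 := PB_gt0 H; have M0 := PB_ge0 H.
apply: (@PB_series _ _ _ (fun k x => (k`!%:R)^-1 * f x ^+ k)
  (fun k => normc ((k`!%:R : C)^-1) * M ^+ k)) => //.
- by move=> k; apply: PB_mul (PB_cst _ _ r0) (PB_exp k H).
- move=> F; apply: le_trans (absb_exp M0 F); apply: ler_sum => k _.
  by rewrite normcM normcR ger0_norm // exprn_ge0.
- by move=> x _; exact: hs_cexp.
Qed.

Lemma hol_cexp a f : hol_at a f -> hol_at a (fun x => cexp (f x)).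
Proof. by move=> [r [M /PB_cexp H]]; exists r, (expR M). Qed.

Lemma pd_cexp a f j : hol_at a f -> pd (fun x => cexp (f x)) j a = cexp (f a) * pd f j a.
Proof.
move=> Hf; have [H1 H2] := exp_series (@hs_cexp R).
have E : (fun x => cexp (f x)) = (fun x => (fun y : 'cV[C]_1 => cexp (y 0 0)) (\col_(i < 1) f x)).
  by apply/funext => x; rewrite mxE.
rewrite E (pd_comp j (h := fun _ => f) (fun _ => Hf) (H1 _)) big_ord1.
by rewrite H2 mxE.
Qed.

Lemma absb_geom (q : R) : 0 <= q < 1 -> absb (fun k : nat => (q ^+ k)%:C%C) (1 - q)^-1.
Proof.
move=> /andP[q0 q1] F; pose n := (\max_(k <- F) k).+1.
have H k : normc (q ^+ k)%:C%C = q ^+ k by rewrite normcR ger0_norm // exprn_ge0.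
under eq_bigr do rewrite H.
apply: le_trans (_ : \sum_(k < n) q ^+ k <= _).
  have -> : \sum_(k < n) q ^+ k = \sum_(k <- [fset (val k) | k in 'I_n]%fset) q ^+ k.
    by rewrite big_imfset //= ?big_enum // => i j _ _; exact: val_inj.
  apply: ler_sum_fset => [k|]; first by rewrite exprn_ge0.
  apply/fsubsetP => k kF; have kn : (k < n)%N by rewrite ltnS; apply: leq_bigmax_seq.
  by apply/imfsetP; exists (Ordinal kn).
rewrite -[leRHS]mul1r ler_pdivlMr ?subr_gt0 // mulrC.
have := subrX1 q n => E; have -> : (1 - q) * \sum_(k < n) q ^+ k = 1 - q ^+ n.
  by rewrite -[LHS]opprK -mulNr opprB -E opprB.
by rewrite gerBl exprn_ge0.
Qed.

Lemma hs_geom (q : C) : normc q < 1 -> hs (fun k : nat => q ^+ k) (1 - q)^-1.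
Proof.
move=> q1; have Ha : absb (fun k => q ^+ k) (1 - normc q)^-1.
  apply: absb_le_fun (absb_geom (q := normc q) _) => [k|]; last by rewrite normc_ge0.
  by rewrite normcX normcR ger0_norm // exprn_ge0 // normc_ge0.
have [l Hl] := absb_hs Ha.
have H0 : hs (fun k : nat => if k == 0%N then 1 else 0) (1 : C).
  by have := @hs1 R _ 0%N (fun k : nat => if k == 0%N then 1 else 0); apply => k /negbTE ->.
have H1 : hs (fun k : nat => if k == 0%N then 0 else q ^+ k) (q * l).
  apply: (hs_inj (f := S)) => [k k' []//|[|k] // H|]; first by have := H k; rewrite eqxx.
  by apply: hs_ext (hsZ q Hl) => k /=; rewrite exprS.
have E : l = 1 + q * l.
  apply: hs_uniq Hl (hs_ext _ (hsD H0 H1)) => k.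
  by case: eqP => [->|_]; rewrite ?addr0 ?expr0 // add0r.
suff -> : (1 - q)^-1 = l by [].
have q1' : 1 - q != 0.
  by apply/eqP => /eqP; rewrite subr_eq0 => /eqP Eq; move: q1; rewrite -Eq normc1 ltxx.
by apply: (mulfI q1'); rewrite divff // mulrBl mul1r {1}E addrK.
Qed.

Lemma PB_inv i a r (w : C) : 0 < r -> r < normc (a i 0 + w) ->
  PB a r (normc (a i 0 + w) - r)^-1 (fun x => (x i 0 + w)^-1).
Proof.
set b := a i 0 + w => r0 rb; have b0 : 0 < normc b by exact: lt_trans rb.
have bn0 : b != 0 by rewrite -normc_eq0 gt_eqF.
apply: PB_eq (@PB_univ _ _ i (fun k => b^-1 * (- b^-1) ^+ k) (fun u => (b + u)^-1) a r _ r0 _ _)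
  => [x|F|u ur].
- by congr (_^-1); rewrite /b; ring.
- have q1 : 0 <= r / normc b < 1.
    by rewrite divr_ge0 ?(ltW r0) ?(ltW b0) // ltr_pdivrMr // mul1r.
  have := absbZ b^-1 (absb_geom q1) => /(_ F).
  have -> : normc b^-1 * (1 - r / normc b)^-1 = (normc b - r)^-1.
    by rewrite normcV -invfM mulrBr mulr1 mulrC divfK ?gt_eqF.
  apply: le_trans; apply: ler_sum => k _.
  rewrite -mulrA !normcM ler_wpM2l ?normc_ge0 // normcX normcN normcV !normcR.
  have [r0' q0] : 0 <= r /\ 0 <= r / normc b by case/andP: q1; split=> //; exact: ltW.
  by rewrite !ger0_norm ?exprn_ge0 // expr_div_n exprVn mulrC.
- have q1 : normc (- (u / b)) < 1.
    by rewrite normcN normcM normcV ltr_pdivrMr // mul1r; exact: le_lt_trans rb.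
  have bu : b + u != 0.
    apply/eqP => /eqP; rewrite addr_eq0 => /eqP E; move: ur; rewrite leNgt.
    by move: rb; rewrite E normcN => ->.
  have := hsZ b^-1 (hs_geom q1); have -> : b^-1 * (1 - - (u / b))^-1 = (b + u)^-1.
    by rewrite opprK; field; rewrite bn0 /= ?bu // mulrC.
  apply: hs_ext => k; rewrite -mulrA -exprMn; congr (_ * _ ^+ _); ring.
Qed.

Lemma hol_inv i a : a i 0 != 0 -> hol_at a (fun x => (x i 0)^-1).
Proof.
rewrite -normc_eq0 => a0; have r0 : 0 < normc (a i 0) by rewrite lt0r a0 normc_ge0.
exists (normc (a i 0) / 2), (normc (a i 0 + 0) - normc (a i 0) / 2)^-1.
apply: PB_eq (@PB_inv i a _ 0 _ _) => [x||]; rewrite ?addr0 //; lra.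
Qed.

End CexpComposition.

(** * The logarithm series *)

Section Log.
Variable R : realType.
Local Notation C := R[i].
Implicit Types (u z : C) (x : 'cV[C]_1).

Definition log1_coef (k : nat) : C := if k == 0%N then 0 else - (-1) ^+ k / k%:R.

Lemma log1_coef_le k : normc (log1_coef k) <= 1.
Proof.
rewrite /log1_coef; case: eqP => [_|/eqP k0]; first by rewrite normc0.
rewrite normcM normcN normcX normcN normc1 expr1n mul1r normcV normc_nat invf_le1 ?ltr0n ?lt0n //.
by rewrite ler1n lt0n.
Qed.

(** The condition on [u] stands under the existential quantifier so that choice yields a total
    function, arbitrary off the unit disc. *)
Lemma log1_ex u : exists l, normc u < 1 -> hs (fun k => log1_coef k * u ^+ k) l.
Proof.
have [u1|] := boolP (normc u < 1); last by exists 0.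
suff [l Hl] : exists l, hs (fun k => log1_coef k * u ^+ k) l by exists l.
apply: (@absb_hs _ _ _ (1 - normc u)^-1).
apply: absb_le_fun (absb_geom (q := normc u) _) => [k|]; last by rewrite normc_ge0.
rewrite normcM normcX normcR ger0_norm ?exprn_ge0 ?normc_ge0 //.
by rewrite ler_piMl ?exprn_ge0 ?normc_ge0 // log1_coef_le.
Qed.

Definition log1 u : C := projT1 (cid (log1_ex u)).

Lemma log1P u : normc u < 1 -> hs (fun k => log1_coef k * u ^+ k) (log1 u).
Proof. exact: (projT2 (cid (log1_ex u))). Qed.

Lemma log1_PS (r : R) : 0 < r -> r < 1 ->
  PS 0 r (1 - r)^-1 (fun p => log1_coef (p 0 0)) (fun x => log1 (x 0 0)).
Proof.
move=> r0 r1; apply: PS_ext (gps1 0 (h := log1) r0 _ _) => [x _|F|u ur].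
- by rewrite mxE subr0.
- apply: le_trans (absb_geom (q := r) _ F); last by rewrite (ltW r0).
  by apply: ler_sum => k _; rewrite normcM ler_piMl ?normc_ge0 // log1_coef_le.
- by apply: log1P; exact: le_lt_trans r1.
Qed.

Lemma log1_hol x : normc (x 0 0) < 1 ->
  hol_at x (fun y => log1 (y 0 0)) /\ pd (fun y => log1 (y 0 0)) 0 x = (1 + x 0 0)^-1.
Proof.
move=> x1; set n := normc (x 0 0) in x1; pose r := (1 + n) / 2.
have n0 : 0 <= n by exact: normc_ge0.
have [r0 r1 nr] : [/\ 0 < r, r < 1 & n < r] by rewrite /r; split; lra.
have Hx : close 0 n x by move=> j; rewrite (ord1 j) mxE subr0.
have H := log1_PS r0 r1.
split.
  have H' : PB 0 r (1 - r)^-1 (fun y : 'cV[C]_1 => log1 (y 0 0)) by eexists; exact: H.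
  by exists (r - n), (1 - r)^-1; exact: PB_recenter H' Hx n0 nr.
have Hd := pd_hs 0 H Hx n0 nr.
have Hq : normc (- x 0 0) < 1 by rewrite normcN.
have := hs_geom Hq; rewrite opprK => Hg.
apply: hs_uniq Hd _.
apply: (hs_inj (f := fun k : nat => mdl 0 k.+1)) => [k k' /colP/(_ 0)|p Hp|].
- by rewrite !mxE eqxx => -[].
- have [p0|] := posnP (p 0 0); first by rewrite p0 mulr0 mul0r.
  move=> p0; have := Hp (p 0 0).-1; rewrite prednK // (_ : mdl 0 (p 0 0) = p) ?eqxx //.
  by apply/colP => i; rewrite (ord1 i) mxE.
- apply: hs_ext Hg => k /=.
  rewrite !mxE eqxx /log1_coef /= divfK ?pnatr_eq0 //.
  have -> : dec 0 (mdl 0 k.+1) = mdl 0 k :> 'cV[nat]_1.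
    by apply/colP => i; rewrite (ord1 i) !mxE.
  by rewrite mono_mdl subr0 [LHS]exprNn exprS mulN1r opprK.
Qed.

(** The function [g] = e^(log1 u) / (1 + u) - 1 vanishes at 0 and has zero derivative on the unit
    disc; hence it is flat at 0 and its expansion on radius [r] is zero. *)
Lemma cexp_log1 u : normc u < 1 -> cexp (log1 u) = 1 + u.
Proof.
move=> u1; set n := normc u in u1; pose r := (1 + n) / 2.
have n0 : 0 <= n by exact: normc_ge0.
have [r0 r1 nr] : [/\ 0 < r, r < 1 & n <= r] by rewrite /r; split; lra.
pose g (x : 'cV[C]_1) := cexp (log1 (x 0 0)) * (x 0 0 + 1)^-1 - 1.
have PBg : exists M, PB 0 r M g.
  have Hi : PB (0 : 'cV[C]_1) r (normc ((0 : 'cV[C]_1) 0 0 + 1) - r)^-1 (fun x => (x 0 0 + 1)^-1).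
    by apply: PB_inv; rewrite // mxE add0r normc1.
  have H' : PB 0 r (1 - r)^-1 (fun y : 'cV[C]_1 => log1 (y 0 0)) by eexists; exact: log1_PS.
  eexists; exact: PB_add (PB_mul (PB_cexp H') Hi) (PB_cst _ (-1) r0).
pose U := [set x : 'cV[C]_1 | normc (x 0 0) < 1].
have oU : open U.
  apply: close_open => x Ux; have d0 : 0 < (1 - normc (x 0 0)) / 2 by rewrite divr_gt0 // subr_gt0.
  exists ((1 - normc (x 0 0)) / 2) => // y /(_ 0) Hy; rewrite /U /=.
  have -> : y 0 0 = x 0 0 + (y 0 0 - x 0 0) by ring.
  by apply: le_lt_trans (le_normcD _ _) _; lra.
have ne0 x : U x -> x 0 0 + 1 != 0.
  move=> Ux; apply/eqP => /eqP; rewrite addr_eq0 => /eqP E.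
  by move: Ux; rewrite /U /= E normcN normc1 ltxx.
have H1 x : U x -> hol_at x (fun y => (y 0 0 + 1)^-1).
  move=> Ux; have Hn : 0 < normc (x 0 0 + 1) by rewrite lt0r normc_eq0 ne0 // normc_ge0.
  exists (normc (x 0 0 + 1) / 2), (normc (x 0 0 + 1) - normc (x 0 0 + 1) / 2)^-1.
  apply: PB_inv; lra.
have H2 x : U x -> hol_at x (fun y => cexp (log1 (y 0 0))).
  by move=> Ux; apply: hol_cexp; case: (log1_hol Ux).
have Hp x : U x -> pd g 0 x = 0.
  move=> Ux; rewrite /g (pdB 0 (hol_mul (H2 x Ux) (H1 x Ux)) (hol_cst _ 1)) pd_cst subr0.
  have [Hl El] := log1_hol Ux.
  rewrite (pdM 0 (H2 x Ux) (H1 x Ux)) (pd_cexp 0 Hl) El.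
  have Ei : pd (fun y : 'cV[C]_1 => (y 0 0 + 1)^-1) 0 x = - ((x 0 0 + 1)^-1) ^+ 2.
    have Hc : hol_at x (fun y : 'cV[C]_1 => y 0 0 + 1) by apply: hol_add; [exact: hol_coord|exact: hol_cst].
    have E := pdM 0 Hc (H1 x Ux).
    have E1 : pd (fun y : 'cV[C]_1 => (y 0 0 + 1) * (y 0 0 + 1)^-1) 0 x = 0.
      apply: (etrans (pd_open 0 oU (g := fun=> 1) _ Ux)); last exact: pd_cst.
      by move=> y Uy; rewrite divff // ne0.
    have E2 : pd (fun y : 'cV[C]_1 => y 0 0 + 1) 0 x = 1.
      by rewrite (pdD 0 (hol_coord x 0) (hol_cst _ 1)) pd_coord pd_cst addr0 eqxx.
    rewrite E2 mul1r E1 in E; apply: (mulfI (ne0 x Ux)); rewrite mulrN expr2 mulrA divff ?ne0 //.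
    by rewrite mul1r; apply/eqP; rewrite -addr_eq0 -E.
  by rewrite Ei [1 + _]addrC; ring.
have [M HM] := PBg.
have g0 : g 0 = 0.
  rewrite /g !mxE add0r invr1 mulr1.
  have := PS_val (log1_PS r0 r1); rewrite !mxE => ->.
  by rewrite /log1_coef eqxx cexp0 subrr.
have U0 : U 0 by rewrite /U /= mxE normc0 ltr01.
have Fg : flat 0 g.
  case/lastP => [//|l j]; rewrite (ord1 j) /pdw foldr_rcons -/(pdw _ _).
  apply: (etrans (pdw_open l oU (g := fun=> 0) Hp U0)).
  exact: (near0_flat (r := 1)).
have := flat_PB HM Fg (x := const_mx u); rewrite /g mxE => Hu.
have /eqP : cexp (log1 u) * (u + 1)^-1 - 1 = 0.
  by apply: Hu => j; rewrite !mxE subr0.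
have u0 : u + 1 != 0 by have := ne0 (const_mx u); rewrite mxE; apply; rewrite /U /= mxE.
by rewrite subr_eq0 => /eqP E; have := congr1 (fun w => w * (u + 1)) E; rewrite divfK // mul1r addrC.
Qed.

End Log.

Section Branches.
Variables (R : realType) (N : nat).
Local Notation C := R[i].
Local Notation V := 'cV[C]_N.
Implicit Types (a b x : V) (U : set V).

Lemma continuous_close a (f : V -> C) (e : R) : 0 < e -> {for a, continuous f} ->
  exists2 r, 0 < r & forall x, close a r x -> normc (f x - f a) < e.
Proof.
move=> e0 cf; apply/(nbhs_close a (fun x => normc (f x - f a) < e)).
have /(@cvgrPdist_lt _ _ _ (nbhs a) (nbhs_filter a)) H := cf.
have eC : 0 < e%:C%C :> C by rewrite ltcR.
by have := H _ eC; apply: filterS => x; rewrite normE ltcR normc_distC.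
Qed.

(** Near [a] the branch equals its value at [a] plus [log1] of (x_j - a_j) / a_j: the exponentials
    agree, and continuity bounds each increment by 1/2, so the difference has modulus less than 1
    and [cexp_eq1_small] applies. *)
Lemma log_branch_hol U lam j a : open U -> log_branches U lam -> U a ->
  hol_at a (lam j : V -> C) /\ forall i, pd (lam j) i a = (j == i)%:R / a j 0.
Proof.
move=> oU HL Ua; have [cont E] := HL j a Ua.
have aj0 : a j 0 != 0 by rewrite -E cexp_neq0.
pose v x : C := (a j 0)^-1 * (x j 0 - a j 0).
have holv x : hol_at x v.
  by apply: hol_scale; apply: hol_sub; [exact: hol_coord|exact: hol_cst].
have va : v a = 0 by rewrite /v subrr mulr0.
pose S x := log1 (v x).
have SE : S = fun x => (fun y : 'cV[C]_1 => log1 (y 0 0)) (\col_(i < 1) v x).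
  by apply/funext => x; rewrite mxE.
have H1 : normc ((\col_(i < 1) v a) 0 0) < 1 by rewrite mxE va normc0 ltr01.
have [Hl pl] := log1_hol H1.
have holS : hol_at a S by rewrite SE; exact: (hol_comp (h := fun _ => v) (fun _ => holv a) Hl).
have S0 : S a = 0.
  have h0 : (0 : R) < 1 / 2 by rewrite divr_gt0.
  have h1 : (1 / 2 : R) < 1 by lra.
  have := PS_val (log1_PS h0 h1); rewrite !mxE /S va => ->.
  by rewrite /log1_coef eqxx.
have cv : {for a, continuous v} by exact: (hol_continuous (holv a)).
have cS : {for a, continuous S} by exact: (hol_continuous holS).
have h12 : (0 : R) < 1 / 2 by rewrite divr_gt0.
have [r1 r10 K1] := continuous_close h12 cont; have [r2 r20 K2] := continuous_close h12 cv.
have [r3 r30 K3] := continuous_close h12 cS; have [r4 r40 K4] := open_close oU Ua.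
pose r := Num.min (Num.min r1 r2) (Num.min r3 r4).
have r0 : 0 < r by rewrite !lt_min r10 r20 r30 r40.
have lE x : close a r x -> lam j a + S x = lam j x.
  move=> Hx; have [Ha Hb Hc Hd] : [/\ r <= r1, r <= r2, r <= r3 & r <= r4].
    by split; rewrite !ge_min lexx ?orbT.
  have := K1 x (close_le Ha Hx); have := K2 x (close_le Hb Hx); have := K3 x (close_le Hc Hx).
  rewrite va S0 !subr0 => k3 k2 k1; have [_ Ex] := HL j x (K4 x (close_le Hd Hx)).
  have v1 : normc (v x) < 1 by apply: lt_trans k2 _; lra.
  apply/esym/eqP; rewrite -subr_eq0; apply/eqP; apply: cexp_eq1_small.
    rewrite cexpD cexpN cexpD E Ex /S cexp_log1 // /v.
    have xj0 : x j 0 != 0 by rewrite -Ex cexp_neq0.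
    have -> : a j 0 * (1 + (a j 0)^-1 * (x j 0 - a j 0)) = x j 0 by field.
    by rewrite divff.
  rewrite opprD addrA; apply: le_lt_trans (le_normcD _ _) _; rewrite normcN; lra.
have Hs : hol_at a (fun x => lam j a + S x) by apply: hol_add; [exact: hol_cst|].
split; first exact: hol_near r0 lE Hs.
move=> i; rewrite -(pd_near i r0 lE) (pdD i (hol_cst _ _) holS) pd_cst add0r SE.
rewrite (pd_comp i (h := fun _ => v) (fun _ => holv a) Hl) big_ord1 pl mxE va addr0 invr1 mul1r.
have Hsub : hol_at a (fun x => x j 0 - a j 0) by apply: hol_sub; [exact: hol_coord|exact: hol_cst].
by rewrite (pdZ _ i Hsub) (pdB i (hol_coord a j) (hol_cst _ _)) pd_coord pd_cst subr0 mulrC.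
Qed.

Lemma starshaped_connected U a : U a ->
  (forall x (t : R), U x -> 0 <= t -> t <= 1 -> U (a + t%:C%C *: (x - a))) -> connected U.
Proof.
move=> Ua Hs; pose seg x := (fun t : R => a + t%:C%C *: (x - a)) @` `[0, 1]%classic.
have -> : U = \bigcup_(x in U) seg x.
  apply/seteqP; split=> [x Ux|_ [x Ux [t /= t01 <-]]].
    exists x => //; exists 1; first by rewrite /= in_itv /= ler01 lexx.
    by rewrite scale1r addrC subrK.
  by apply: Hs => //; move: t01; rewrite in_itv /= => /andP[].
apply: bigcup_connected.
  exists a => x Ux; exists 0; first by rewrite /= in_itv /= lexx ler01.
  by rewrite scale0r addr0.
move=> x Ux; apply: connected_continuous_connected; first exact: segment_connected.
apply: continuous_subspaceT => t.
move=> A /nbhs_close[r r0 HA]; pose K := \sum_j normc (x j 0 - a j 0) + 1.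
have K0 : 0 < K by rewrite ltr_wpDl // sumr_ge0 // => j _; exact: normc_ge0.
apply/nbhs_ballP; exists (r / K) => /=; first by rewrite divr_gt0.
move=> s; rewrite /ball /= => ts; apply: HA => j; rewrite !mxE.
have -> : a j 0 + s%:C%C * (x j 0 - a j 0) - (a j 0 + t%:C%C * (x j 0 - a j 0)) =
  (s - t)%:C%C * (x j 0 - a j 0) by rewrite rmorphB /=; ring.
rewrite normcM normcR distrC; rewrite ltr_pdivlMr // in ts; apply: le_trans (ltW ts).
rewrite ler_wpM2l // /K (bigD1 j) //= -addrA lerDl addr_ge0 // sumr_ge0 // => i _.
exact: normc_ge0.
Qed.

End Branches.

(** * The ideal acting on holomorphic functions *)

Lemma nataddE (a b : nat) : (a + b)%R = (a + b)%N.
Proof. by []. Qed.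

Section WeylAction.
Variables (R : realType) (N : nat).
Local Notation C := R[i].
Local Notation V := 'cV[C]_N.
Implicit Types (a x : V) (U : set V) (f g : V -> C) (P Q : weyl C N).

Lemma weyl_act_open U P f g : open U -> (forall x, U x -> f x = g x) ->
  forall x, U x -> weyl_act P f x = weyl_act P g x.
Proof.
move=> oU; elim: P f g => [c|j|j|P IHP Q IHQ|P IHP Q IHQ] f g E x Ux.
- by rewrite /= E.
- by rewrite /= E.
- exact: (pd_open j oU E Ux).
- exact: congr2 (IHP _ _ E _ Ux) (IHQ _ _ E _ Ux).
- exact: IHP (IHQ _ _ E) _ Ux.
Qed.

Lemma weyl_act_hol U P f : holU U f -> holU U (weyl_act P f).
Proof.
elim: P f => [c|j|j|P IHP Q IHQ|P IHP Q IHQ] f Hf a Ua.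
- exact: hol_scale (Hf a Ua).
- exact: hol_mul (hol_coord a j) (Hf a Ua).
- exact: hol_pd (Hf a Ua).
- exact: hol_add (IHP f Hf a Ua) (IHQ f Hf a Ua).
- exact: IHP (IHQ f Hf) a Ua.
Qed.

Lemma weyl_act_lin U P f g (z : C) : open U -> holU U f -> holU U g ->
  forall x, U x -> weyl_act P (fun y => z * f y + g y) x = z * weyl_act P f x + weyl_act P g x.
Proof.
move=> oU; elim: P f g => [c|j|j|P IHP Q IHQ|P IHP Q IHQ] f g Hf Hg x Ux.
- by rewrite /=; ring.
- by rewrite /=; ring.
- apply: (etrans (pdD j (hol_scale z (Hf x Ux)) (Hg x Ux))).
  exact: congr2 (pdZ z j (Hf x Ux)) erefl.
- apply: (etrans (congr2 +%R (IHP _ _ Hf Hg x Ux) (IHQ _ _ Hf Hg x Ux))).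
  by rewrite /=; ring.
- apply: (etrans (weyl_act_open P oU (IHQ _ _ Hf Hg) Ux)).
  exact: (IHP _ _ (weyl_act_hol Q Hf) (weyl_act_hol Q Hg) x Ux).
Qed.

Lemma weyl_act0 P x : weyl_act P (fun=> 0) x = 0.
Proof.
elim: P x => [c|j|j|P IHP Q IHQ|P IHP Q IHQ] x.
- exact: mulr0.
- exact: mulr0.
- exact: pd_cst.
- by rewrite /= IHP IHQ addr0.
- rewrite /= (_ : weyl_act Q (fun=> 0) = fun=> 0) //; exact/funext.
Qed.

Lemma weyl_act_add U P f g : open U -> holU U f -> holU U g ->
  forall x, U x -> weyl_act P (fun y => f y + g y) x = weyl_act P f x + weyl_act P g x.
Proof.
move=> oU Hf Hg x Ux; have := weyl_act_lin P 1 oU Hf Hg Ux; rewrite mul1r => <-.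
by apply: (weyl_act_open P oU) => // y _; rewrite mul1r.
Qed.

Lemma weyl_act_scale U P f (z : C) : open U -> holU U f ->
  forall x, U x -> weyl_act P (fun y => z * f y) x = z * weyl_act P f x.
Proof.
move=> oU Hf x Ux; have H0 : holU U (fun=> 0 : C) by move=> y _; exact: hol_cst.
have := weyl_act_lin P z oU Hf H0 Ux; rewrite weyl_act0 addr0 => <-.
by apply: (weyl_act_open P oU) => // y _; rewrite addr0.
Qed.

(** The action on expressions descends to the Weyl algebra on holomorphic functions: [weq_DD] is the
    symmetry of second derivatives, [weq_DX] the product rule, and the congruence for products uses
    that [U] is open. *)
Lemma weyl_eq_act U P Q : open U -> weyl_eq P Q -> forall f, holU U f ->
  forall x, U x -> weyl_act P f x = weyl_act Q f x.
Proof.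
move=> oU; elim=> {P Q}.
- by [].
- by move=> P Q _ IH f Hf x Ux; rewrite IH.
- by move=> P Q S _ IH1 _ IH2 f Hf x Ux; rewrite IH1 // IH2.
- by move=> P P' Q Q' _ IH1 _ IH2 f Hf x Ux; rewrite /= IH1 // IH2.
- move=> P P' Q Q' _ IH1 _ IH2 f Hf x Ux /=.
  rewrite (weyl_act_open P oU (IH2 f Hf) Ux); apply: IH1 => //; exact: weyl_act_hol.
- by move=> P Q S f Hf x Ux; exact: addrA.
- by move=> P Q f Hf x Ux; exact: addrC.
- by move=> P f Hf x Ux; rewrite /= mul0r add0r.
- by move=> P f Hf x Ux; rewrite /= mul0r mulN1r subrr.
- by [].
- by move=> P f Hf x Ux; rewrite /= mul1r.
- by [].
- move=> P Q S f Hf x Ux; apply: (weyl_act_add P oU _ _ Ux); exact: weyl_act_hol.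
- by move=> c d f Hf x Ux; rewrite /= mulrDl.
- by move=> c d f Hf x Ux; rewrite /= mulrA.
- by move=> c P f Hf x Ux; exact: (esym (weyl_act_scale P c oU Hf Ux)).
- by move=> i j f Hf x Ux; exact: mulrCA.
- by move=> i j f Hf x Ux; exact: pd_comm (Hf x Ux).
- move=> i j f Hf x Ux; apply: (etrans (pdM i (hol_coord x j) (Hf x Ux))).
  by rewrite pd_coord eq_sym.
Qed.

Lemma left_ideal_act U (S G : set (weyl C N)) f : open U -> holU U f ->
  (forall P, G P -> forall x, U x -> weyl_act P f x = 0) ->
  forall P, left_ideal S G P -> forall x, U x -> weyl_act P f x = 0.
Proof.
move=> oU Hf HG P; elim=> {P}.
- exact: HG.
- by move=> x _; exact: mul0r.
- by move=> P Q _ IHP _ IHQ x Ux; rewrite /= IHP // IHQ // addr0.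
- move=> P Q _ _ IHQ x Ux; apply: (etrans (weyl_act_open P oU IHQ Ux)).
  exact: weyl_act0.
- by move=> P Q E _ IHP x Ux; rewrite -(weyl_eq_act oU E Hf Ux); exact: IHP.
Qed.

Definition word (u : 'cV[nat]_N) : seq 'I_N :=
  flatten [seq nseq (u j 0) j | j <- index_enum 'I_N].

Lemma dmonomial_act u f : weyl_act (dmonomial C u) f = pdw (word u) f.
Proof.
rewrite /dmonomial /word; elim: (index_enum _) => [|j s IH].
  by rewrite big_nil; apply/funext => x; exact: mul1r.
rewrite big_cons map_cons pdw_cat -IH.
set B := \big[_/_]_(k <- s) _; have -> : forall A, weyl_act (WMul A B) f = weyl_act A (weyl_act B f) by [].
move: (weyl_act B f) => h; elim: (u j 0) => [|k IHk].
  by apply/funext => x; exact: mul1r.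
exact: (congr1 (fun h => pd h j) IHk).
Qed.

Lemma count_word (u : 'cV[nat]_N) j : count_mem j (word u) = u j 0.
Proof.
rewrite /word count_flatten -map_comp sumnE big_map (bigD1 j) //= count_nseq /= eqxx mul1n.
rewrite big1 ?addn0 // => i ij; rewrite count_nseq /=.
by rewrite (negbTE ij).
Qed.

Lemma perm_word (u : 'cV[nat]_N) (l : seq 'I_N) : (forall j, count_mem j l = u j 0) -> perm_eq (word u) l.
Proof. by move=> H; apply/allP => j _ /=; rewrite count_word H. Qed.

Lemma euler_act d (A : 'M[int]_(d, N)) i f x :
  weyl_act (euler C A i) f x = \sum_j (A i j)%:~R * (x j 0 * pd f j x).
Proof.
rewrite /euler; elim: (index_enum _) => [|j s IH]; first by rewrite !big_nil; exact: mul0r.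
by rewrite !big_cons -IH.
Qed.

End WeylAction.

(** * The toric ideal and its binomials *)

Section Toric.
Variables (R : realType) (n : nat).
Local Notation C := R[i].
Local Notation N := (n.+1 + n.+1)%N.
Local Notation V := 'cV[C]_N.
Implicit Types (x : V) (U : set V) (f g : V -> C) (u v : 'cV[nat]_N).
Local Notation lm := (lift ord_max).
Local Notation om := (ord_max : 'I_n.+1).

Lemma pos_eq i j : (pos i == pos j :> 'I_N) = (i == j).
Proof. exact: eq_lshift. Qed.

Lemma neg_eq i j : (neg i == neg j :> 'I_N) = (i == j).
Proof. exact: eq_rshift. Qed.

Lemma pos_neg i j : (pos i == neg j :> 'I_N) = false.
Proof. exact: eq_lrshift. Qed.

Lemma neg_pos i j : (neg i == pos j :> 'I_N) = false.
Proof. exact: eq_rlshift. Qed.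

Definition eq_posneg := (pos_eq, neg_eq, pos_neg, neg_pos).

Lemma lm_om i : (lm i == om) = false.
Proof. by rewrite eq_sym; apply/negbTE/neq_lift. Qed.

Lemma om_lm i : (om == lm i) = false.
Proof. by apply/negbTE/neq_lift. Qed.

Lemma sum_N (W : nmodType) (F : 'I_N -> W) :
  \sum_j F j = \sum_(i < n) (F (pos (lm i)) + F (neg (lm i))) + (F (pos om) + F (neg om)).
Proof.
rewrite big_split_ord /= (bigD1_ord om) //= [in X in _ + X](bigD1_ord om) //=.
rewrite big_split /= addrACA addrC; congr (_ + _).
Qed.

Lemma ordN_ind (P : 'I_N -> Prop) :
  (forall i, P (pos i)) -> (forall i, P (neg i)) -> forall j, P j.
Proof. by move=> H1 H2 j; case: (split_ordP j) => i ->; [exact: H1|exact: H2]. Qed.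

Lemma ordm_ind (P : 'I_n.+1 -> Prop) :
  (forall i : 'I_n, P (lm i)) -> P om -> forall j, P j.
Proof. by move=> H1 H2 j; case: (unliftP om j) => [i ->|->]. Qed.

Lemma Amx0 (y : 'cV[int]_N) : (Amx n *m y) (lshift _ 0) 0 = \sum_j y j 0.
Proof.
rewrite mxE; apply: eq_bigr => j _; rewrite /Amx.
by case: (split_ordP j) => i ->; rewrite ?block_mxEul ?block_mxEur mxE mul1r.
Qed.

Lemma AmxS (y : 'cV[int]_N) i : (Amx n *m y) (rshift _ i) 0 = y (pos i) 0 - y (neg i) 0.
Proof.
rewrite mxE big_split_ord /= (bigD1 i) //= [in X in _ + X](bigD1 i) //=.
rewrite /Amx !block_mxEdl !block_mxEdr !mxE eqxx mul1r mulN1r.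
rewrite !big1 ?addr0 // => k /negbTE ki; rewrite ?block_mxEdl ?block_mxEdr !mxE eq_sym ki.
  by rewrite oppr0 mul0r.
by rewrite mul0r.
Qed.

Definition eqA u v := (\sum_j u j 0%R = \sum_j v j 0%R)%N /\
  forall i, (u (pos i) 0%R + v (neg i) 0%R = v (pos i) 0%R + u (neg i) 0%R)%N.

Lemma eqAP u v : Amx n *m map_mx Posz u = Amx n *m map_mx Posz v -> eqA u v.
Proof.
move=> E; split.
  have := congr1 (fun M : 'cV[int]_(1 + n.+1) => M (lshift _ 0) 0) E; rewrite !Amx0.
  have H w : \sum_j (map_mx Posz w : 'cV[int]_N) j 0 = Posz (\sum_j w j 0%R)%N.
    by rewrite (big_morph _ PoszD (erefl (Posz 0))); apply: eq_bigr => j _; rewrite mxE.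
  by rewrite !H => -[].
move=> i; have := congr1 (fun M : 'cV[int]_(1 + n.+1) => M (rshift _ i) 0) E.
rewrite !AmxS !mxE; lia.
Qed.

(** Division by the Groebner basis. Replacing d_i d_-i by d_m d_-m lowers the exponents of the d_i,
    i < m, so a normal form is reached where u_i or u_-i is 0 for each i < m. Then u_i - u_-i
    determines both entries, and the total degree with u_m - u_-m determines the last two: normal
    forms with the same A u coincide. *)
Lemma toric_act U f : open U -> holU U f ->
  (forall i : 'I_n, forall x, U x -> pd (pd f (neg (lm i))) (pos (lm i)) x =
    pd (pd f (neg om)) (pos om) x) ->
  forall u v, eqA u v -> forall x, U x -> pdw (word u) f x = pdw (word v) f x.
Proof.
move=> oU Hf Hb.
pose normal u := forall i : 'I_n, u (pos (lm i)) 0 = 0%N \/ u (neg (lm i)) 0 = 0%N.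
have step u : exists v, [/\ normal v, eqA u v &
    forall x, U x -> pdw (word u) f x = pdw (word v) f x].
  have [K] := ubnP (\sum_(i < n) u (pos (lm i)) 0%R)%N; elim: K u => // K IH u.
  rewrite ltnS => uk.
  have [nu|] := pselect (normal u); first by exists u; split.
  move=> /existsNP[i /not_orP[/eqP]]; rewrite -lt0n => /mdl_split[q uE] /eqP.
  rewrite uE !mxE nataddE neg_pos addn0 -lt0n => /mdl_split[w qE].
  pose u1 := w + mdl (neg om) 1 + mdl (pos om) 1.
  have pw (j j' : 'I_N) : perm_eq (word (w + mdl j' 1 + mdl j 1)) (word w ++ [:: j; j']).
    apply: perm_word => k; rewrite count_cat count_word /= !mxE (eq_sym k j) (eq_sym k j').
    rewrite !nataddE; case: (j == k); case: (j' == k); rewrite /=; lia.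
  have [|u2 [n2 e2 E2]] := IH u1.
    apply: leq_trans uk; rewrite uE qE (bigD1 i) //= [in X in (_ < X)%N](bigD1 i) //=.
    rewrite -addSn; apply: leq_add.
      by rewrite /u1 !mxE !nataddE !eq_posneg lm_om eqxx; lia.
    apply: leq_sum => k _; rewrite /u1 !mxE !nataddE !eq_posneg lm_om.
    by case: (_ == _); lia.
  exists u2; split=> //.
    case: e2 => e2s e2d; split.
      have {}e2s : deg u1 = deg u2 by exact: e2s.
      by apply: etrans e2s; rewrite -[LHS]/(deg _) qE !degD !deg_mdl.
    move=> k; have := e2d k; rewrite qE /u1 !mxE !nataddE !eq_posneg.
    by case: (k == lm i); case: (k == om); lia.
  move=> x Ux; apply: etrans (E2 x Ux).
  apply: etrans (esym (pdw_perm oU Hf (pw (pos om) (neg om)) Ux)).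
  rewrite qE; apply: (etrans (pdw_perm oU Hf (pw (pos (lm i)) (neg (lm i))) Ux)).
  by rewrite !pdw_cat; exact: (pdw_open (word w) oU (Hb i) Ux).
move=> u v E x Ux; have [u' [nu Eu H1]] := step u; have [v' [nv Ev H2]] := step v.
apply: (etrans (H1 x Ux)); apply: etrans (esym (H2 x Ux)).
suff -> : u' = v' by [].
have [E1s E1d] := E; have [Eus Eud] := Eu; have [Evs Evd] := Ev.
have lmE (i : 'I_n) : u' (pos (lm i)) 0 = v' (pos (lm i)) 0 /\ u' (neg (lm i)) 0 = v' (neg (lm i)) 0.
  have := E1d (lm i); have := Eud (lm i); have := Evd (lm i); have := nu i; have := nv i.
  by lia.
have S : (u' (pos om) 0%R + u' (neg om) 0%R = v' (pos om) 0%R + v' (neg om) 0%R)%N.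
  have H (w : 'cV[nat]_N) : (\sum_j w j 0%R)%N = (\sum_(i < n) (w (pos (lm i)) 0%R + w (neg (lm i)) 0%R)
      + (w (pos om) 0%R + w (neg om) 0%R))%N := sum_N (fun j => w j 0).
  have := esym (etrans (esym Eus) (etrans E1s Evs)); rewrite !H.
  have -> : (\sum_(i < n) (v' (pos (lm i)) 0%R + v' (neg (lm i)) 0%R) =
      \sum_(i < n) (u' (pos (lm i)) 0%R + u' (neg (lm i)) 0%R))%N.
    by apply: eq_bigr => i _; case: (lmE i) => -> ->.
  lia.
have := E1d om; have := Eud om; have := Evd om => D1 D2 D3.
apply/colP; apply: ordN_ind; apply: ordm_ind => [i|].
- by case: (lmE i).
- lia.
- by case: (lmE i).
- lia.
Qed.

End Toric.

(** * Words in the Euler operators theta_j *)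

Section Theta.
Variables (R : realType) (N : nat).
Local Notation C := R[i].
Local Notation V := 'cV[C]_N.
Implicit Types (a x : V) (U : set V) (f g : V -> C) (l : seq 'I_N).

Definition TH j f : V -> C := fun x => x j 0 * pd f j x.

Definition thW l f : V -> C := foldr TH f l.

Lemma TH_hol U j f : holU U f -> holU U (TH j f).
Proof. by move=> Hf a Ua; apply: hol_mul (hol_coord a j) (hol_pd j (Hf a Ua)). Qed.

Lemma thW_hol U l f : holU U f -> holU U (thW l f).
Proof. by move=> Hf; elim: l => [//|j l IH]; exact: TH_hol. Qed.

Lemma thW_cat l l' f : thW (l ++ l') f = thW l (thW l' f).
Proof. exact: foldr_cat. Qed.

Lemma TH_open U f g j : open U -> (forall x, U x -> f x = g x) ->
  forall x, U x -> TH j f x = TH j g x.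
Proof. by move=> oU E x Ux; exact: (congr1 (fun z => x j 0 * z) (pd_open j oU E Ux)). Qed.

Lemma thW_open U f g l : open U -> (forall x, U x -> f x = g x) ->
  forall x, U x -> thW l f x = thW l g x.
Proof.
move=> oU E; elim: l => [|j l IH] x Ux; first exact: E.
exact: (TH_open j oU IH Ux).
Qed.

Lemma THM U f g j : holU U f -> holU U g -> forall x, U x ->
  TH j (fun y => f y * g y) x = f x * TH j g x + TH j f x * g x.
Proof.
move=> Hf Hg x Ux; rewrite /TH; apply: (etrans (congr1 (fun z => x j 0 * z) (pdM j (Hf x Ux) (Hg x Ux)))).
move: (pd f j x) (pd g j x) => A B; ring.
Qed.

Lemma TH_comm U f i j : open U -> holU U f -> forall x, U x ->
  TH i (TH j f) x = TH j (TH i f) x.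
Proof.
move=> oU Hf x Ux.
have Hij := pdM i (hol_coord x j) (hol_pd j (Hf x Ux)).
have Hji := pdM j (hol_coord x i) (hol_pd i (Hf x Ux)).
have Hc := pd_comm j i (Hf x Ux).
rewrite pd_coord in Hij; rewrite pd_coord in Hji.
apply: (@etrans _ _ (x i 0 * (x j 0 * pd (pd f j) i x + (j == i)%:R * pd f j x))).
  exact: (congr1 (fun z => x i 0 * z) Hij).
apply: (@etrans _ _ (x j 0 * (x i 0 * pd (pd f i) j x + (i == j)%:R * pd f i x))); last first.
  exact: (esym (congr1 (fun z => x j 0 * z) Hji)).
have alg (A B : C) (F : 'I_N -> C) : A = B ->
    x i 0 * (x j 0 * A + (j == i)%:R * F j) = x j 0 * (x i 0 * B + (i == j)%:R * F i).
  by move=> ->; rewrite (eq_sym j i); case: (eqVneq i j) => [->|_] /=; rewrite ?mulr0n ?mulr1n; ring.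
exact: (alg _ _ (fun k => pd f k x) Hc).
Qed.

Lemma THZ U f j (z : C) : holU U f -> forall x, U x ->
  TH j (fun y => z * f y) x = z * TH j f x.
Proof.
move=> Hf x Ux; rewrite /TH; apply: (etrans (congr1 (fun z => x j 0 * z) (pdZ z j (Hf x Ux)))).
move: (pd f j x) => A; ring.
Qed.

Lemma holU_sum U (T : Type) (s : seq T) (h : T -> V -> C) :
  (forall t, holU U (h t)) -> holU U (fun x => \sum_(t <- s) h t x).
Proof. by move=> H a Ua; apply: hol_sum => t _; exact: H. Qed.

Lemma TH_sum U (T : Type) (s : seq T) (h : T -> V -> C) j :
  (forall t, holU U (h t)) -> forall x, U x ->
  TH j (fun y => \sum_(t <- s) h t y) x = \sum_(t <- s) TH j (h t) x.
Proof.
move=> H x Ux; rewrite /TH pd_sum => [|t _]; last exact: H.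
exact: mulr_sumr.
Qed.

Lemma thW_sum U (T : Type) (s : seq T) (h : T -> V -> C) l : open U ->
  (forall t, holU U (h t)) -> forall x, U x ->
  thW l (fun y => \sum_(t <- s) h t y) x = \sum_(t <- s) thW l (h t) x.
Proof.
move=> oU H; elim: l => [//|j l IH] x Ux.
apply: (etrans (TH_open j oU IH Ux)).
by apply: (TH_sum (U := U)) => // t; exact: thW_hol.
Qed.

Lemma thWZ U f l (z : C) : open U -> holU U f -> forall x, U x ->
  thW l (fun y => z * f y) x = z * thW l f x.
Proof.
move=> oU H; elim: l => [//|j l IH] x Ux.
apply: (etrans (TH_open j oU IH Ux)).
by apply: (THZ (U := U)) => //; exact: thW_hol.
Qed.

Lemma thW_TH_comm U f l j : open U -> holU U f -> forall x, U x ->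
  thW l (TH j f) x = TH j (thW l f) x.
Proof.
move=> oU Hf; elim: l => [//|i l IH] x Ux.
apply: (etrans (TH_open i oU IH Ux)).
by apply: (TH_comm (U := U)) => //; exact: thW_hol.
Qed.

Lemma thW_perm U f l l' : open U -> holU U f -> perm_eq l l' ->
  forall x, U x -> thW l f x = thW l' f x.
Proof.
move=> oU Hf; elim: l l' => [|j l IH] l' P x Ux.
  by move: P; rewrite perm_sym => /perm_nilP ->.
have jl' : j \in l' by rewrite -(perm_mem P) mem_head.
case/splitPr: jl' P => l1 l2; rewrite -[j :: l2]cat1s perm_sym perm_catCA /= perm_cons perm_sym => P.
rewrite thW_cat; apply: (etrans (TH_open j oU (IH _ P) Ux)).
have H := thW_TH_comm (f := thW l2 f) l1 j oU (thW_hol l2 Hf) Ux; apply: etrans (esym H).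
by rewrite thW_cat.
Qed.

(** Leibniz: every term in which some theta_j falls on [q] contains a strictly shorter word applied
    to [f], and vanishes at [a]. *)
Lemma thW_mul_low U f q l a (P : pred 'I_N) : open U -> holU U f -> holU U q -> U a ->
  all P l -> (forall l', all P l' -> (size l' < size l)%N -> thW l' f a = 0) ->
  thW l (fun y => q y * f y) a = q a * thW l f a.
Proof.
move=> oU Hf Hq Ua; elim/last_ind: l f q Hf Hq => [//|l j IH] f q Hf Hq.
rewrite all_rcons => /andP[Pj Pl] H0.
rewrite -cats1 !thW_cat.
have E := thW_open l oU (THM (U := U) j Hq Hf) Ua.
apply: (etrans E) => {E}.
have H1 : holU U (TH j q) by exact: TH_hol.
have H2 : holU U (TH j f) by exact: TH_hol.
have E2 := @thW_sum U bool [:: true; false]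
  (fun b y => if b then q y * TH j f y else TH j q y * f y) l oU _ a Ua.
apply: etrans (_ : thW l (fun y => q y * TH j f y) a + thW l (fun y => TH j q y * f y) a = _).
  have {E2} := E2 _; rewrite !big_cons big_nil addr0 => <-.
    by congr (thW l _ a); apply/funext => y; rewrite !big_cons big_nil addr0.
  by case=> b Ub; apply: hol_mul; [exact: Hq|exact: H2|exact: H1|exact: Hf].
rewrite (IH (TH j f) q) //; last first.
  move=> l' Pl' l'l; have := H0 (rcons l' j); rewrite all_rcons Pj Pl' -cats1 thW_cat; apply=> //.
  by rewrite cats1 !size_rcons ltnS.
rewrite (IH f (TH j q)) //; last first.
  by move=> l' Pl' l'l; apply: H0 => //; rewrite size_rcons ltnW.
by rewrite (H0 l) ?size_rcons // mulr0 addr0.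
Qed.

Lemma pdw_mul_flat U f q d a : open U -> holU U f -> holU U q -> U a ->
  (forall l, (size l <= d)%N -> pdw l f a = 0) ->
  forall l, (size l <= d)%N -> pdw l (fun y => q y * f y) a = 0.
Proof.
move=> oU + + Ua; elim: d f q => [|d IH] f q Hf Hq H0.
  by case=> // _; have f0 : f a = 0 := H0 [::] isT; rewrite /= f0 mulr0.
case/lastP => [_|l j]; first by have f0 : f a = 0 := H0 [::] isT; rewrite /= f0 mulr0.
rewrite size_rcons ltnS => ld; rewrite /pdw foldr_rcons -!/(pdw _ _).
have E x : U x -> pd (fun y => q y * f y) j x = q x * pd f j x + pd q j x * f x.
  by move=> Ux; exact: pdM j (Hq x Ux) (Hf x Ux).
apply: (etrans (pdw_open l oU E Ua)).
have Hfj : holU U (pd f j) by move=> x Ux; exact: hol_pd (Hf x Ux).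
have Hqj : holU U (pd q j) by move=> x Ux; exact: hol_pd (Hq x Ux).
have add (u v : V -> C) : holU U u -> holU U v -> forall l', forall x, U x ->
    pdw l' (fun y => u y + v y) x = pdw l' u x + pdw l' v x.
  move=> Hu Hv; elim=> [//|k l' IHl] x Ux; apply: (etrans (pd_open k oU IHl Ux)).
  by apply: pdD; apply: hol_pdw; [exact: Hu|exact: Hv].
apply: (etrans (add _ _ _ _ l a Ua)).
- by move=> x Ux; apply: hol_mul; [exact: Hq|exact: Hfj].
- by move=> x Ux; apply: hol_mul; [exact: Hqj|exact: Hf].
rewrite (IH (pd f j) q) // => [|l' l'd]; last first.
  by have := H0 (rcons l' j); rewrite /pdw foldr_rcons; apply; rewrite size_rcons.
rewrite (IH f (pd q j)) ?addr0 // => l' l'd; apply: H0; exact: leqW.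
Qed.

(** Off the coordinate hyperplanes d_j = x_j^(-1) theta_j. Induction on the order applies to theta_j
    f, and multiplication by x_j^(-1) preserves vanishing to a given order. *)
Lemma thW_flat U f a : open U -> holU U f -> U a ->
  (forall j x, U x -> x j 0 != 0) -> (forall l, thW l f a = 0) -> flat a f.
Proof.
move=> oU Hf Ua Unz H.
suff K d : forall g, holU U g -> (forall l, thW l g a = 0) ->
    forall l, (size l <= d)%N -> pdw l g a = 0 by move=> l; exact: (K (size l) f Hf H).
elim: d => [|d IH] g Hg H0; first by case=> // _; exact: (H0 [::]).
case/lastP => [_|l j]; first exact: (H0 [::]).
rewrite size_rcons ltnS => ld; rewrite /pdw foldr_rcons -!/(pdw _ _).
have E x : U x -> pd g j x = (x j 0)^-1 * TH j g x.
  by move=> Ux; rewrite /TH mulKf // Unz.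
apply: (etrans (pdw_open l oU E Ua)).
apply: (@pdw_mul_flat U (TH j g) (fun x => (x j 0)^-1) d a oU) => //.
- exact: TH_hol.
- by move=> x Ux; apply: hol_inv; exact: Unz.
- apply: IH; first exact: TH_hol.
  by move=> l'; have := H0 (rcons l' j); rewrite -cats1 thW_cat.
Qed.

End Theta.

(** * Solutions are determined by their square-free Euler derivatives *)

Section Solutions.
Variables (R : realType) (n : nat).
Local Notation C := R[i].
Local Notation N := (n.+1 + n.+1)%N.
Local Notation V := 'cV[C]_N.
Implicit Types (a x : V) (U : set V) (f g : V -> C).
Local Notation lm := (lift ord_max).
Local Notation om := (ord_max : 'I_n.+1).
Local Notation p i := (pos (lm i)).

(** The Euler equations in solved form: every theta is expressed through theta_1, ...,
    theta_(m-1). *)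
Definition Eul U f := [/\ holU U f,
  forall i : 'I_n, forall x, U x -> TH (neg (lm i)) f x = TH (p i) f x,
  forall x, U x -> TH (pos om) f x = - \sum_(i < n) TH (p i) f x &
  forall x, U x -> TH (neg om) f x = - \sum_(i < n) TH (p i) f x].

Definition Box U f := forall (i : 'I_n) x, U x ->
  pd (pd f (neg (lm i))) (p i) x = pd (pd f (neg om)) (pos om) x.

Lemma Amx_row0 j : Amx n (lshift _ 0) j = 1.
Proof.
by rewrite /Amx; case: (split_ordP j) => i ->; rewrite ?block_mxEul ?block_mxEur mxE.
Qed.

Lemma Amx_rowS i j : Amx n (rshift 1 i) j = (j == pos i)%:R - (j == neg i)%:R.
Proof.
rewrite /Amx; case: (split_ordP j) => k ->; rewrite ?block_mxEdl ?block_mxEdr !mxE !eq_posneg eq_sym.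
  by rewrite subr0.
by rewrite sub0r.
Qed.

Lemma euler_row0 f x : weyl_act (euler C (Amx n) (lshift _ 0)) f x = \sum_j TH j f x.
Proof.
rewrite euler_act; apply: eq_bigr => j _; rewrite Amx_row0.
exact: mul1r.
Qed.

Lemma euler_rowS f x i :
  weyl_act (euler C (Amx n) (rshift _ i)) f x = TH (pos i) f x - TH (neg i) f x.
Proof.
rewrite euler_act; have E j : (Amx n (rshift 1 i) j)%:~R * (x j 0 * pd f j x) =
    (j == pos i)%:R * TH j f x - (j == neg i)%:R * TH j f x.
  by rewrite Amx_rowS rmorphB /= !rmorph_nat -mulrBl.
under eq_bigr => j _ do rewrite E.
have D k : \sum_j (j == k)%:R * TH j f x = TH k f x.
  rewrite (bigD1 k) //= eqxx mul1r big1 ?addr0 // => j /negbTE ->.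
  exact: mul0r.
by rewrite big_split /= sumrN !D.
Qed.

(** This is e^(z_i), written without logarithms. *)
Definition tq (i : 'I_n) x : C :=
  x (p i) 0 * x (neg (lm i)) 0 / (x (pos om) 0 * x (neg om) 0).

Lemma solution_Eul U f : open U -> solution (Amx n) U f -> Eul U f.
Proof.
move=> oU [/holomorphicE Hf Hid].
have H0 x : U x -> \sum_j TH j f x = 0.
  by move=> Ux; rewrite -euler_row0; apply: Hid => //; apply: li_gen; right; eexists.
have HS i x : U x -> TH (pos i) f x = TH (neg i) f x.
  move=> Ux; apply/eqP; rewrite -subr_eq0 -euler_rowS; apply/eqP; apply: Hid => //.
  by apply: li_gen; right; eexists.
have Hm x : U x -> TH (pos om) f x = - \sum_(i < n) TH (p i) f x.
  move=> Ux; have := H0 x Ux; rewrite sum_N -HS // big_split /=.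
  under [X in _ + X + _]eq_bigr => i _ do rewrite -HS //.
  move: (\sum_(i < n) _) (TH (pos om) f x) => S T E.
  by apply: (mulfI (_ : (2 : C) != 0)); [rewrite pnatr_eq0|move/eqP: E; rewrite addr_eq0 => /eqP E; rewrite mulrN !mulr_natl !mulr2n E opprK].
split; [exact: Hf| |exact: Hm|].
  by move=> i x Ux; exact: esym (HS _ x Ux).
by move=> x Ux; exact: etrans (esym (HS om x Ux)) (Hm x Ux).
Qed.

Lemma word_pair U f (j j' : 'I_N) : open U -> holU U f -> forall x, U x ->
  pdw (word (mdl j 1 + mdl j' 1)) f x = pd (pd f j') j x.
Proof.
move=> oU Hf x Ux; apply: (etrans (pdw_perm oU Hf (_ : perm_eq _ [:: j; j']) Ux)); last by [].
apply: perm_word => k; rewrite /= !mxE nataddE (eq_sym k j) (eq_sym k j').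
by case: (j == k); case: (j' == k).
Qed.

Lemma solution_Box U f : open U -> solution (Amx n) U f -> Box U f.
Proof.
move=> oU [/holomorphicE Hf Hid] i x Ux.
have := Hid (WAdd (dmonomial C (mdl (p i) 1 + mdl (neg (lm i)) 1))
  (WMul (WC (-1)) (dmonomial C (mdl (pos om) 1 + mdl (neg om) 1)))) _ x Ux.
rewrite /= !dmonomial_act.
rewrite (word_pair (p i) (neg (lm i)) oU Hf Ux) (word_pair (pos om) (neg om) oU Hf Ux).
move=> H; apply/eqP; rewrite -subr_eq0 -mulN1r; apply/eqP; apply: H.
apply: li_gen; left; apply: li_gen.
exists (mdl (p i) 1 + mdl (neg (lm i)) 1), (mdl (pos om) 1 + mdl (neg om) 1); split=> //.
have S (j j' : 'I_N) : \sum_k (map_mx Posz (mdl j 1 + mdl j' 1) : 'cV[int]_N) k 0 = 2.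
  have -> : \sum_k (map_mx Posz (mdl j 1 + mdl j' 1) : 'cV[int]_N) k 0 = Posz (deg (mdl j 1 + mdl j' 1)).
    by rewrite /deg (big_morph _ PoszD (erefl (Posz 0))); apply: eq_bigr => k _; rewrite mxE.
  by rewrite degD !deg_mdl.
apply/colP => k; case: (split_ordP k) => k' ->.
  by rewrite (ord1 k') !Amx0 !S.
by rewrite !AmxS !mxE !eq_posneg !nataddE; case: (_ == _); case: (_ == _).
Qed.

Lemma Eul_Box_solution U f : open U -> Eul U f -> Box U f -> solution (Amx n) U f.
Proof.
move=> oU [Hf E1 E2 E3] Hb; split; first exact/holomorphicE.
apply: (left_ideal_act oU Hf) => P [HP|[i _ <-]].
  apply: (left_ideal_act oU Hf) HP => Q [u [v [Auv ->]]] x Ux.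
  rewrite /= !dmonomial_act (toric_act oU Hf Hb (eqAP Auv) Ux).
  by rewrite mulN1r subrr.
move=> x Ux; case: (split_ordP i) => k ->.
  rewrite (ord1 k) euler_row0 sum_N E2 // E3 //.
  under eq_bigr => j _ do rewrite E1 //.
  by rewrite big_split /= -opprD subrr.
rewrite euler_rowS; elim/ordm_ind: k => [j|]; first by rewrite E1 // subrr.
by rewrite E2 // E3 // subrr.
Qed.

Lemma Eul_TH U f j : open U -> Eul U f -> Eul U (TH j f).
Proof.
move=> oU [Hf E1 E2 E3]; have Hs : forall i : 'I_n, holU U (TH (p i) f) by move=> i; exact: TH_hol.
split; first exact: TH_hol.
- move=> i x Ux; apply: (etrans (TH_comm _ j oU Hf Ux)).
  apply: (etrans (TH_open j oU (E1 i) Ux)).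
  exact: (TH_comm j (p i) oU Hf Ux).
- move=> x Ux; apply: (etrans (TH_comm _ j oU Hf Ux)).
  apply: (etrans (TH_open j oU E2 Ux)).
  have E x' : U x' -> - \sum_(i < n) TH (p i) f x' = -1 * \sum_(i < n) TH (p i) f x'.
    by move=> _; rewrite mulN1r.
  apply: (etrans (TH_open j oU E Ux)).
  apply: (etrans (THZ j (-1) (holU_sum _ Hs) Ux)); rewrite mulN1r; congr (- _).
  rewrite (TH_sum (index_enum _) j Hs Ux); apply: eq_bigr => i _; exact: (TH_comm j (p i) oU Hf Ux).
- move=> x Ux; apply: (etrans (TH_comm _ j oU Hf Ux)).
  apply: (etrans (TH_open j oU E3 Ux)).
  have E x' : U x' -> - \sum_(i < n) TH (p i) f x' = -1 * \sum_(i < n) TH (p i) f x'.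
    by move=> _; rewrite mulN1r.
  apply: (etrans (TH_open j oU E Ux)).
  apply: (etrans (THZ j (-1) (holU_sum _ Hs) Ux)); rewrite mulN1r; congr (- _).
  rewrite (TH_sum (index_enum _) j Hs Ux); apply: eq_bigr => i _; exact: (TH_comm j (p i) oU Hf Ux).
Qed.

Lemma TH_TH_neq U f j k : open U -> holU U f -> j != k -> forall x, U x ->
  TH j (TH k f) x = x j 0 * x k 0 * pd (pd f k) j x.
Proof.
move=> oU Hf jk x Ux; have H := pdM j (hol_coord x k) (hol_pd k (Hf x Ux)).
apply: (etrans (congr1 (fun z => x j 0 * z) H)).
by rewrite pd_coord eq_sym (negbTE jk) mul0r addr0 mulrA.
Qed.

(** For distinct indices theta_j theta_k = x_j x_k d_j d_k. Applied to the pairs (i, -i) and (m,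
    -m), with the Euler equations eliminating theta_-i, theta_m and theta_-m, the binomial equation
    becomes this relation. *)
Lemma TH_relation U f : open U -> Eul U f -> Box U f -> (forall j x, U x -> x j 0 != 0) ->
  forall (i : 'I_n) x, U x -> TH (p i) (TH (p i) f) x =
    tq i x * \sum_(j < n) \sum_(l < n) TH (p j) (TH (p l) f) x.
Proof.
move=> oU Ef Hb Unz i x Ux; have [Hf E1 E2 E3] := Ef.
have EL : TH (p i) (TH (p i) f) x = x (p i) 0 * x (neg (lm i)) 0 * pd (pd f (neg om)) (pos om) x.
  apply: (etrans (esym (TH_open (p i) oU (E1 i) Ux))).
  apply: (etrans (TH_TH_neq oU Hf _ Ux)); first by rewrite pos_neg.
  exact: (congr1 (fun z => x (p i) 0 * x (neg (lm i)) 0 * z) (Hb i x Ux)).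
have ER : \sum_(j < n) \sum_(l < n) TH (p j) (TH (p l) f) x =
    x (pos om) 0 * x (neg om) 0 * pd (pd f (neg om)) (pos om) x.
  apply: etrans (TH_TH_neq oU Hf _ Ux); last by rewrite pos_neg.
  have [_ _ F2 _] := Eul_TH (neg om) oU Ef.
  apply: esym; apply: (etrans (F2 x Ux)); rewrite -sumrN; apply: eq_bigr => j _.
  have E3' x' : U x' -> TH (neg om) f x' = -1 * \sum_(i < n) TH (p i) f x'.
    by move=> Ux'; rewrite E3 // mulN1r.
  have Hs : forall i : 'I_n, holU U (TH (p i) f) by move=> k; exact: TH_hol.
  apply: (etrans (congr1 -%R (TH_open (p j) oU E3' Ux))).
  apply: (etrans (congr1 -%R (THZ (p j) (-1) (holU_sum _ Hs) Ux))); rewrite mulN1r opprK.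
  exact: (TH_sum (index_enum _) (p j) Hs Ux).
rewrite EL ER /tq; move: (pd _ _ _) => D.
have h1 := Unz (pos om) x Ux; have h2 := Unz (neg om) x Ux.
by field; rewrite h1 h2.
Qed.

(* [phi w] stands for the value at a point of the derivative of a solution along
   the word [w] of Euler operators: the relations [theta_i ^ 2 = t_i (\sum_j
   theta_j) ^ 2] then express it through square-free words. *)
Definition regular (t : 'I_n -> C) := forall K (phi : seq 'I_n -> C),
  (forall w w', perm_eq w w' -> phi w = phi w') ->
  (forall w, size w = K -> uniq w -> phi w = 0) ->
  (forall i w, (size w).+2 = K ->
    phi (w ++ [:: i; i]) = t i * \sum_(j < n) \sum_(l < n) phi (w ++ [:: j; l])) ->
  forall w, size w = K -> phi w = 0.

Lemma not_uniq_perm (w : seq 'I_n) : ~~ uniq w -> exists i w', perm_eq w (w' ++ [:: i; i]).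
Proof.
elim: w => //= i w IH; rewrite negb_and negbK => /orP[iw|/IH[j [w' P]]].
  exists i, (rem i w); rewrite perm_sym perm_catC /= perm_cons perm_sym.
  exact: perm_to_rem.
by exists j, (i :: w'); rewrite /= perm_cons.
Qed.

(* With [M] the maximum of [normc (phi w) / \prod_(i <- w) r i], the relations
   give [M <= (\sum_i r i) ^ 2 * M]. *)
Lemma regular_small (t : 'I_n -> C) (r : 'I_n -> R) : (forall i, 0 < r i) ->
  (forall i, normc (t i) = r i ^+ 2) -> \sum_i r i < 1 -> regular t.
Proof.
move=> r0 tr sr K phi Hp Hu Hr.
pose rho (w : seq 'I_n) := \prod_(i <- w) r i.
have rho0 w : 0 < rho w by apply: prodr_gt0 => i _.
pose M := \big[Num.max/0]_(w : K.-tuple 'I_n) (normc (phi w) / rho w).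
have HM w : size w = K -> normc (phi w) <= M * rho w.
  move=> sw; rewrite -ler_pdivrMr //; have wK : size w == K by apply/eqP.
  exact: (le_bigmax _ (fun w : K.-tuple 'I_n => normc (phi w) / rho w) (Tuple wK)).
set s := \sum_i r i in sr *; have s0 : 0 <= s by apply: sumr_ge0 => i _; exact: ltW.
have M0 : 0 <= M by exact: bigmax_ge_id.
have HM2 w : size w = K -> normc (phi w) <= s ^+ 2 * M * rho w.
  move=> sw; have [uw|/not_uniq_perm[i [w' P]]] := boolP (uniq w).
    by rewrite Hu // normc0 mulr_ge0 ?(ltW (rho0 w)) // mulr_ge0 // exprn_ge0.
  have sw' : (size w').+2 = K by rewrite -sw (perm_size P) size_cat addn2.
  rewrite (Hp _ _ P) Hr // normcM tr.
  have -> : rho w = rho w' * r i ^+ 2.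
    by rewrite /rho (perm_big _ P) /= big_cat /= !big_cons big_nil mulr1.
  have -> : s ^+ 2 * M * (rho w' * r i ^+ 2) = r i ^+ 2 * (M * rho w' * s ^+ 2) by ring.
  rewrite ler_wpM2l ?exprn_ge0 ?(ltW (r0 i)) //; apply: le_trans (normc_sum _ _ _) _.
  have -> : M * rho w' * s ^+ 2 = \sum_j \sum_l M * (rho w' * (r j * r l)).
    rewrite expr2 /s big_distrlr /= mulr_sumr; apply: eq_bigr => j _.
    by rewrite mulr_sumr; apply: eq_bigr => l _; rewrite [RHS]mulrA.
  apply: ler_sum => j _; apply: le_trans (normc_sum _ _ _) _; apply: ler_sum => l _.
  apply: le_trans (HM _ _) _; first by rewrite size_cat addn2.
  by rewrite /rho big_cat /= !big_cons big_nil mulr1.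
have M1 : M <= s ^+ 2 * M.
  apply: bigmax_le; first by rewrite mulr_ge0 // exprn_ge0.
  by move=> w _; rewrite ler_pdivrMr //; apply: HM2; rewrite size_tuple.
have s2 : s ^+ 2 < 1 by rewrite expr_lt1.
have ME : M = 0 by apply/le_anti; rewrite M0 andbT; nra.
move=> w sw; apply: normc_small_eq0 => e e0.
by apply: le_trans (HM w sw) _; rewrite ME mul0r ltW.
Qed.

End Solutions.

Section Determination.
Variables (R : realType) (n : nat).
Local Notation C := R[i].
Local Notation N := (n.+1 + n.+1)%N.
Local Notation V := 'cV[C]_N.
Implicit Types (a x : V) (U : set V) (f g : V -> C).
Local Notation lm := (lift ord_max).
Local Notation om := (ord_max : 'I_n.+1).
Local Notation p i := (pos (lm i)).

(** The letters of a word are removed from the right: the innermost theta_j is replaced by its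
    expression through the theta_i, i < m, and theta_j f satisfies the Euler equations again. *)
Lemma Eul_flat U f a : open U -> U a -> (forall j x, U x -> x j 0 != 0) -> Eul U f ->
  (forall w : seq 'I_n, thW (map (fun i => p i) w) f a = 0) -> flat a f.
Proof.
move=> oU Ua Unz Ef Hw; apply: (thW_flat oU _ Ua Unz); first by case: Ef.
move=> l; elim/last_ind: l f Ef Hw => [|l j IH] f Ef Hw; first exact: (Hw [::]).
rewrite -cats1 thW_cat; apply: (IH (TH j f)); first exact: Eul_TH.
have [Hf E1 E2 E3] := Ef.
have Hp w (i : 'I_n) : thW (map (fun i => p i) w) (TH (p i) f) a = 0.
  by have := Hw (rcons w i); rewrite map_rcons -cats1 thW_cat.
have Hs (i : 'I_n) : holU U (TH (p i) f) by exact: TH_hol.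
have Hsum w g : (forall x, U x -> g x = - \sum_(i < n) TH (p i) f x) ->
    thW (map (fun i => p i) w) g a = 0.
  move=> Eg; have Eg' x : U x -> g x = -1 * \sum_(i < n) TH (p i) f x.
    by move=> Ux; rewrite mulN1r; exact: Eg.
  apply: (etrans (thW_open _ oU Eg' Ua)); apply: (etrans (thWZ _ (-1) oU (holU_sum _ Hs) Ua)).
  rewrite (thW_sum (index_enum _) _ oU Hs Ua) big1 ?mulr0 // => i _; exact: Hp.
move=> w; elim/ordN_ind: j => j; case: (unliftP om j) => [i ->|->].
- exact: Hp.
- exact: Hsum E2.
- by apply: (etrans (thW_open _ oU (E1 i) Ua)); exact: Hp.
- exact: Hsum E3.
Qed.

(** The coefficient [tq i] is not constant, but once the words of length below K vanish at [a], the
    derivatives that fall on it contribute nothing. At length K the relations hold with the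
    constants [tq i a], which is the situation of [regular]. *)
Lemma solution_determined U f a : open U -> U a -> (forall j x, U x -> x j 0 != 0) ->
  Eul U f -> Box U f -> regular (fun i => tq i a) ->
  (forall w : seq 'I_n, uniq w -> thW (map (fun i => p i) w) f a = 0) -> flat a f.
Proof.
move=> oU Ua Unz Ef Bf Hreg Hu; apply: (Eul_flat oU Ua Unz Ef) => w.
have [Hf _ _ _] := Ef.
have [K] := ubnP (size w); elim: K w => // K IH w; rewrite ltnS => wK.
have [/IH//|Kw] := ltnP (size w) K.
have {wK Kw} sw : size w = K by apply/eqP; rewrite eqn_leq wK Kw.
apply: (Hreg K (fun w => thW (map (fun i => p i) w) f a)) sw.
- move=> w1 w2 P; apply: (thW_perm oU Hf _ Ua); exact: perm_map.
- by move=> w1 _; exact: Hu.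
move=> i w1 sw1; rewrite map_cat thW_cat.
pose h x := \sum_(j < n) \sum_(l < n) TH (p j) (TH (p l) f) x.
have Hh2 (j : 'I_n) : holU U (fun x => \sum_(l < n) TH (p j) (TH (p l) f) x).
  by apply: holU_sum => l; apply: TH_hol; exact: TH_hol.
have Hh : holU U h by apply: holU_sum => j; exact: Hh2.
have hE w' : thW (map (fun i => p i) w') h a =
    \sum_(j < n) \sum_(l < n) thW (map (fun i => p i) (w' ++ [:: j; l])) f a.
  apply: (etrans (thW_sum (index_enum _) _ oU Hh2 Ua)); apply: eq_bigr => j _.
  have Hjl (l : 'I_n) : holU U (TH (p j) (TH (p l) f)) by apply: TH_hol; exact: TH_hol.
  apply: (etrans (thW_sum (index_enum _) _ oU Hjl Ua)); apply: eq_bigr => l _.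
  by rewrite map_cat thW_cat.
have tqh : holU U (tq i : V -> C).
  move=> x Ux; apply: hol_eq (hol_mul (hol_mul (hol_coord x (p i)) (hol_coord x (neg (lm i))))
    (hol_mul (hol_inv (Unz (pos om) x Ux)) (hol_inv (Unz (neg om) x Ux)))) => y.
  by rewrite /tq invfM.
apply: (etrans (thW_open _ oU (TH_relation oU Ef Bf Unz i) Ua)).
rewrite -hE; apply: (thW_mul_low (P := fun j => j \in map (fun i => p i) (enum 'I_n)) oU Hh tqh Ua).
  by apply/allP => _ /mapP[k _ ->]; apply/mapP; exists k; rewrite ?mem_enum.
move=> l' Pl' sl'.
have [w2 l'E] : exists w2, l' = map (fun i => p i) w2.
  elim: l' Pl' {sl'} => [|j l' IHl] /=; first by exists [::].
  by move=> /andP[/mapP[k _ ->] /IHl[w2 ->]]; exists (k :: w2).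
rewrite l'E hE big1 // => j _; rewrite big1 // => l _; apply: IH.
by move: sl'; rewrite l'E !size_map size_cat -sw1 addn2.
Qed.

End Determination.

(** * Termwise derivatives of series of functions *)

Section SeriesDerivatives.
Variables (R : realType) (N : nat).
Local Notation C := R[i].
Local Notation V := 'cV[C]_N.
Implicit Types (a x : V) (U : set V) (f g : V -> C) (l : seq 'I_N).

Lemma series_pd (K : choiceType) (fk : K -> V -> C) (Mk : K -> R) a r M f j : 0 < r ->
  (forall k, PB a r (Mk k) (fk k)) -> (forall F : {fset K}, \sum_(k <- F) Mk k <= M) ->
  (forall x, close a r x -> hs (fun k => fk k x) (f x)) ->
  forall x, close a (r / 2) x -> hs (fun k => pd (fk k) j x) (pd f j x).
Proof.
move=> r0 Hk HM Hf x Hx; have r20 : 0 < r / 2 by rewrite divr_gt0.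
have Hk' k : PB x (r / 2) (Mk k) (fk k).
  by rewrite {1}(_ : r / 2 = r - r / 2); [apply: PB_recenter (Hk k) Hx _ _; lra|lra].
have [ck Hck] := choice Hk'.
have [y Hy|c Hc Hcp] := PS_series r20 Hck HM (f := f).
  by apply: Hf; rewrite [r]splitr; exact: close_trans Hx Hy.
rewrite (PS_pd1 j Hc); apply: hs_ext (Hcp (mdl j 1)) => k.
exact: (esym (PS_pd1 j (Hck k))).
Qed.

Lemma series_pdw (K : choiceType) (fk : K -> V -> C) (Mk : K -> R) a r M f l : 0 < r ->
  (forall k, PB a r (Mk k) (fk k)) -> (forall F : {fset K}, \sum_(k <- F) Mk k <= M) ->
  (forall x, close a r x -> hs (fun k => fk k x) (f x)) ->
  exists2 d, 0 < d &
    forall x, close a d x -> hs (fun k => pdw l (fk k) x) (pdw l f x).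
Proof.
move=> r0 Hk HM Hf.
suff [d d0 [D [D0 Hd Hx]]] : exists2 d, 0 < d & exists D, [/\ 0 <= D,
    forall k, PB a d (D * Mk k) (pdw l (fk k)) &
    forall x, close a d x -> hs (fun k => pdw l (fk k) x) (pdw l f x)] by exists d.
elim: l => [|j l [d d0 [D [D0 Hd Hx]]]].
  exists r => //; exists 1; split=> // k; rewrite mul1r; exact: Hk.
exists (d / 2); first by rewrite divr_gt0.
exists (D / d); split; first by rewrite divr_ge0 // ltW.
- move=> k; rewrite mulrAC; exact: PB_pd j (Hd k).
- apply: (series_pd j d0 Hd (M := D * M)) => [F|//].
  by rewrite -mulr_sumr ler_wpM2l.
Qed.

Lemma pdw_sum U (T : Type) (s : seq T) (h : T -> V -> C) l : open U ->
  (forall t, holU U (h t)) -> forall x, U x ->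
  pdw l (fun y => \sum_(t <- s) h t y) x = \sum_(t <- s) pdw l (h t) x.
Proof.
move=> oU H; elim: l => [//|j l IH] x Ux.
apply: (etrans (pd_open j oU IH Ux)).
by apply: (pd_sum s (P := predT)) => t _; apply: hol_pdw; exact: H.
Qed.

(** The default 0 for a divergent family makes the series into functions defined everywhere; only
    values at points of convergence are used. *)
Definition hsum (I : choiceType) (u : I -> C) : C := xget 0 [set z | hs u z].

Lemma hsumE (I : choiceType) (u : I -> C) z : hs u z -> hsum u = z.
Proof. by move=> H; apply: (@xget_subset1 _ 0 [set z | hs u z] z H) => x y; exact: hs_uniq. Qed.

Lemma hsumP (I : choiceType) (u : I -> C) M : absb u M -> hs u (hsum u).
Proof. by move=> /absb_hs[z Hz]; rewrite (hsumE Hz). Qed.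

(** In a square-free word the factor [q], which varies with coordinate [j] only, is differentiated
    at most once, so the Leibniz rule has just two terms. *)
Lemma pdw_mul_coord U (q h : V -> C) j l : open U -> holU U q -> holU U h ->
  (forall i, i != j -> forall x, U x -> pd q i x = 0) -> uniq l ->
  forall x, U x -> pdw l (fun y => q y * h y) x =
    q x * pdw l h x + (if j \in l then pd q j x * pdw (rem j l) h x else 0).
Proof.
move=> oU Hq Hh Hqi ul.
have Hw g l' : holU U g -> holU U (pdw l' g) by move=> Hg y Uy; apply: hol_pdw; exact: Hg.
have out g l' : holU U g -> (forall i, i != j -> forall x, U x -> pd g i x = 0) ->
    j \notin l' -> forall h', holU U h' -> forall x, U x ->
    pdw l' (fun y => g y * h' y) x = g x * pdw l' h' x.
  move=> Hg Hgi; elim: l' => [//|i l' IH] /=; rewrite inE negb_or => /andP[ij jl] h' Hh' x Ux.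
  apply: (etrans (pd_open i oU (IH jl h' Hh') Ux)).
  apply: (etrans (pdM i (Hg x Ux) (Hw _ l' Hh' x Ux))).
  by rewrite Hgi 1?eq_sym // mul0r addr0.
move=> x Ux; case: ifP => [jl|/negbT jl]; last by rewrite addr0; exact: out.
have P : perm_eq l (rem j l ++ [:: j]).
  by rewrite perm_sym perm_catC /= perm_sym; exact: perm_to_rem.
have jr : j \notin rem j l by rewrite mem_rem_uniqF.
have Hqh : holU U (fun y => q y * h y) by move=> y Uy; exact: hol_mul (Hq y Uy) (Hh y Uy).
apply: (etrans (pdw_perm oU Hqh P Ux)); rewrite pdw_cat.
have E y : U y -> pdw [:: j] (fun y => q y * h y) y = q y * pd h j y + pd q j y * h y.
  by move=> Uy; exact: pdM j (Hq y Uy) (Hh y Uy).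
apply: (etrans (pdw_open _ oU E Ux)).
have Hhj : holU U (pd h j) by move=> y Uy; exact: hol_pd j (Hh y Uy).
have Hqj : holU U (pd q j) by move=> y Uy; exact: hol_pd j (Hq y Uy).
have add (u v : V -> C) : holU U u -> holU U v -> forall l', forall y, U y ->
    pdw l' (fun y => u y + v y) y = pdw l' u y + pdw l' v y.
  move=> Hu Hv; elim=> [//|k l' IHl] y Uy; apply: (etrans (pd_open k oU IHl Uy)).
  by apply: pdD; apply: Hw.
apply: (etrans (add _ _ _ _ (rem j l) x Ux)).
- by move=> y Uy; exact: hol_mul (Hq y Uy) (Hhj y Uy).
- by move=> y Uy; exact: hol_mul (Hqj y Uy) (Hh y Uy).
have Hqji i : i != j -> forall y, U y -> pd (pd q j) i y = 0.
  move=> ij y Uy; apply: (etrans (pd_comm j i (Hq y Uy))).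
  apply: (etrans (pd_open j oU (g := fun=> 0) (Hqi i ij) Uy)); exact: pd_cst.
apply: (etrans (congr2 +%R (out q _ Hq Hqi jr _ Hhj x Ux) (out (pd q j) _ Hqj Hqji jr _ Hh x Ux))).
congr (_ + _); congr (_ * _); apply: esym.
by apply: (etrans (pdw_perm oU Hh P Ux)); rewrite pdw_cat.
Qed.

End SeriesDerivatives.

(** * The series in the variables z and s *)

Section Terms.
Variables (R : realType) (n : nat).
Local Notation C := R[i].
Local Notation V := 'cV[C]_(n + n).
Implicit Types (a y : V) (k : 'cV[nat]_n) (r : R) (z s : 'cV[C]_n).

(* The term of index [\sum_i k_i *: g i] at [y = col_mx z s], where [z] has the
   coordinates [log x_i + log x_-i - log x_m - log x_-m] (see [Fterm_Hk]). *)
Definition Hk k (y : V) : C :=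
  (\prod_(j < deg k) (\sum_i y (rshift n i) 0 + j%:R)) ^+ 2
  * (\prod_i \prod_(j < k i 0%R) (y (rshift n i) 0 + j.+1%:R)^-1) ^+ 2
  * cexp (\sum_i (y (rshift n i) 0 + (k i 0%R)%:R) * y (lshift n i) 0).

(* Since [Hk k] is [(\sum_i s_i) ^ 2] times [wt k * exp(\sum_i k_i z_i)] to second
   order in [s], the number [wt k] measures the size of the derivatives at [s = 0]. *)
Definition wt k : R := ((deg k).-1`!%:R / \prod_i (k i 0%R)`!%:R) ^+ 2.

(** The margin [eta] pays for passing from the weights to bounds of the terms on a polydisc around
    (z, 0). Only real parts of z occur, so the condition is invariant under imaginary
    translations. *)
Definition conv z (eta M : R) := 0 < eta /\ forall F : {fset 'cV[nat]_n},
  \sum_(k <- F) wt k * \prod_i expR ((complex.Re (z i 0) + eta) * (k i 0%R)%:R) <= M.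

Lemma wt_ge0 k : 0 <= wt k.
Proof. exact: sqr_ge0. Qed.

(** The factor j = 0 is c <= e^c, and each later one satisfies c + j <= j e^c; the factorial is
    therefore that of K - 1. *)
Lemma prod_rising K (c : R) : 0 <= c ->
  \prod_(j < K) (c + j%:R) <= K.-1`!%:R * expR c ^+ K.
Proof.
move=> c0; have e1 : 1 <= expR c by rewrite -expR0 ler_expR.
have ce : c <= expR c by have := expR_ge1Dx c; lra.
case: K => [|K]; first by rewrite big_ord0 expr0 mul1r.
rewrite /= exprS mulrCA; elim: K => [|K IH].
  by rewrite big_ord1 addr0 fact0 mul1r expr0 mulr1.
rewrite big_ord_recr /= factS natrM exprS.
have -> : expR c * (K.+1%:R * K`!%:R * (expR c * expR c ^+ K)) =
  (expR c * (K`!%:R * expR c ^+ K)) * (K.+1%:R * expR c) by ring.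
apply: ler_pM => //.
- by apply: prodr_ge0 => j _; rewrite addr_ge0.
- by rewrite addr_ge0.
have : 0 <= (K%:R : R) * (expR c - 1) by rewrite mulr_ge0 // subr_ge0.
by have := expR_ge1Dx c; rewrite -natr1; lra.
Qed.

Lemma inv_shift_le (r : R) j : 0 < r -> r <= 1 / 2 ->
  (j.+1%:R - r)^-1 <= (j.+1%:R)^-1 * expR (2 * r).
Proof.
move=> r0 r1; have j1 : 1 <= j.+1%:R :> R by rewrite ler1n.
have h : 0 < j.+1%:R - r by lra.
have j0 : 0 < j.+1%:R :> R by rewrite ltr0n.
rewrite -[leLHS]mul1r ler_pdivrMr // mulrAC -[leLHS](mulVf (lt0r_neq0 j0)).
rewrite -mulrA ler_wpM2l ?invr_ge0 ?(ltW j0) //.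
have e := expR_ge1Dx (2 * r).
apply: le_trans (_ : (j.+1%:R - r) * (1 + 2 * r) <= _); last by rewrite ler_wpM2l // ltW.
have : 0 <= r * (2 * j.+1%:R - 1 - 2 * r) by rewrite mulr_ge0 ?(ltW r0) //; lra.
lra.
Qed.

(** A bound uniform in [k]: on a small polydisc around s = 0 each factor of H_k exceeds its weight
    by at most an exponential in |k|, which [eta] absorbs. *)
Lemma PB_Hk a (eta : R) : (forall i, a (rshift n i) 0 = 0) -> 0 < eta ->
  exists r D, [/\ 0 < r, r <= 1 / 2, 0 <= D & forall k, PB a r
    (D * (wt k * \prod_i expR ((complex.Re (a (lshift n i) 0) + eta) * (k i 0%R)%:R))) (Hk k)].
Proof.
(* In multiples of r |k|, the exponential loss is 2n from the squared numerator, 4 from the squared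
   denominators and 1 from the radius in z. *)
move=> as0 eta0; pose c : R := (2 * n + 5)%:R; have c0 : 0 < c by rewrite ltr0n addnS.
pose r := Num.min (1 / 2) (eta / c).
have r0 : 0 < r by rewrite lt_min !divr_gt0.
have r1 : r <= 1 / 2 by rewrite ge_min lexx.
have rc : c * r <= eta by rewrite mulrC -ler_pdivlMr // ge_min lexx orbT.
(* [D] bounds the product of the e^(s_i z_i), which does not involve [k]. *)
clearbody r; pose D := \prod_i expR (r * (normc (a (lshift n i) 0) + r)).
have D0 : 0 <= D by apply: prodr_ge0 => i _; exact: expR_ge0.
exists r, D; split=> // k.
have PBs i : PB a r r (fun y => y (rshift n i) 0).
  apply: PB_eq (PB_le (PB_coord (rshift n i) a 0 r0) _) => [y|]; first by rewrite subr0.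
  by rewrite as0 subr0 normc0 add0r.
have PBz i : PB a r (normc (a (lshift n i) 0) + r) (fun y => y (lshift n i) 0).
  by apply: PB_eq (PB_le (PB_coord (lshift n i) a 0 r0) _) => [y|]; rewrite subr0.
have P1 : PB a r (\prod_(j < deg k) (n%:R * r + j%:R)) (fun y => \prod_(j < deg k) (\sum_i y (rshift n i) 0 + j%:R)).
  apply: PB_prod => // j _; apply: PB_le (PB_add (PB_sum _ r0 (fun i _ => PBs i)) (PB_cst _ _ r0)) _.
  by rewrite sumr_const card_ord mulr_natl normc_nat.
have P2 : PB a r (\prod_i \prod_(j < k i 0%R) (j.+1%:R - r)^-1)
    (fun y => \prod_i \prod_(j < k i 0%R) (y (rshift n i) 0 + j.+1%:R)^-1).
  apply: PB_prod => // i _; apply: PB_prod => // j _.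
  have := @PB_inv _ _ (rshift n i) a r j.+1%:R r0; rewrite as0 add0r normc_nat; apply.
  have J1 : 1 <= j.+1%:R :> R by rewrite ler1n.
  lra.
have P3 : PB a r (D * \prod_i (expR (complex.Re (a (lshift n i) 0) + r)) ^+ k i 0)
    (fun y => cexp (\sum_i (y (rshift n i) 0 + (k i 0%R)%:R) * y (lshift n i) 0)).
  have Ez i : PB a r (expR (complex.Re (a (lshift n i) 0) + r)) (fun y => cexp (y (lshift n i) 0)).
    have H1 : PB a r r (fun y => y (lshift n i) 0 - a (lshift n i) 0).
      by apply: PB_le (PB_coord (lshift n i) a (a (lshift n i) 0) r0) _; rewrite subrr normc0 add0r.
    have := PB_mul (PB_cst a (cexp (a (lshift n i) 0)) r0) (PB_cexp H1).
    rewrite normc_cexp -expRD; apply: PB_eq => y.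
    by rewrite -cexpD; congr cexp; rewrite addrC subrK.
  have Hi i := PB_mul (PB_cexp (PB_mul (PBs i) (PBz i))) (PB_exp (k i 0) (Ez i)).
  have := @PB_prod _ _ _ (index_enum 'I_n) predT _ _ a r r0 (fun i _ => Hi i).
  rewrite /D -big_split /=; apply: PB_eq => y.
  rewrite cexp_sum; apply: eq_bigr => i _.
  by rewrite -cexpMn -cexpD mulrDl mulr_natl.
apply: PB_le (PB_mul (PB_mul (PB_exp 2 P1) (PB_exp 2 P2)) P3) _.
have J1 (j : nat) : r <= j.+1%:R.
  by have : 1 <= j.+1%:R :> R; [rewrite ler1n|lra].
have nr0 : 0 <= n%:R * r by rewrite mulr_ge0 ?(ltW r0).
have L1 : \prod_(j < deg k) (n%:R * r + j%:R) <= (deg k).-1`!%:R * expR (n%:R * r) ^+ deg k.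
  exact: prod_rising.
have L2 : \prod_i \prod_(j < k i 0%R) (j.+1%:R - r)^-1 <=
    (\prod_i (k i 0%R)`!%:R)^-1 * expR (2 * r) ^+ deg k.
  rewrite -prodrXr -prodfV -big_split /=; apply: ler_prod => i _; apply/andP; split.
    by apply: prodr_ge0 => j _; rewrite invr_ge0 subr_ge0; apply: J1.
  rewrite fact_prod natr_prod big_add1 big_mkord -prodfV /=.
  rewrite -[X in _ * expR _ ^+ X]card_ord -prodr_const -big_split /=.
  apply: ler_prod => j _; rewrite inv_shift_le // andbT invr_ge0 subr_ge0; exact: J1.
have L3 : 0 <= D * \prod_i expR (complex.Re (a (lshift n i) 0) + r) ^+ k i 0.
  by rewrite mulr_ge0 // prodr_ge0 // => i _; rewrite exprn_ge0 // expR_ge0.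
have Q1 : 0 <= \prod_(j < deg k) (n%:R * r + j%:R) by apply: prodr_ge0 => j _; rewrite addr_ge0.
have Q2 : 0 <= \prod_i \prod_(j < k i 0%R) (j.+1%:R - r)^-1.
  apply: prodr_ge0 => i _; apply: prodr_ge0 => j _; rewrite invr_ge0 subr_ge0; exact: J1.
apply: le_trans (_ : (((deg k).-1`!%:R * expR (n%:R * r) ^+ deg k) ^+ 2 *
   ((\prod_i (k i 0%R)`!%:R)^-1 * expR (2 * r) ^+ deg k) ^+ 2) * _ <= _).
  apply: ler_wpM2r => //; apply: ler_pM; rewrite ?exprn_ge0 //; apply: lerXn2r => //;
  by rewrite nnegrE; apply: le_trans L1 || apply: le_trans L2.
have -> : \prod_i expR ((complex.Re (a (lshift n i) 0) + eta) * (k i 0%R)%:R) =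
    (\prod_i expR (complex.Re (a (lshift n i) 0) + r) ^+ k i 0) * expR (eta - r) ^+ deg k.
  rewrite -prodrXr -big_split /=; apply: eq_bigr => i _.
  by rewrite -exprMn -expRD -expRM_natr; congr expR; ring.
set P := \prod_i _ ^+ _; rewrite /wt.
have E : (expR (n%:R * r) ^+ deg k) ^+ 2 * (expR (2 * r) ^+ deg k) ^+ 2 <= expR (eta - r) ^+ deg k.
  rewrite -!exprM ![(deg k * 2)%N]mulnC !exprM -exprMn lerXn2r ?nnegrE ?mulr_ge0 ?exprn_ge0 ?expR_ge0 //.
  rewrite -exprMn -expRD -expRM_natr ler_expR mulrC; move: rc; rewrite /c natrD natrM.
  move: (n%:R : R) => m; lra.
set A := (deg k).-1`!%:R; set B := \prod_i (k i 0%R)`!%:R.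
set X := expR (n%:R * r) ^+ deg k in E *; set Y := expR (2 * r) ^+ deg k in E *.
have -> : (A * X) ^+ 2 * (B^-1 * Y) ^+ 2 * (D * P) = (D * ((A / B) ^+ 2 * P)) * (X ^+ 2 * Y ^+ 2) by ring.
have -> : D * ((A / B) ^+ 2 * (P * expR (eta - r) ^+ deg k)) =
  (D * ((A / B) ^+ 2 * P)) * expR (eta - r) ^+ deg k by ring.
apply: ler_wpM2l => //; apply: mulr_ge0 => //; apply: mulr_ge0; first exact: sqr_ge0.
by apply: prodr_ge0 => i _; rewrite exprn_ge0 // expR_ge0.
Qed.

End Terms.

(** * The functions G_I: differential system and periods *)

Section Family.
Variables (R : realType) (n : nat).
Local Notation C := R[i].
Local Notation V := 'cV[C]_(n + n).
Implicit Types (a y : V) (k : 'cV[nat]_n) (r : R) (z s : 'cV[C]_n).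
Local Notation zc := (@lshift n n).
Local Notation sc := (@rshift n n).

Lemma pdw_affine (m N : nat) (h : 'cV[C]_m -> 'cV[C]_N) (F : 'cV[C]_N -> C)
    (sg : 'I_m -> 'I_N) l (x : 'cV[C]_m) :
  (forall i t (u : 'cV[C]_m), h (t *: (delta_mx i 0 : 'cV_m) + u) =
    t *: (delta_mx (sg i) 0 : 'cV_N) + h u) ->
  pdw l (fun u => F (h u)) x = pdw (map sg l) F (h x).
Proof.
move=> H; elim: l x => [//|i l IH] x.
have E : pdw l (fun u => F (h u)) = (fun u => pdw (map sg l) F (h u)) by apply/funext.
rewrite /= -/(pdw _ _) E; apply: pd_affine => t; exact: H.
Qed.

Lemma pdw_zpart (F : V -> C) s l z :
  pdw l (fun z => F (col_mx z s)) z = pdw (map zc l) F (col_mx z s).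
Proof.
apply: (pdw_affine (h := fun z => col_mx z s)) => i t z'.
apply/colP => j; case: (split_ordP j) => j' ->; rewrite !(col_mxEu, col_mxEd, mxE).
  by rewrite eq_lshift.
by rewrite eq_rlshift mulr0 add0r.
Qed.

Lemma pdw_spart (F : V -> C) z l s :
  pdw l (fun s => F (col_mx z s)) s = pdw (map sc l) F (col_mx z s).
Proof.
apply: (pdw_affine (h := fun s => col_mx z s)) => i t s'.
apply/colP => j; case: (split_ordP j) => j' ->; rewrite !(col_mxEu, col_mxEd, mxE).
  by rewrite eq_lrshift mulr0 add0r.
by rewrite eq_rshift.
Qed.

Lemma pdw_shift (N : nat) (F : 'cV[C]_N -> C) (v : 'cV[C]_N) l (x : 'cV[C]_N) :
  pdw l (fun u => F (u + v)) x = pdw l F (x + v).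
Proof.
by rewrite (pdw_affine (h := fun u => u + v) F (sg := id)) ?map_id // => i t u; rewrite addrA.
Qed.

(** On this set no denominator s_i + j + 1 vanishes, so all the terms are holomorphic on one open
    set that does not depend on the convergence of the series. *)
Definition Odom : set V := [set y | forall i, normc (y (sc i) 0) < 1].

Lemma Odom_open : open Odom.
Proof.
apply: close_open => y Oy.
have [r r0 Hr] : exists2 r, 0 < r & forall i, normc (y (sc i) 0) + r < 1.
  apply: (@fin_radius R 'I_n (fun i r => normc (y (sc i) 0) + r < 1)) => i.
  exists ((1 - normc (y (sc i) 0)) / 2) => [|d d0 dr]; have := Oy i; first by move=> h; lra.
  by lra.
exists r => // x Hx i; have -> : x (sc i) 0 = y (sc i) 0 + (x (sc i) 0 - y (sc i) 0) by ring.
by apply: le_lt_trans (le_normcD _ _) _; have := Hx (sc i); have := Hr i; lra.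
Qed.

Definition Hs k y : C := (\prod_(j < deg k) (\sum_i y (sc i) 0 + j%:R)) ^+ 2
  * (\prod_i \prod_(j < k i 0%R) (y (sc i) 0 + j.+1%:R)^-1) ^+ 2.

Definition He k y : C := \sum_i (y (sc i) 0 + (k i 0%R)%:R) * y (zc i) 0.

Lemma hol_inv_add (N : nat) (i : 'I_N) (x : 'cV[C]_N) (w : C) : x i 0 + w != 0 ->
  hol_at x (fun u => (u i 0 + w)^-1).
Proof.
rewrite -normc_eq0 => a0; have r0 : 0 < normc (x i 0 + w) by rewrite lt0r a0 normc_ge0.
exists (normc (x i 0 + w) / 2), (normc (x i 0 + w) - normc (x i 0 + w) / 2)^-1.
apply: PB_inv; lra.
Qed.

Lemma Odom_neq0 y i j : Odom y -> y (sc i) 0 + j.+1%:R != 0.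
Proof.
move=> Oy; apply/eqP => /eqP; rewrite addr_eq0 => /eqP E.
by have := Oy i; rewrite E normcN normc_nat ltNge ler1n.
Qed.

Lemma Hs_hol k : holU Odom (Hs k).
Proof.
move=> y Oy; apply: hol_mul; apply: hol_exp; apply: hol_prod => i _.
  apply: hol_add; last exact: hol_cst.
  by apply: hol_sum => i' _; exact: hol_coord.
by apply: hol_prod => j _; apply: hol_inv_add; exact: Odom_neq0.
Qed.

Lemma He_term_hol k y i : hol_at y (fun y => (y (sc i) 0 + (k i 0%R)%:R) * y (zc i) 0).
Proof.
by apply: hol_mul; [apply: hol_add; [exact: hol_coord|exact: hol_cst]|exact: hol_coord].
Qed.

Lemma He_hol k y : hol_at y (He k).
Proof. by apply: hol_sum => i _; exact: He_term_hol. Qed.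

Lemma Hk_hol k : holU Odom (Hk k).
Proof. by move=> y Oy; exact: hol_mul (Hs_hol k Oy) (hol_cexp (He_hol k y)). Qed.

Lemma pd_He k i y : pd (He k) (zc i) y = y (sc i) 0 + (k i 0%R)%:R.
Proof.
have Hc j := hol_coord y (zc j).
have Hl j : hol_at y (fun y : V => y (sc j) 0 + (k j 0%R)%:R).
  by apply: hol_add; [exact: hol_coord|exact: hol_cst].
have E j : pd (fun y : V => (y (sc j) 0 + (k j 0%R)%:R) * y (zc j) 0) (zc i) y =
    if j == i then y (sc i) 0 + (k i 0%R)%:R else 0.
  apply: (etrans (pdM (zc i) (Hl j) (Hc j))).
  rewrite (pdD (zc i) (hol_coord y (sc j)) (hol_cst _ _)) pd_coord pd_coord pd_cst.
  rewrite eq_rlshift eq_lshift addr0 mul0r addr0; case: eqP => [->|_]; by rewrite ?mulr1 ?mulr0.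
apply: (etrans (pd_sum (index_enum _) (P := predT) (zc i) (fun j _ => He_term_hol k y j))).
by rewrite (eq_bigr _ (fun j _ => E j)) -big_mkcond big_pred1_eq.
Qed.

Lemma pd_Hk k i y : Odom y -> pd (Hk k) (zc i) y = (y (sc i) 0 + (k i 0%R)%:R) * Hk k y.
Proof.
move=> Oy; apply: (etrans (pdM (zc i) (Hs_hol k Oy) (hol_cexp (He_hol k y)))).
have -> : pd (Hs k) (zc i) y = 0.
  apply: pd_dir => h; rewrite /Hs.
  have E j : (h *: (delta_mx (zc i) 0 : V) + y) (sc j) 0 = y (sc j) 0.
    by rewrite !mxE eq_rlshift mulr0 add0r.
  congr (_ ^+ 2 * _ ^+ 2); apply: eq_bigr => j _.
    by congr (_ + _); apply: eq_bigr => i' _; exact: E.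
  by apply: eq_bigr => j' _; rewrite E.
rewrite mul0r addr0 (pd_cexp (zc i) (He_hol k y)) pd_He.
by rewrite /Hk -/(Hs k y) -/(He k y); ring.
Qed.

Definition sw (I : {set 'I_n}) : seq 'I_(n + n) := map sc (enum I).

Definition GF (I : {set 'I_n}) z : C := hsum (fun k => pdw (sw I) (Hk k) (col_mx z 0)).

Lemma Odom0 z : Odom (col_mx z 0).
Proof. by move=> i; rewrite col_mxEd mxE normc0 ltr01. Qed.

(** The series F_N itself in the variables (z, s); under [conv] every G_I is a restriction to s = 0
    of one of its derivatives. *)
Definition Hsum y : C := hsum (fun k => Hk k y).

Lemma Hk_summable z eta M : conv z eta M ->
  exists r (Mk : 'cV[nat]_n -> R) M', [/\ 0 < r, forall k, PB (col_mx z 0) r (Mk k) (Hk k),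
    forall F : {fset 'cV[nat]_n}, \sum_(k <- F) Mk k <= M' &
    forall y, close (col_mx z 0) r y -> hs (fun k => Hk k y) (Hsum y)].
Proof.
move=> [eta0 HM]; have [|r [D [r0 _ D0 Hk']]] := @PB_Hk R n (col_mx z 0) eta _ eta0.
  by move=> i; rewrite col_mxEd mxE.
have HF : forall F : {fset 'cV[nat]_n}, \sum_(k <- F) D * (wt R k *
    \prod_i expR ((complex.Re ((col_mx z 0 : V) (zc i) 0) + eta) * (k i 0%R)%:R)) <= D * M.
  move=> F; rewrite -mulr_sumr ler_wpM2l //; apply: le_trans (HM F).
  by apply: ler_sum => k _; rewrite ler_wpM2l ?wt_ge0 //; under eq_bigr => i _ do rewrite col_mxEu.
exists r; eexists; exists (D * M); split; [done|exact: Hk'|exact: HF|].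
move=> y Hy; apply: (@hsumP _ _ _ (D * M)) => F; apply: le_trans (HF F).
by apply: ler_sum => k _; exact: PB_norm (Hk' k) Hy.
Qed.

Lemma conv_near z eta M z' : conv z eta M -> close z (eta / 2) z' -> conv z' (eta / 2) M.
Proof.
move=> [eta0 HM] Hz; split=> [|F]; first by rewrite divr_gt0.
apply: le_trans (HM F); apply: ler_sum => k _; rewrite ler_wpM2l ?wt_ge0 //.
apply: ler_prod => i _; rewrite expR_ge0 ler_expR ler_wpM2r //.
have : complex.Re (z' i 0 - z i 0) <= eta / 2.
  apply: le_trans (ler_norm _) _; apply: le_trans (normc_Re _) (Hz i).
by rewrite raddfB /=; lra.
Qed.

Lemma GF_point z eta M : conv z eta M -> [/\ hol_at (col_mx z 0) Hsum,
    forall l, hs (fun k => pdw l (Hk k) (col_mx z 0)) (pdw l Hsum (col_mx z 0)) &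
    forall I, GF I z = pdw (sw I) Hsum (col_mx z 0)].
Proof.
move=> /Hk_summable[r [Mk [M' [r0 Hk' HF Hh]]]].
have Hl l : hs (fun k => pdw l (Hk k) (col_mx z 0)) (pdw l Hsum (col_mx z 0)).
  have [d d0 H] := series_pdw l r0 Hk' HF Hh; apply: H; exact: closexx (ltW d0).
split=> //; last by move=> I; apply: hsumE.
by exists r, M'; exact: PB_series r0 Hk' HF Hh.
Qed.

Lemma GF_pdw z eta M w I : conv z eta M ->
  pdw w (GF I) z = pdw (map zc w ++ sw I) Hsum (col_mx z 0).
Proof.
move=> cz; have eta0 : 0 < eta / 2 by case: cz => ? _; rewrite divr_gt0.
rewrite pdw_cat -(pdw_zpart (pdw (sw I) Hsum) 0).
(* The identification of G_I with a derivative of [Hsum] holds at all points near [z], so it may be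
   differentiated in z. *)
apply: (pdw_near w eta0) => z' /(conv_near cz)/GF_point[_ _]; exact.
Qed.

Lemma hol_zpart (F : V -> C) z : hol_at (col_mx z 0) F -> hol_at z (fun z => F (col_mx z 0)).
Proof.
have E z' : col_mx z' 0 = \col_j (col_mx z' (0 : 'cV[C]_n)) j 0.
  by apply/colP => j; rewrite [RHS]mxE.
rewrite E => HF; have -> : (fun z => F (col_mx z 0)) =
    (fun z => F (\col_j (col_mx z (0 : 'cV[C]_n)) j 0)) by apply/funext => z'; rewrite -E.
apply: (hol_comp (h := fun j z => (col_mx z (0 : 'cV[C]_n)) j 0)) => // j.
case: (split_ordP j) => i ->.
  by apply: hol_eq (hol_coord z i) => z'; rewrite col_mxEu.
by apply: hol_eq (hol_cst z 0) => z'; rewrite col_mxEd mxE.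
Qed.

Lemma GF_hol z eta M I : conv z eta M -> hol_at z (GF I).
Proof.
move=> cz; have eta0 : 0 < eta / 2 by case: cz => ? _; rewrite divr_gt0.
have [HH _ _] := GF_point cz.
apply: hol_near eta0 _ (hol_zpart (hol_pdw (sw I) HH)) => z' /(conv_near cz)/GF_point[_ _ H].
by rewrite H.
Qed.

Lemma GF_hs z eta M w I : conv z eta M ->
  hs (fun k => pdw (map zc w ++ sw I) (Hk k) (col_mx z 0)) (pdw w (GF I) z).
Proof. by move=> cz; rewrite (GF_pdw w I cz); case: (GF_point cz). Qed.

Lemma uniq_sw I : uniq (sw I).
Proof. by rewrite map_inj_uniq ?enum_uniq //; exact: rshift_inj. Qed.

Lemma mem_sw I i : (sc i \in sw I) = (i \in I).
Proof. by rewrite mem_map ?mem_enum //; exact: rshift_inj. Qed.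

Lemma pd2_Hk k i j y : Odom y -> pdw [:: zc j; zc i] (Hk k) y =
  (y (sc j) 0 + (k j 0%R)%:R) * (y (sc i) 0 + (k i 0%R)%:R) * Hk k y.
Proof.
move=> Oy; apply: (etrans (pd_open (zc j) Odom_open (pd_Hk k i) Oy)).
have Hl : hol_at y (fun y : V => y (sc i) 0 + (k i 0%R)%:R).
  by apply: hol_add; [exact: hol_coord|exact: hol_cst].
apply: (etrans (pdM (zc j) Hl (Hk_hol k Oy))).
rewrite (pdD (zc j) (hol_coord y (sc i)) (hol_cst _ _)) pd_coord pd_cst eq_rlshift.
rewrite addr0 mul0r addr0; apply: (etrans (congr1 _ (pd_Hk k j Oy))); by rewrite mulrA [_ * (y (sc j) 0 + _)]mulrC.
Qed.

Lemma deg_add_mdl k i : deg (k + mdl i 1) = (deg k).+1.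
Proof. by rewrite degD deg_mdl addn1. Qed.

Lemma Hk_recurrence k i y : Odom y ->
  cexp (y (zc i) 0) * (\sum_j (y (sc j) 0 + (k j 0%R)%:R)) ^+ 2 * Hk k y =
  (y (sc i) 0 + (k i 0%R)%:R + 1) ^+ 2 * Hk (k + mdl i 1) y.
Proof.
move=> Oy; have ni := Odom_neq0 i (k i 0) Oy.
rewrite /Hk deg_add_mdl big_ord_recr /=.
have -> : \sum_j (y (sc j) 0 + (k j 0%R)%:R) = \sum_j y (sc j) 0 + (deg k)%:R.
  by rewrite big_split /= /deg natr_sum.
have -> : \prod_i' \prod_(j < (k + mdl i 1)%R i' 0%R) (y (sc i') 0 + j.+1%:R)^-1 =
   \prod_i' \prod_(j < k i' 0%R) (y (sc i') 0 + j.+1%:R)^-1 * (y (sc i) 0 + (k i 0%R).+1%:R)^-1.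
  rewrite (bigD1 i) //= [in RHS](bigD1 i) //= !mxE nataddE eqxx addn1 big_ord_recr /=.
  rewrite -!mulrA; congr (_ * _); rewrite mulrC; congr (_ * _).
  by apply: eq_bigr => i' /negbTE ii; rewrite !mxE nataddE ii addn0.
have -> : \sum_i' (y (sc i') 0 + ((k + mdl i 1)%R i' 0%R)%:R) * y (zc i') 0 =
   y (zc i) 0 + \sum_i' (y (sc i') 0 + (k i' 0%R)%:R) * y (zc i') 0.
  rewrite (bigD1 i) //= [in RHS](bigD1 i) //= !mxE nataddE eqxx natrD.
  rewrite (eq_bigr (fun i' => (y (sc i') 0 + (k i' 0%R)%:R) * y (zc i') 0)); first by ring.
  by move=> i' /negbTE ii; rewrite !mxE nataddE ii addn0.
rewrite cexpD -addrA natr1.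
set A := \prod_(j < deg k) _; set B := \prod_i' _; set E := cexp _; set E' := cexp _; set S := _ + (deg k)%:R.
set X := _ + _.+1%:R in ni *; by field.
Qed.

(** The recurrence matches the term of index k on the right with that of index k + e_i on the left.
    The indices with k_i = 0 are not reached by this shift, and square-freeness of the s-derivative
    makes their terms vanish. *)
Lemma GF_system z eta M I i : conv z eta M ->
  pdw [:: i; i] (GF I) z = cexp (z i 0) * \sum_j \sum_l pdw [:: j; l] (GF I) z.
Proof.
move=> cz; have O0 := Odom0 z; have oO := Odom_open.
pose q i k (y : V) : C := (y (sc i) 0 + (k i 0%R)%:R) ^+ 2.
pose b k := pdw (sw I) (fun y => q i k y * Hk k y) (col_mx z 0).
have swap k w : pdw (map zc w ++ sw I) (Hk k) (col_mx z 0) =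
    pdw (sw I) (pdw (map zc w) (Hk k)) (col_mx z 0).
  by rewrite -pdw_cat; apply: (pdw_perm oO (@Hk_hol k) _ O0); rewrite perm_catC.
have qhol i' k : holU Odom (q i' k).
  by move=> y Oy; apply: hol_exp; apply: hol_add; [exact: hol_coord|exact: hol_cst].
have pdq i' k j : forall y, pd (q i' k) j y = 2 * (y (sc i') 0 + (k i' 0%R)%:R) * (sc i' == j)%:R.
  move=> y; have Hl : hol_at y (fun y : V => y (sc i') 0 + (k i' 0%R)%:R).
    by apply: hol_add; [exact: hol_coord|exact: hol_cst].
  rewrite (pdX j 2 Hl) (pdD j (hol_coord y (sc i')) (hol_cst _ _)) pd_coord pd_cst addr0.
  by rewrite expr1.
have H1 : hs b (pdw [:: i; i] (GF I) z).
  apply: hs_ext (GF_hs [:: i; i] I cz) => k; rewrite swap /b.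
  apply: (pdw_open _ oO _ O0) => y Oy; apply: (etrans (pd2_Hk k i i Oy)); by rewrite /q expr2.
(* For k_i = 0 the factor is s_i^2, differentiated at most once in s_i, so a factor s_i survives at
   s = 0. *)
have b0 k : k i 0 = 0%N -> b k = 0.
  move=> ki; apply: (etrans (pdw_mul_coord (j := sc i) oO (qhol i k) (@Hk_hol k) _ (uniq_sw I) O0)).
    by move=> j ij y _; rewrite pdq eq_sym (negbTE ij) mulr0.
  rewrite pdq /q ki col_mxEd mxE addr0 expr0n mul0r mulr0 !mul0r add0r.
  by case: ifP.
have Hb' : hs (fun k => b (k + mdl i 1)) (cexp (z i 0) * \sum_j \sum_l pdw [:: j; l] (GF I) z).
  have := hsZ (cexp (z i 0)) (hs_sum (index_enum 'I_n) (P := predT) (fun j _ =>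
    hs_sum (index_enum 'I_n) (P := predT) (fun l _ => GF_hs [:: j; l] I cz))).
  apply: hs_ext => k.
  pose h y : C := (\sum_j (y (sc j) 0 + (k j 0%R)%:R)) ^+ 2 * Hk k y.
  have Hl j' : holU Odom (fun y : V => y (sc j') 0 + (k j' 0%R)%:R).
    by move=> y _; apply: hol_add; [exact: hol_coord|exact: hol_cst].
  have hhol : holU Odom h.
    move=> y Oy; apply: hol_mul (Hk_hol k Oy); apply: hol_exp; apply: hol_sum => j' _; exact: Hl.
  have Ehol : holU Odom (fun y : V => cexp (y (zc i) 0)).
    by move=> y _; apply: hol_cexp; exact: hol_coord.
  have E1 y : Odom y -> q i (k + mdl i 1) y * Hk (k + mdl i 1) y = cexp (y (zc i) 0) * h y.
    move=> Oy; rewrite /h mulrA Hk_recurrence // /q !mxE nataddE eqxx natrD addrA.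
    by [].
  rewrite /b; apply: etrans (esym (pdw_open (sw I) oO E1 O0)).
  apply: etrans (esym (pdw_mul_coord (j := zc i) oO Ehol hhol _ (uniq_sw I) O0)); last first.
    move=> j ji y _; apply: (etrans (pd_cexp j (hol_coord y (zc i)))).
    by rewrite pd_coord eq_sym (negbTE ji) mulr0.
  have -> : (zc i \in sw I) = false.
    by apply/negbTE/mapP => -[i' _ /eqP]; rewrite eq_lrshift.
  rewrite addr0 col_mxEu; congr (_ * _).
  have E2 y : Odom y -> h y = \sum_j \sum_l pdw [:: zc j; zc l] (Hk k) y.
    move=> Oy; rewrite /h expr2 big_distrlr /= mulr_suml; apply: eq_bigr => j _.
    rewrite mulr_suml; apply: eq_bigr => l _; exact: esym (pd2_Hk k l j Oy).
  apply: esym; apply: (etrans (pdw_open (sw I) oO E2 O0)).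
  have holw w : holU Odom (pdw w (Hk k)) by move=> y Oy; apply: hol_pdw; exact: Hk_hol.
  have holS j : holU Odom (fun y => \sum_l pdw [:: zc j; zc l] (Hk k) y).
    by apply: holU_sum => l; exact: holw.
  apply: (etrans (pdw_sum (index_enum _) (sw I) oO holS O0)); apply: eq_bigr => j _.
  have holj l : holU Odom (pdw [:: zc j; zc l] (Hk k)) by exact: holw.
  apply: (etrans (pdw_sum (index_enum _) (sw I) oO holj O0)); apply: eq_bigr => l _.
  exact: esym (swap k [:: j; l]).
apply: hs_uniq H1 _; apply: (hs_inj (f := fun k => k + mdl i 1)) Hb' => [k k' /colP E|k Hk0].
  by apply/colP => j; have := E j; rewrite !mxE !nataddE => /addIn.
have [/b0 //|/mdl_split[k' kE]] := posnP (k i 0).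
by have := Hk0 k'; rewrite kE eqxx.
Qed.

Lemma conv_shift z eta M i (t : R) : conv z eta M ->
  conv (z + (0 +i* t)%C *: (delta_mx i 0 : 'cV[C]_n)) eta M.
Proof.
move=> [eta0 HM]; split=> // F; apply: le_trans (HM F); apply: ler_sum => k _.
rewrite ler_wpM2l ?wt_ge0 // (_ : \prod_i _ = \prod_i expR ((complex.Re (z i 0) + eta) * (k i 0%R)%:R)) //.
apply: eq_bigr => j _; rewrite !mxE; case: (z j 0) => u v.
by case: (_ && _); rewrite ?mulr1 ?mulr0 /= addr0.
Qed.

Lemma GF_period z eta M I i : conv z eta M ->
  let c : C := (0 +i* (pi *+ 2))%C in
  GF I (z + c *: (delta_mx i 0 : 'cV[C]_n)) = GF I z + (if i \in I then c * GF (I :\ i) z else 0).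
Proof.
move=> cz c; have O0 := Odom0 z; have oO := Odom_open.
have cz' := conv_shift i (pi *+ 2) cz.
have [_ Hl' /(_ I) E'] := GF_point cz'; have [_ Hl E] := GF_point cz.
rewrite E' !E; apply: hs_uniq (Hl' (sw I)) _.
have Hif : hs (fun k => if i \in I then c * pdw (sw (I :\ i)) (Hk k) (col_mx z 0) else 0)
    (if i \in I then c * pdw (sw (I :\ i)) Hsum (col_mx z 0) else 0).
  by case: ifP => _; [apply: hsZ; exact: Hl|exact: hs0].
apply: hs_ext (hsD (Hl (sw I)) Hif) => k; apply: esym.
pose v : V := c *: (delta_mx (zc i) 0 : V).
have -> : col_mx (z + c *: (delta_mx i 0 : 'cV[C]_n)) 0 = col_mx z 0 + v.
  apply/colP => j; case: (split_ordP j) => j' ->; rewrite /v !(col_mxEu, col_mxEd, mxE).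
    by rewrite eq_lshift.
  by rewrite eq_rlshift mulr0 addr0.
rewrite -(pdw_shift (Hk k) v).
pose q (y : V) := cexp (c * y (sc i) 0).
have qh : holU Odom q.
  by move=> y _; apply: hol_cexp; apply: hol_scale; exact: hol_coord.
have pdq j y : pd q j y = q y * (c * (sc i == j)%:R).
  rewrite /q (pd_cexp j (hol_scale c (hol_coord y (sc i)))) (pdZ c j (hol_coord y (sc i))).
  by rewrite pd_coord.
(* The translation multiplies the exponential by e^(2 pi i (s_i + k_i)), and the integer k_i
   contributes 1. *)
have Eq y : Odom y -> Hk k (y + v) = q y * Hk k y.
  move=> Oy; have Es j : (y + v) (sc j) 0 = y (sc j) 0.
    by rewrite /v !mxE eq_rlshift mulr0 addr0.
  rewrite /Hk [RHS]mulrCA; congr (_ * _).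
    congr (_ ^+ 2 * _ ^+ 2); apply: eq_bigr => j _.
      by congr (_ + _); apply: eq_bigr => j' _; exact: Es.
    by apply: eq_bigr => j' _; rewrite Es.
  rewrite /q -cexpD; have -> : \sum_j ((y + v) (sc j) 0 + (k j 0%R)%:R) * (y + v) (zc j) 0 =
      c *+ k i 0 + (c * y (sc i) 0 + \sum_j (y (sc j) 0 + (k j 0%R)%:R) * y (zc j) 0).
    rewrite (bigD1 i) //= [in RHS](bigD1 i) //= Es.
    rewrite (eq_bigr (fun j => (y (sc j) 0 + (k j 0%R)%:R) * y (zc j) 0)); last first.
      by move=> j /negbTE ji; rewrite Es /v !mxE eq_lshift ji mulr0 addr0.
    by rewrite /v !mxE eqxx -mulr_natl /=; ring.
  by rewrite [LHS]cexpD cexpMn cexp_2pi expr1n mul1r.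
apply: (etrans (pdw_open (sw I) oO Eq O0)).
apply: (etrans (pdw_mul_coord (j := sc i) oO qh (@Hk_hol k) _ (uniq_sw I) O0)).
  by move=> j ji y _; rewrite pdq eq_sym (negbTE ji) !mulr0.
have q1 : q (col_mx z 0) = 1 by rewrite /q col_mxEd mxE mulr0 cexp0.
rewrite q1 mul1r mem_sw pdq q1 eqxx mulr1 mul1r; congr (_ + _); case: ifP => // iI.
congr (_ * _); apply: (pdw_perm oO (@Hk_hol k) _ O0).
apply: uniq_perm; [by rewrite rem_uniq ?uniq_sw|exact: uniq_sw|].
move=> j; rewrite mem_rem_uniq ?uniq_sw // inE.
apply/andP/mapP => [[ji /mapP[j' j'I E1]]|[j' j'I ->]].
  exists j' => //; rewrite mem_enum !inE -(mem_enum I) j'I andbT.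
  by move: ji; rewrite E1 eq_rshift.
move: j'I; rewrite mem_enum !inE => /andP[j'i j'I]; split; first by rewrite /= eq_rshift.
by rewrite mem_sw.
Qed.

Lemma GF_set0 z eta M : conv z eta M -> GF finset.set0 z = 1.
Proof.
move=> cz; have [_ Hl E] := GF_point cz; rewrite E /sw enum_set0 /=.
apply: hs_uniq (Hl [::]) _ => /=.
have Hk0 k : k != 0 -> Hk k (col_mx z 0) = 0.
  rewrite -deg_eq0 -lt0n => k0; rewrite /Hk -(prednK k0) big_ord_recl /=.
  by rewrite addr0 big1 ?mul0r ?expr0n ?mul0r // => i _; rewrite col_mxEd mxE.
have H0 : Hk 0 (col_mx z 0) = 1.
  rewrite /Hk deg0 big_ord0 expr1n mul1r big1 => [|i _]; last first.
    by rewrite (_ : (0 : 'cV[nat]_n) i 0%R = 0%N) ?big_ord0 // mxE.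
  rewrite expr1n mul1r big1 ?cexp0 // => i _.
  by rewrite col_mxEd !mxE addr0 mul0r.
by have := hs1 Hk0; rewrite H0.
Qed.

End Family.

(** * The terms of the series attached to C(w) *)

Section Linking.
Variables (R : realType) (n : nat).
Local Notation C := R[i].
Local Notation N := (n.+1 + n.+1)%N.
Implicit Types (x l : 'cV[C]_N) (k : 'cV[nat]_n) (s : 'cV[C]_n) (u : 'cV[int]_N).
Local Notation lm := (lift ord_max).
Local Notation om := (ord_max : 'I_n.+1).

Definition zl l : 'cV[C]_n :=
  \col_i (l (pos (lm i)) 0 + l (neg (lm i)) 0 - l (pos om) 0 - l (neg om) 0).

Definition Bu k : 'cV[int]_N := \sum_i g i *+ k i 0.

Lemma gE (i : 'I_n) j : g i j 0 = (j == pos (lm i))%:R + (j == neg (lm i))%:R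
  - (j == pos om)%:R - (j == neg om)%:R.
Proof. by rewrite /g !mxE !eqxx !andbT. Qed.

Lemma g_pos (i j : 'I_n) : g i (pos (lm j)) 0 = (j == i)%:R.
Proof. by rewrite gE !eq_posneg lm_om (inj_eq (@lift_inj _ _)); case: (j == i). Qed.

Lemma g_neg (i j : 'I_n) : g i (neg (lm j)) 0 = (j == i)%:R.
Proof. by rewrite gE !eq_posneg lm_om (inj_eq (@lift_inj _ _)); case: (j == i). Qed.

Lemma g_posm (i : 'I_n) : g i (pos om) 0 = -1.
Proof. by rewrite gE !eq_posneg om_lm eqxx. Qed.

Lemma g_negm (i : 'I_n) : g i (neg om) 0 = -1.
Proof. by rewrite gE !eq_posneg om_lm eqxx. Qed.

Lemma Bu_pos k i : Bu k (pos (lm i)) 0 = (k i 0)%:Z.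
Proof.
rewrite /Bu summxE (bigD1 i) //= big1 => [|j ji]; rewrite mulmxnE g_pos; first by rewrite eqxx addr0 -[RHS]natz.
by rewrite eq_sym (negbTE ji) mul0rn.
Qed.

Lemma Bu_neg k i : Bu k (neg (lm i)) 0 = (k i 0)%:Z.
Proof.
rewrite /Bu summxE (bigD1 i) //= big1 => [|j ji]; rewrite mulmxnE g_neg; first by rewrite eqxx addr0 -[RHS]natz.
by rewrite eq_sym (negbTE ji) mul0rn.
Qed.

Lemma Bu_posm k : Bu k (pos om) 0 = - (deg k)%:Z.
Proof.
rewrite /Bu summxE /deg (big_morph _ PoszD (erefl (Posz 0))) -sumrN; apply: eq_bigr => i _.
by rewrite mulmxnE g_posm mulNrn -[in RHS]natz.
Qed.

Lemma Bu_negm k : Bu k (neg om) 0 = - (deg k)%:Z.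
Proof.
rewrite /Bu summxE /deg (big_morph _ PoszD (erefl (Posz 0))) -sumrN; apply: eq_bigr => i _.
by rewrite mulmxnE g_negm mulNrn -[in RHS]natz.
Qed.

Definition BuE := (Bu_pos, Bu_neg, Bu_posm, Bu_negm).

Lemma Bu_inj : injective Bu.
Proof.
move=> k k' E; apply/colP => i; have := congr1 (fun u : 'cV[int]_N => u (pos (lm i)) 0) E.
by rewrite !Bu_pos => -[].
Qed.

Lemma inL_val u : inL u -> (forall i, u (pos i) 0 = u (neg i) 0) /\
  u (pos om) 0 = - \sum_(i < n) u (pos (lm i)) 0.
Proof.
move=> H; have E i : u (pos i) 0 = u (neg i) 0.
  have := congr1 (fun M : 'cV[int]_(1 + n.+1) => M (rshift _ i) 0) H; rewrite AmxS mxE.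
  by move=> /eqP; rewrite subr_eq0 => /eqP.
split=> //; have := congr1 (fun M : 'cV[int]_(1 + n.+1) => M (lshift _ 0) 0) H.
rewrite Amx0 mxE sum_N -E.
rewrite (eq_bigr (fun i => u (pos (lm i)) 0 *+ 2)) => [|i _]; last by rewrite -E mulr2n.
rewrite sumrMnl -mulr2n -mulrnDl => /eqP; rewrite mulrn_eq0 /= addrC addr_eq0 => /eqP.
by [].
Qed.

Lemma inL_Bu k : inL (Bu k).
Proof.
apply/colP => j; case: (split_ordP j) => i ->; rewrite [RHS]mxE.
  rewrite (ord1 i) Amx0 sum_N !BuE.
  under eq_bigr => i' _ do rewrite !BuE.
  by rewrite big_split /= /deg !(big_morph _ PoszD (erefl (Posz 0))) -opprD subrr.
rewrite AmxS; elim/ordm_ind: i => [i|]; by rewrite !BuE subrr.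
Qed.

(** Inside L, membership in C(w) means u_i >= 0 for all i < m. This depends on the negative support
    alone, so the support of any element of C(w) belongs to N. *)
Lemma inL'P u : inL' u <-> exists k, u = Bu k.
Proof.
split=> [[uL [_ H]]|[k ->]].
  have [k ->] := H u uL erefl; exists (\col_i k i).
  by rewrite /Bu; apply: eq_bigr => i _; rewrite mxE.
split; first exact: inL_Bu.
split; first by exists (Bu k) => //; exact: inL_Bu.
move=> u' uL E; have [E1 E2] := inL_val uL.
have pos0 (i : 'I_n) : 0 <= u' (pos (lm i)) 0.
  rewrite leNgt; have := congr1 (fun A : {set 'I_N} => pos (lm i) \in A) E.
  by rewrite !inE => ->; rewrite Bu_pos ltNge.
pose k' : 'cV[nat]_n := \col_i `|u' (pos (lm i)) 0%R|%N.
have Ek (i : 'I_n) : u' (pos (lm i)) 0 = (k' i 0)%:Z by rewrite mxE gez0_abs.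
exists (fun i => k' i 0); rewrite -[RHS]/(Bu k').
have Em : u' (pos om) 0 = - (deg k')%:Z.
  by rewrite E2 /deg (big_morph _ PoszD (erefl (Posz 0))); congr (- _); apply: eq_bigr => i _.
apply/colP; apply: ordN_ind; apply: ordm_ind => [i|]; rewrite BuE ?Ek ?Em //.
  by rewrite -E1 Ek.
by rewrite -E1 Em.
Qed.

Lemma BsE s j : Bs s j 0 = \sum_i s i 0 * (g i j 0)%:~R.
Proof. by rewrite /Bs summxE; apply: eq_bigr => i _; rewrite !mxE. Qed.

Lemma Bs_pos s i : Bs s (pos (lm i)) 0 = s i 0.
Proof.
rewrite BsE (bigD1 i) //= big1 => [|j ji]; rewrite g_pos; first by rewrite eqxx mulr1 addr0.
by rewrite eq_sym (negbTE ji) mulr0.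
Qed.

Lemma Bs_neg s i : Bs s (neg (lm i)) 0 = s i 0.
Proof.
rewrite BsE (bigD1 i) //= big1 => [|j ji]; rewrite g_neg; first by rewrite eqxx mulr1 addr0.
by rewrite eq_sym (negbTE ji) mulr0.
Qed.

Lemma Bs_posm s : Bs s (pos om) 0 = - \sum_i s i 0.
Proof. by rewrite BsE -sumrN; apply: eq_bigr => i _; rewrite g_posm rmorphN1 mulrN1. Qed.

Lemma Bs_negm s : Bs s (neg om) 0 = - \sum_i s i 0.
Proof. by rewrite BsE -sumrN; apply: eq_bigr => i _; rewrite g_negm rmorphN1 mulrN1. Qed.

Definition BsEE := (Bs_pos, Bs_neg, Bs_posm, Bs_negm).

Lemma prod_N (F : 'I_N -> C) :
  \prod_j F j = \prod_(i < n) (F (pos (lm i)) * F (neg (lm i))) * (F (pos om) * F (neg om)).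
Proof.
rewrite big_split_ord /= (bigD1_ord om) //= [in X in _ * X](bigD1_ord om) //=.
by rewrite big_split /= mulrACA mulrC.
Qed.

Lemma pospart_nat (a : nat) : `|Num.max a%:Z 0|%N = a.
Proof. by rewrite max_l. Qed.

Lemma pospart_Nnat (a : nat) : `|Num.max (- a%:Z) 0|%N = 0%N.
Proof. by rewrite max_r ?oppr_le0. Qed.

Lemma cexpMz (c : C) (m : int) : cexp (c * m%:~R) = cexp c ^ m.
Proof.
case: m => k; first by rewrite -[_%:~R]/(k%:R) mulr_natr cexpMn.
by rewrite NegzE mulrNz mulrN cexpN -[_%:~R]/(k.+1%:R) mulr_natr cexpMn.
Qed.

(** The squares arise because the coordinates i and -i of both [Bs s] and [Bu k] agree; for the same
    reason the signs of the factors - |s| - j cancel in pairs. *)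
Lemma Fterm_Hk x l k s : (forall j, cexp (l j 0) = x j 0) ->
  Fterm x l (Bu k) s = Hk k (col_mx (zl l) s).
Proof.
move=> Hl; rewrite /Fterm /Hk.
have -> : falling (Bs s) (pospart (- Bu k)) =
    (\prod_(j < deg k) (\sum_i (col_mx (zl l) s) (rshift n i) 0 + j%:R)) ^+ 2.
  have E (i : 'I_n) j : j = pos (lm i) \/ j = neg (lm i) -> pospart (- Bu k) j 0 = 0%N.
    by case=> ->; rewrite !mxE BuE pospart_Nnat.
  have Em j : j = pos om \/ j = neg om -> pospart (- Bu k) j 0 = deg k.
    by case=> ->; rewrite !mxE BuE opprK pospart_nat.
  rewrite /falling prod_N big1 => [|i _]; last by rewrite !(E i) ?big_ord0 ?mulr1; [|right|left].
  rewrite mul1r !Em; [|by right|by left].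
  rewrite !BsEE expr2 -!big_split /=; apply: eq_bigr => j _.
  have -> : \sum_i (col_mx (zl l) s) (rshift n i) 0 = \sum_i s i 0.
    by apply: eq_bigr => i _; rewrite col_mxEd.
  by ring.
have -> : falling (Bs s + map_mx intr (Bu k)) (pospart (Bu k)) =
    ((\prod_i \prod_(j < k i 0%R) ((col_mx (zl l) s) (rshift n i) 0 + j.+1%:R)^-1) ^+ 2)^-1.
  have E (i : 'I_n) j : j = pos (lm i) \/ j = neg (lm i) ->
      pospart (Bu k) j 0 = k i 0%R /\ (Bs s + map_mx intr (Bu k)) j 0 = s i 0 + (k i 0)%:R.
    by case=> ->; rewrite !mxE !BuE !BsEE pospart_nat.
  have Em j : j = pos om \/ j = neg om -> pospart (Bu k) j 0 = 0%N.
    by case=> ->; rewrite !mxE BuE pospart_Nnat.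
  (* Read backwards, s_i + k_i - j for j < k_i runs through s_i + 1, ..., s_i + k_i. *)
  have P i : \prod_(j < k i 0%R) (s i 0 + (k i 0)%:R - j%:R) =
      (\prod_(j < k i 0%R) (s i 0 + j.+1%:R)^-1)^-1.
    rewrite prodfV invrK [RHS](reindex_inj rev_ord_inj) /=; apply: eq_bigr => j _.
    by rewrite subnSK // natrB ?addrA // ltnW.
  rewrite /falling prod_N !Em; [|by right|by left].
  rewrite !big_ord0 mulr1 mulr1 -exprVn -prodfV -prodrXl; apply: eq_bigr => i _.
  have [-> ->] := E i (pos (lm i)) (or_introl erefl).
  have [-> ->] := E i (neg (lm i)) (or_intror erefl).
  by rewrite P expr2; under [in RHS]eq_bigr => j _ do rewrite col_mxEd.
rewrite invrK; congr (_ * _).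
have -> : \prod_j x j 0 ^ Bu k j 0 = cexp (\sum_j l j 0 * (Bu k j 0)%:~R).
  by rewrite cexp_sum; apply: eq_bigr => j _; rewrite cexpMz Hl.
rewrite -cexpD -big_split /=; congr cexp.
rewrite sum_N !Bu_posm !Bu_negm !Bs_posm !Bs_negm.
rewrite (eq_bigr (fun i => (l (pos (lm i)) 0 + l (neg (lm i)) 0) * (s i 0 + (k i 0)%:R))); last first.
  by move=> i _; rewrite Bu_pos Bu_neg Bs_pos Bs_neg -[(k i 0)%:~R]/((k i 0)%:R); ring.
rewrite [RHS](eq_bigr (fun i => (s i 0 + (k i 0)%:R) * zl l i 0)); last first.
  by move=> i _; rewrite col_mxEu col_mxEd.
have -> : (- (deg k)%:Z)%:~R = - \sum_i (k i 0)%:R :> C.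
  by rewrite rmorphN /= /deg -natr_sum.
set A := l (pos om) 0; set B := l (neg om) 0.
have -> : A * - (\sum_i (k i 0)%:R) + A * - (\sum_i s i 0) +
   (B * - (\sum_i (k i 0)%:R) + B * - (\sum_i s i 0)) = \sum_i - ((A + B) * (s i 0 + (k i 0)%:R)).
  by rewrite sumrN -mulr_sumr big_split /=; ring.
rewrite -big_split /=; apply: eq_bigr => i _.
by rewrite mxE /A /B; ring.
Qed.

Lemma dFterm_Bu I x l k : (forall j, cexp (l j 0) = x j 0) ->
  dFterm I x l (Bu k) = pdw (sw I) (Hk k) (col_mx (zl l) 0).
Proof.
move=> Hl; rewrite /dFterm asboolT; last by apply/inL'P; exists k.
have -> : Fterm x l (Bu k) = (fun s => Hk k (col_mx (zl l) s)).
  by apply/funext => s; exact: Fterm_Hk.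
exact: (pdw_spart (Hk k) (zl l) (enum I) 0).
Qed.

Lemma dFterm_out I x l u : (forall k, Bu k != u) -> dFterm I x l u = 0.
Proof.
move=> H; rewrite /dFterm asboolF // => /inL'P[k E].
by have := H k; rewrite E eqxx.
Qed.

Lemma dFterm_hs I x l L : (forall j, cexp (l j 0) = x j 0) ->
  hs (fun k => pdw (sw I) (Hk k) (col_mx (zl l) 0)) L -> hs (dFterm I x l) L.
Proof.
move=> Hl H; apply: (hs_inj Bu_inj) => [u Hu|]; first exact: dFterm_out.
by apply: hs_ext H => k /=; rewrite dFterm_Bu.
Qed.

Lemma hs_sumE (T : choiceType) (u : T -> C) L : hs u L -> summability.sum u = L.
Proof.
move=> /has_sumE H; rewrite /summability.sum; apply: cvg_lim => //.
exact: totally_filter.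
Qed.

Lemma converges_absb I x l : converges I x l -> exists M, absb (dFterm I x l) M.
Proof. by move=> /cvg_ex[L HL]; apply: (@hs_absb _ _ _ L); apply/has_sumE. Qed.

Lemma hs_converges I x l L : hs (dFterm I x l) L -> converges I x l.
Proof. by move=> /has_sumE H; apply/cvg_ex; exists L. Qed.

End Linking.

(** * Convergence *)

Section Convergence.
Variables (R : realType) (n : nat).
Local Notation C := R[i].
Implicit Types (k : 'cV[nat]_n) (z s : 'cV[C]_n).

Definition colf K (f : {ffun 'I_n -> 'I_K}) : 'cV[nat]_n := \col_i (f i : nat).

Definition boxf K : {fset 'cV[nat]_n} := [fset colf f | f in {ffun 'I_n -> 'I_K}]%fset.

Lemma sum_box (a : 'I_n -> nat -> R) K :
  \prod_i \sum_(j < K) a i j = \sum_(k <- boxf K) \prod_i a i (k i 0).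
Proof.
rewrite bigA_distr_bigA /= big_imfset /=; last first.
  move=> f f' _ _ /colP E; apply/ffunP => i; apply: val_inj; have := E i; by rewrite !mxE.
by rewrite big_enum /=; apply: eq_bigr => f _; apply: eq_bigr => i _; rewrite mxE.
Qed.

Lemma sum_prod_le (a : 'I_n -> nat -> R) (m : 'I_n -> R) (F : {fset 'cV[nat]_n}) :
  (forall i j, 0 <= a i j) -> (forall i K, \sum_(j < K) a i j <= m i) ->
  \sum_(k <- F) \prod_i a i (k i 0) <= \prod_i m i.
Proof.
move=> a0 am; pose K := (\max_(k <- F) \max_(i < n) k i 0%R).+1.
apply: le_trans (_ : \prod_i \sum_(j < K) a i j <= _); last first.
  by apply: ler_prod => i _; rewrite am andbT; apply: sumr_ge0.
rewrite sum_box; apply: ler_sum_fset => [k|]; first by apply: prodr_ge0.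
apply/fsubsetP => k kF.
have kK i : (k i 0%R < K)%N.
  have h2 : (\max_(i < n) k i 0%R <= \max_(k <- F) \max_(i < n) k i 0%R)%N.
    by rewrite [leqRHS](bigD1_seq k) ?fset_uniq //= leq_maxl.
  by rewrite ltnS; apply: leq_trans h2; exact: (leq_bigmax (F := fun i => k i 0%R)).
apply/imfsetP; exists [ffun i => Ordinal (kK i)] => //.
by apply/colP => i; rewrite mxE ffunE.
Qed.

Lemma geom_sum_le (q : R) K : 0 <= q < 1 -> \sum_(j < K) q ^+ j <= (1 - q)^-1.
Proof.
move=> /andP[q0 q1]; rewrite -[leRHS]mul1r ler_pdivlMr ?subr_gt0 // mulrC.
have E := subrX1 q K; have -> : (1 - q) * \sum_(k < K) q ^+ k = 1 - q ^+ K.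
  by rewrite -[LHS]opprK -mulNr opprB -E opprB.
by rewrite gerBl exprn_ge0.
Qed.

(** Half of the exponential is enough: over all coordinates the loss is the constant 2^n, harmless
    in a growth comparison. *)
Lemma exp_half (u : R) : 0 <= u -> exists K, forall K', (K <= K')%N ->
  expR u / 2 <= \sum_(j < K') u ^+ j / j`!%:R.
Proof.
move=> u0.
have cv : series (exp_coeff u) @ \oo --> expR u by exact: is_cvg_series_exp_coeff.
have e0 : 0 < expR u / 2 by rewrite divr_gt0 // expR_gt0.
move/cvgrPdist_le: cv => /(_ _ e0)[K _ HK].
exists K => K' KK'; have := HK K' KK'; rewrite /= /series /= big_mkord => H.
have -> : \sum_(j < K') u ^+ j / j`!%:R = \sum_(k < K') exp_coeff u k by [].
have := ler_norm (expR u - \sum_(k < K') exp_coeff u k); lra.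
Qed.

Lemma exp_growth (s A D : R) : 0 <= A -> 0 <= D ->
  (forall X, 0 <= X -> expR (s * X) <= A * (1 + D * (X * expR X))) -> s <= 1.
Proof.
move=> A0 D0 H; rewrite leNgt; apply/negP => s1; set e := s - 1.
have e0 : 0 < e by rewrite subr_gt0.
(* If e > 0, then e^(e X) >= (1 + e X / 2)^2 >= e^2 X^2 / 4, where the base of e^(e X) is Euler's
   number. This must stay below A (1 + D) X, whereas X is chosen with e^2 X = e^2 + 4 A (1 + D). *)
pose X := 1 + 4 * A * (1 + D) / e ^+ 2.
have q0 : 0 <= 4 * A * (1 + D) / e ^+ 2.
  by rewrite divr_ge0 ?sqr_ge0 // !mulr_ge0 // addr_ge0.
have X1 : 1 <= X by rewrite /X; lra.
have X0 : 0 <= X by lra.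
have {}H := H X X0.
have E : expR (s * X) = expR X * expR (e * X / 2) ^+ 2.
  by rewrite -expRM_natr -expRD /e; congr expR; field.
have h1 : 1 + e * X / 2 <= expR (e * X / 2) by exact: expR_ge1Dx.
have eX : 0 <= e * X by rewrite mulr_ge0 // ltW.
have h2 : (1 + e * X / 2) ^+ 2 <= expR (e * X / 2) ^+ 2.
  by rewrite lerXn2r // nnegrE; lra.
have eX1 : 1 <= expR X by have := expR_ge1Dx X; lra.
have h3 : expR X * (1 + e * X / 2) ^+ 2 <= A * (1 + D * (X * expR X)).
  by apply: le_trans H; rewrite E ler_wpM2l ?expR_ge0.
have h4 : A * (1 + D * (X * expR X)) <= expR X * (A * (1 + D) * X).
  have -> : A * (1 + D * (X * expR X)) = A * 1 + A * D * X * expR X by ring.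
  have -> : expR X * (A * (1 + D) * X) = A * (expR X * X) + A * D * X * expR X by ring.
  by rewrite lerD2r ler_wpM2l // -[leLHS]mul1r ler_pM.
have h5 : (1 + e * X / 2) ^+ 2 <= A * (1 + D) * X.
  by rewrite -(ler_pM2l (expR_gt0 X)); exact: le_trans h3 h4.
have h6 : e ^+ 2 * X / 4 * X <= A * (1 + D) * X.
  apply: le_trans h5; have -> : (1 + e * X / 2) ^+ 2 = e ^+ 2 * X / 4 * X + (1 + e * X) by field.
  lra.
have h7 : e ^+ 2 * X / 4 <= A * (1 + D) by rewrite -(ler_pM2r (lt_le_trans ltr01 X1)).
have h8 : e ^+ 2 * X = e ^+ 2 + 4 * A * (1 + D).
  by rewrite /X mulrDr mulr1 mulrCA divff ?mulr1 // expf_neq0 // gt_eqF.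
have : 0 < e ^+ 2 by rewrite exprn_gt0.
lra.
Qed.

(* The terms are bounded, so with [y_i = e ^ ((Re z_i + eta) / 2)] and [q < 1] one has
   [\prod_i (y_i q X) ^ k_i / k_i! = O(X e ^ X q ^ |k|)]; summing over [k] gives
   [e ^ (t X) = O(X e ^ X)] for [t = \sum_i y_i q], whence [t <= 1]. *)
Lemma conv_sum_lt1 z eta M : conv z eta M ->
  \sum_i expR (complex.Re (z i 0) / 2) < 1.
Proof.
(* The hypothesis bounds the squares w^2 by [M]; since w <= w^2 + 1/4, [M + 1] bounds the w
   themselves. *)
move=> [eta0 HM]; pose B := M + 1.
pose y i := expR ((complex.Re (z i 0) + eta) / 2).
(* Since y_i q^2 = e^(Re z_i / 2), the margin is spent in two halves: one factor q makes the sum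
   over [k] geometric, the other turns t <= 1 into the strict inequality. *)
pose q := expR (- (eta / 4)).
have q1 : 0 <= q < 1 by rewrite expR_ge0 /= -expR0 ltr_expR; lra.
have Hk k : (deg k).-1`!%:R / \prod_i (k i 0%R)`!%:R * \prod_i y i ^+ k i 0 <= B.
  have := HM [fset k]%fset; rewrite big_seq_fset1 /wt.
  have -> : \prod_i expR ((complex.Re (z i 0) + eta) * (k i 0%R)%:R) = (\prod_i y i ^+ k i 0) ^+ 2.
    rewrite -prodrXl; apply: eq_bigr => i _.
    by rewrite /y -!expRM_natr; congr expR; field.
  rewrite -exprMn; set w := _ * _ => w2.
  rewrite /B; have : 0 <= (w - 1 / 2) ^+ 2 by rewrite sqr_ge0.
  by rewrite sqrrB; lra.
have B0 : 0 <= B.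
  apply: le_trans (Hk 0); rewrite mulr_ge0 // ?divr_ge0 // ?prodr_ge0 // => i _.
  by rewrite exprn_ge0 // expR_ge0.
pose t := \sum_i (y i * q).
have t1 : t <= 1.
  pose G := \prod_(i < n) (1 - q)^-1.
  have G0 : 0 <= G by apply: prodr_ge0 => i _; rewrite invr_ge0 subr_ge0; case/andP: q1 => _ /ltW.
  apply: (@exp_growth t (2 ^+ n) (B * G)) => [||X X0].
  - by rewrite exprn_ge0.
  - by rewrite mulr_ge0.
  pose a i j := (y i * q * X) ^+ j / j`!%:R.
  have yq i : 0 <= y i * q * X by rewrite !mulr_ge0 // expR_ge0.
  have [K HK] : exists K, forall i, expR (y i * q * X) / 2 <= \sum_(j < K) a i j.
    have [K HK] := choice (fun i => exp_half (yq i)).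
    by exists (\max_i K i) => i; apply: HK; exact: leq_bigmax.
  have h1 : expR (t * X) <= 2 ^+ n * \prod_i \sum_(j < K) a i j.
    rewrite /t mulr_suml expR_sum; have -> : \prod_i expR (y i * q * X) =
        2 ^+ n * \prod_i (expR (y i * q * X) / 2).
      rewrite -[in 2 ^+ n](card_ord n) -prodr_const -big_split /=; apply: eq_bigr => i _.
      by rewrite mulrCA divff ?mulr1 // pnatr_eq0.
    rewrite ler_wpM2l ?exprn_ge0 //; apply: ler_prod => i _.
    by rewrite HK andbT divr_ge0 // expR_ge0.
  apply: le_trans h1 _; rewrite ler_wpM2l ?exprn_ge0 // sum_box.
  set F := boxf K.
  have Hb k : \prod_i a i (k i 0) <= (if k == 0 then 1 else 0) + (B * (X * expR X)) * \prod_i q ^+ k i 0.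
    have Pq : 0 <= \prod_i q ^+ k i 0 by apply: prodr_ge0 => i _; rewrite exprn_ge0 // expR_ge0.
    have [->|k0] := eqVneq k 0.
      rewrite big1 => [|i _]; last by rewrite /a mxE expr0 fact0 divr1.
      by rewrite lerDl !mulr_ge0 ?expR_ge0 // prodr_ge0 // => i _; rewrite exprn_ge0 // expR_ge0.
    rewrite add0r; have kd : (0 < deg k)%N by rewrite lt0n deg_eq0.
    have -> : \prod_i a i (k i 0) = ((\prod_i (k i 0%R)`!%:R)^-1 * \prod_i y i ^+ k i 0) *
        X ^+ deg k * \prod_i q ^+ k i 0.
      rewrite -prodrXr -prodfV -!big_split /=; apply: eq_bigr => i _.
      by rewrite /a !exprMn; set f := (_`!%:R)^-1; set u := y i ^+ _; set v := q ^+ _; set w := X ^+ _; rewrite mulrC !mulrA mulrAC.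
    rewrite ler_wpM2r //.
    have f0 : 0 < (deg k).-1`!%:R :> R by rewrite ltr0n fact_gt0.
    have XK : X ^+ deg k <= (deg k).-1`!%:R * (X * expR X).
      rewrite -(prednK kd) exprS /= mulrCA; apply: ler_wpM2l => //; rewrite mulrC -ler_pdivrMr //.
      have := exp_coeff_le (deg k).-1.+1 X0; rewrite big_nat_recr //=.
      by apply: le_trans; rewrite lerDr sumr_ge0 // => j _; rewrite divr_ge0 ?exprn_ge0.
    set A := (\prod_i _)^-1 * _; have A0 : 0 <= A.
      rewrite mulr_ge0 ?invr_ge0 ?prodr_ge0 // => i _.
      by rewrite exprn_ge0 // expR_ge0.
    apply: le_trans (ler_wpM2l A0 XK) _; rewrite [leLHS]mulrA; apply: ler_wpM2r; first by rewrite mulr_ge0 ?expR_ge0.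
    by apply: le_trans (Hk k); rewrite /A mulrC mulrA.
  apply: le_trans (ler_sum _ (fun k _ => Hb k)) _; rewrite big_split /=; apply: lerD.
    case: (boolP (0 \in F)) => F0.
      by rewrite (bigD1_seq 0) ?fset_uniq //= eqxx big1 ?addr0 // => k /negbTE ->.
    rewrite big1_seq // => k /andP[_ kF]; case: eqP => // k0.
    by rewrite -k0 kF in F0.
  rewrite -mulr_sumr [leRHS]mulrAC ler_wpM2l ?mulr_ge0 ?expR_ge0 //.
  apply: (@sum_prod_le (fun _ j => q ^+ j) (fun=> (1 - q)^-1) F) => [_ j|_ K'].
    by rewrite exprn_ge0 // expR_ge0.
  exact: geom_sum_le.
have E : \sum_i expR (complex.Re (z i 0) / 2) = t * q.
  rewrite /t mulr_suml; apply: eq_bigr => i _; by rewrite /y /q -!expRD; congr expR; field.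
rewrite E; case/andP: q1 => q0 q1; apply: le_lt_trans q1.
by rewrite ler_piMl.
Qed.

End Convergence.

(** * Points where all the series converge with a margin *)

Section Germs.
Variables (R : realType) (n : nat).
Local Notation C := R[i].
Local Notation V := 'cV[C]_(n + n).
Implicit Types (k : 'cV[nat]_n) (z s : 'cV[C]_n) (y : V) (I : {set 'I_n}).
Local Notation zc := (@lshift n n).
Local Notation sc := (@rshift n n).

Definition sumS y : C := \sum_i y (sc i) 0.

Definition Hr k y : C := (\prod_(j < (deg k).-1) (sumS y + j.+1%:R)) ^+ 2
  * (\prod_i \prod_(j < k i 0%R) (y (sc i) 0 + j.+1%:R)^-1) ^+ 2 * cexp (He k y).

Definition Hm k i y : C := 2 * Hr k y + sumS y * pd (Hr k) (sc i) y.

Lemma Hk_lead k y : k != 0 -> Hk k y = sumS y ^+ 2 * Hr k y.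
Proof.
rewrite -deg_eq0 -lt0n => k0; rewrite /Hk -(big_mkord xpredT (fun j => \sum_i y (sc i) 0 + j%:R)).
by rewrite -{1}(prednK k0) big_nat_recl // addr0 -/(sumS y) big_mkord exprMn /Hr -!mulrA.
Qed.

Lemma sumS_hol y : hol_at y sumS.
Proof. by apply: hol_sum => i _; exact: hol_coord. Qed.

Lemma pd_sumS i y : pd sumS (sc i) y = 1.
Proof.
apply: (etrans (pd_sum (index_enum _) (P := predT) (sc i) (fun j _ => hol_coord y (sc j)))).
rewrite (eq_bigr (fun j => (j == i)%:R)) => [|j _]; last by rewrite pd_coord eq_rshift.
by rewrite (bigD1 i) //= eqxx big1 ?addr0 // => j /negbTE ->.
Qed.

Lemma Hr_hol k : holU (@Odom R n) (Hr k).
Proof.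
move=> y Oy; apply: hol_mul; last exact: hol_cexp (He_hol k y).
apply: hol_mul; apply: hol_exp; apply: hol_prod => i _.
  by apply: hol_add; [exact: sumS_hol|exact: hol_cst].
by apply: hol_prod => j _; apply: hol_inv_add; exact: Odom_neq0.
Qed.

Lemma Hm_hol k i : holU (@Odom R n) (Hm k i).
Proof.
move=> y Oy; apply: hol_add; first by apply: hol_scale; exact: Hr_hol.
by apply: hol_mul; [exact: sumS_hol|apply: hol_pd; exact: Hr_hol].
Qed.

Lemma pd_Hk_s k i y : k != 0 -> Odom y -> pd (Hk k) (sc i) y = sumS y * Hm k i y.
Proof.
move=> k0 Oy; apply: (etrans (pd_open (sc i) (@Odom_open R n) (fun y _ => Hk_lead y k0) Oy)).
apply: (etrans (pdM (sc i) (hol_exp 2 (sumS_hol y)) (Hr_hol k Oy))).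
rewrite (pdX (sc i) 2 (sumS_hol y)) pd_sumS /Hm.
by move: (pd _ _ _) (Hr _ _) (sumS _) => a b c; ring.
Qed.

Lemma sumS0 z : sumS (col_mx z 0) = 0.
Proof. by rewrite /sumS big1 // => i _; rewrite col_mxEd mxE. Qed.

(** At s = 0 both derivatives must fall on |s|^2, so the value is the same for every pair (i, j):
    one mixed derivative controls all the weights. *)
Lemma pd2_Hk_s k i j z : k != 0 ->
  pdw [:: sc i; sc j] (Hk k) (col_mx z 0) = 2 * Hr k (col_mx z 0).
Proof.
move=> k0; have O0 := Odom0 z.
apply: (etrans (pd_open (sc i) (@Odom_open R n) (fun y Oy => pd_Hk_s j k0 Oy) O0)).
apply: (etrans (pdM (sc i) (sumS_hol _) (Hm_hol k j O0))).
by rewrite sumS0 mul0r add0r pd_sumS mul1r /Hm sumS0 mul0r addr0.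
Qed.

Lemma normc_Hr0 k z :
  normc (Hr k (col_mx z 0)) = wt R k * \prod_i expR (complex.Re (z i 0) * (k i 0%R)%:R).
Proof.
rewrite /Hr normcM [normc (_ ^+ 2 * _)]normcM !normcX !normc_prod normc_cexp /wt exprMn; congr (_ * _ * _).
- congr (_ ^+ 2); rewrite fact_prod natr_prod big_add1 big_mkord /=; apply: eq_bigr => j _.
  by rewrite sumS0 add0r normc_nat.
- congr (_ ^+ 2); rewrite -prodfV; apply: eq_bigr => i _.
  rewrite normc_prod fact_prod natr_prod big_add1 big_mkord /= -prodfV; apply: eq_bigr => j _.
  by rewrite col_mxEd mxE add0r normcV normc_nat.
rewrite -expR_sum; congr expR; rewrite /He raddf_sum; apply: eq_bigr => i _.
rewrite col_mxEd mxE add0r col_mxEu mulr_natl raddfMn /=.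
by rewrite mulr_natr.
Qed.

Lemma set_le1 I : n = 1%N -> I = finset.set0 \/ exists i, I = [set i]%SET.
Proof.
move=> n1; have I1 : (#|I| <= 1)%N by rewrite (leq_trans (max_card _)) // card_ord n1.
have [/eqP|I0] := posnP #|I|; first by rewrite cards_eq0 => /eqP; left.
by right; apply/cards1P; rewrite eqn_leq I1.
Qed.

(** Now I has at most one element, so a factor |s| survives in every term with k <> 0. Only e^(s z)
    remains, with derivative z at s = 0. *)
Lemma GF1_hs I z : n = 1%N ->
  hs (fun k => pdw (sw I) (Hk k) (col_mx z 0)) (\prod_(i in I) z i 0).
Proof.
move=> n1; have O0 := Odom0 z.
have H0 i k : k != 0 -> pd (Hk k) (sc i) (col_mx z 0) = 0.
  by move=> k0; rewrite (pd_Hk_s i k0 O0) sumS0 mul0r.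
have E0 : Hk 0 = (fun y : V => cexp (He 0 y)).
  apply/funext => y; rewrite /Hk deg0 big_ord0 expr1n mul1r big1 ?expr1n ?mul1r // => i _.
  by rewrite (_ : (0 : 'cV[nat]_n) i 0%R = 0%N) ?big_ord0 // mxE.
have He0 : He 0 (col_mx z 0) = 0.
  by rewrite /He big1 // => i _; rewrite col_mxEd !mxE addr0 mul0r.
have [->|[i ->]] := set_le1 I n1.
  rewrite big_set0 /sw enum_set0 /=.
  have := @hs1 R _ 0 (fun k => Hk k (col_mx z 0)); rewrite E0 He0 cexp0; apply.
  by move=> k k0; rewrite (Hk_lead _ k0) sumS0 expr0n mul0r.
rewrite big_set1 /sw enum_set1 /=.
have := @hs1 R _ 0 (fun k => pd (Hk k) (sc i) (col_mx z 0)) (H0 i).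
rewrite E0 (pd_cexp (sc i) (He_hol 0 _)) He0 cexp0 mul1r.
suff -> : pd (He 0) (sc i) (col_mx z 0) = z i 0 by [].
have Hl j : hol_at (col_mx z 0) (fun y : V => y (sc j) 0 + ((0%R : 'cV[nat]_n) j 0%R)%:R).
  by apply: hol_add; [exact: hol_coord|exact: hol_cst].
have E j : pd (fun y : V => (y (sc j) 0 + ((0%R : 'cV[nat]_n) j 0%R)%:R) * y (zc j) 0) (sc i) (col_mx z 0) =
    if j == i then z i 0 else 0.
  apply: (etrans (pdM (sc i) (Hl j) (hol_coord _ (zc j)))).
  rewrite (pdD (sc i) (hol_coord _ (sc j)) (hol_cst _ _)) !pd_coord pd_cst.
  rewrite eq_lrshift eq_rshift mulr0 add0r addr0 col_mxEu; case: eqP => [->|_]; by rewrite ?mul1r ?mul0r.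
apply: (etrans (pd_sum (index_enum _) (P := predT) (sc i) (fun j _ => He_term_hol 0 _ j))).
by rewrite (eq_bigr _ (fun j _ => E j)) -big_mkcond big_pred1_eq.
Qed.

Lemma GF1E I z : n = 1%N -> GF I z = \prod_(i in I) z i 0.
Proof. by move=> n1; apply: hsumE; exact: GF1_hs. Qed.

(* For [n = 1] the series terminates, and [conv] is needlessly restrictive. *)
Definition good z := n = 1%N \/ exists eta M, conv z eta M.

(** This gives a whole strip of good points around z, unbounded in the imaginary directions. *)
Lemma good_re z : good z -> exists2 d : R, 0 < d &
  forall z', (forall i, `|complex.Re (z' i 0 - z i 0)| < d) -> good z'.
Proof.
case=> [n1|[eta [M [eta0 HM]]]]; first by exists 1 => // z' _; left.
exists (eta / 2) => [|z' Hz]; first by rewrite divr_gt0.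
right; exists (eta / 2), M; split=> [|F]; first by rewrite divr_gt0.
apply: le_trans (HM F); apply: ler_sum => k _; rewrite ler_wpM2l ?wt_ge0 //.
apply: ler_prod => i _; rewrite expR_ge0 ler_expR ler_wpM2r //.
have := le_lt_trans (ler_norm _) (Hz i); rewrite raddfB /=; lra.
Qed.

Lemma good_hs I z : good z -> hs (fun k => pdw (sw I) (Hk k) (col_mx z 0)) (GF I z).
Proof.
case=> [n1|[eta [M cz]]]; first by rewrite GF1E //; exact: GF1_hs.
exact: (GF_hs [::] I cz).
Qed.

Lemma good_hol I z : good z -> hol_at z (GF I).
Proof.
case=> [n1|[eta [M cz]]]; last exact: GF_hol cz.
apply: (hol_eq (f := fun z => \prod_(i in I) z i 0)) => [z'|]; first by rewrite GF1E.
by apply: hol_prod => i _; exact: hol_coord.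
Qed.

Lemma good_system I i z : good z ->
  pd (pd (GF I) i) i z = cexp (z i 0) * \sum_j \sum_l pd (pd (GF I) l) j z.
Proof.
case=> [n1|[eta [M cz]]]; last exact: GF_system cz.
suff H j l : pd (pd (GF I) l) j z = 0.
  have S0 : \sum_j \sum_l pd (pd (GF I) l) j z = 0.
    by apply: big1 => j _; apply: big1 => l _; exact: H.
  apply: (etrans (H i i)); rewrite S0 mulr0; exact: erefl.
suff [c E] : exists c : C, pd (GF I) l = (fun=> c) by rewrite E; exact: (pd_cst c j z).
have -> : GF I = (fun z => \prod_(i in I) z i 0) by apply/funext => z'; exact: GF1E.
have [->|[i' ->]] := set_le1 I n1.
  exists 0; under eq_fun do rewrite big_set0; apply/funext => z'; exact: pd_cst.
exists (i' == l)%:R; under eq_fun do rewrite big_set1; apply/funext => z'; exact: pd_coord.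
Qed.

Lemma good_period I i z : good z -> let c : C := (0 +i* (pi *+ 2))%C in
  GF I (z + c *: (delta_mx i 0 : 'cV[C]_n)) = GF I z + (if i \in I then c * GF (I :\ i) z else 0).
Proof.
case=> [n1|[eta [M cz]]] c; last exact: GF_period cz.
rewrite !GF1E //; have [->|[i' ->]] := set_le1 I n1.
  by rewrite !big_set0 inE addr0.
have -> : i' = i.
  have H (j : 'I_n) : j = 0%N :> nat.
    by apply/eqP; have := ltn_ord j; rewrite [X in (_ < X)%N]n1 ltnS leqn0.
  by apply: val_inj; rewrite /= !H.
rewrite set11 !big_set1 !mxE !eqxx mulr1; congr (_ + _).
by rewrite (_ : [set i]%SET :\ i = finset.set0) ?big_set0 ?mulr1 //; apply/setP => j; rewrite !inE andNb.
Qed.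

Lemma good_set0 z : good z -> GF finset.set0 z = 1.
Proof.
case=> [n1|[eta [M cz]]]; last exact: GF_set0 cz.
by rewrite GF1E // big_set0.
Qed.

(* The term of multi-index [k] of the mixed second derivative is exactly twice
   the [k]-th weight, so absolute convergence there is the bound [conv] asks for. *)
Lemma good_absb z z' (eta M : R) i j : i != j -> 0 < eta ->
  (forall i, complex.Re (z' i 0) = complex.Re (z i 0) + eta) ->
  absb (fun k => pdw (sw [set i; j]%SET) (Hk k) (col_mx z' 0)) M -> good z.
Proof.
move=> ij eta0 Hz HM; right; exists eta, (1 + M); split=> // F.
(* The index k = 0 escapes the formula for the second derivative; its weight 1 accounts for the
   summand 1 in the bound. *)
have w00 : wt R (0 : 'cV[nat]_n) * \prod_i expR ((complex.Re (z i 0) + eta) * ((0%R : 'cV[nat]_n) i 0%R)%:R) = 1.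
  rewrite /wt deg0 fact0 !big1 ?divr1 ?expr1n ?mulr1 // => l _.
    by rewrite (_ : (0 : 'cV[nat]_n) l 0%R = 0%N) ?mulr0 ?expR0 // mxE.
  by rewrite (_ : (0 : 'cV[nat]_n) l 0%R = 0%N) ?fact0 // mxE.
pose w k := wt R k * \prod_i expR ((complex.Re (z i 0) + eta) * (k i 0%R)%:R); have Hw k : w k <= (if k == 0 then 1 else 0) +
    normc (pdw (sw [set i; j]%SET) (Hk k) (col_mx z' 0)).
  have [->|k0] := eqVneq k 0; first by rewrite /w w00 lerDl normc_ge0.
  rewrite add0r; have P : perm_eq (sw [set i; j]%SET) [:: sc i; sc j].
    rewrite -[[:: _; _]]/(map sc [:: i; j]); apply: perm_map; apply: uniq_perm => [||l].
    - exact: enum_uniq.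
    - by rewrite /= inE ij.
    - by rewrite mem_enum !inE.
  rewrite (pdw_perm (@Odom_open R n) (Hk_hol k) P (Odom0 z')) (pd2_Hk_s i j z' k0).
  rewrite normcM normc_Hr0 normc_nat /w; under [in leRHS]eq_bigr => l _ do rewrite Hz.
  set b := _ * _; have b0 : 0 <= b.
    by rewrite mulr_ge0 ?wt_ge0 // prodr_ge0 // => l _; exact: expR_ge0.
  lra.
apply: le_trans (ler_sum (F := w) _ (fun k _ => Hw k)) _; rewrite big_split /=; apply: lerD (HM F).
case: (boolP (0 \in F)) => F0.
  by rewrite (bigD1_seq 0) ?fset_uniq //= eqxx big1 ?addr0 // => k /negbTE ->.
rewrite big1_seq ?ler01 // => k /andP[_ kF]; case: eqP => // k0.
by rewrite -k0 kF in F0.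
Qed.

Lemma good_trivial z : n = 0%N -> good z.
Proof.
move=> n0; right; exists 1, 1; split=> // F.
have H k : k = 0 by apply/colP => i; have := ltn_ord i; rewrite [X in (_ < X)%N]n0.
apply: le_trans (ler_sum_fset (G := [fset 0]%fset) _ _) _ => [k||].
- by rewrite mulr_ge0 ?wt_ge0 // prodr_ge0 // => l _; exact: expR_ge0.
- by apply/fsubsetP => k _; rewrite (H k) inE.
have E (f : 'I_n -> R) : \prod_i f i = 1.
  by rewrite big1 // => i _; have := ltn_ord i; rewrite [X in (_ < X)%N]n0.
by rewrite big_seq_fset1 /wt !E deg0 fact0 divr1 expr1n mulr1.
Qed.

End Germs.

(** * Solutions from the series *)

Section Pullback.
Variables (R : realType) (n : nat).
Local Notation C := R[i].
Local Notation N := (n.+1 + n.+1)%N.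
Local Notation V := 'cV[C]_N.
Variables (U : set V) (lam : 'I_N -> V -> C).
Hypothesis oU : open U.
Hypothesis HL : log_branches U lam.
Implicit Types (a x : V) (z w : 'cV[C]_n) (I : {set 'I_n}) (G : 'cV[C]_n -> C).
Local Notation lm := (lift ord_max).
Local Notation om := (ord_max : 'I_n.+1).

Lemma lam_cexp j x : U x -> cexp (lam j x) = x j 0.
Proof. by move=> /(HL j)[]. Qed.

Lemma dom_neq0 j x : U x -> x j 0 != 0.
Proof. by move=> Ux; rewrite -(lam_cexp j Ux) cexp_neq0. Qed.

Definition ell x : 'cV[C]_n := zl (\col_j lam j x).

Definition elli (i : 'I_n) x : C :=
  lam (pos (lm i)) x + lam (neg (lm i)) x - lam (pos om) x - lam (neg om) x.

Lemma ellE x : ell x = \col_i elli i x.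
Proof. by apply/colP => i; rewrite !mxE. Qed.

Lemma cexp_ell i x : U x -> cexp (ell x i 0) = tq i x.
Proof.
move=> Ux; rewrite ellE mxE /elli !cexpD !cexpN !lam_cexp // /tq.
by rewrite -mulrA invfM.
Qed.

Lemma elli_hol i x : U x -> hol_at x (elli i).
Proof.
move=> Ux; have H j := (log_branch_hol j oU HL Ux).1.
exact: hol_sub (hol_sub (hol_add (H _) (H _)) (H _)) (H _).
Qed.

Lemma pd_elli i j x : U x -> pd (elli i) j x = (g i j 0)%:~R / x j 0.
Proof.
move=> Ux; have H j' := (log_branch_hol j' oU HL Ux).1.
have D j' : pd (lam j') j x = (j == j')%:R / x j 0.
  by rewrite (log_branch_hol j' oU HL Ux).2 eq_sym; case: eqP => [->|_] //; rewrite !mul0r.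
apply: (etrans (pdB j (hol_sub (hol_add (H _) (H _)) (H _)) (H _))).
rewrite (pdB j (hol_add (H _) (H _)) (H _)) (pdD j (H _) (H _)) !D -mulrDl -!mulrBl gE.
by rewrite !rmorphB rmorphD /= !rmorph_nat.
Qed.

Lemma ell_comp_hol G x : U x -> hol_at (ell x) G -> hol_at x (fun x => G (ell x)).
Proof.
move=> Ux HG; apply: (hol_eq (f := fun x => G (\col_i elli i x))) => [y|].
  by rewrite ellE.
by apply: hol_comp; [move=> i; exact: elli_hol|rewrite -ellE].
Qed.

Lemma TH_ell j G x : U x -> hol_at (ell x) G ->
  TH j (fun x => G (ell x)) x = \sum_i (g i j 0)%:~R * pd G i (ell x).
Proof.
move=> Ux HG; have -> : (fun x => G (ell x)) = (fun x => G (\col_i elli i x)).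
  by apply/funext => y; rewrite ellE.
have HG' : hol_at (\col_i elli i x) G by rewrite -ellE.
rewrite /TH (pd_comp j (fun i => elli_hol i Ux) HG').
rewrite mulr_sumr -ellE; apply: eq_bigr => i _.
rewrite (pd_elli i j Ux); move: (pd _ _ _) => d.
by have := dom_neq0 j Ux; move: (x j 0) => y y0; field.
Qed.

Lemma TH_ell_pos (i : 'I_n) G x : U x -> hol_at (ell x) G ->
  TH (pos (lm i)) (fun x => G (ell x)) x = pd G i (ell x).
Proof.
move=> Ux HG; apply: (etrans (TH_ell _ Ux HG)); rewrite (bigD1 i) //= g_pos eqxx mul1r.
by rewrite big1 ?addr0; [exact: erefl|move=> i' ii; rewrite g_pos eq_sym (negbTE ii) mul0r].
Qed.

Lemma TH_ell_neg (i : 'I_n) G x : U x -> hol_at (ell x) G ->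
  TH (neg (lm i)) (fun x => G (ell x)) x = pd G i (ell x).
Proof.
move=> Ux HG; apply: (etrans (TH_ell _ Ux HG)); rewrite (bigD1 i) //= g_neg eqxx mul1r.
by rewrite big1 ?addr0; [exact: erefl|move=> i' ii; rewrite g_neg eq_sym (negbTE ii) mul0r].
Qed.

Lemma TH_ell_posm G x : U x -> hol_at (ell x) G ->
  TH (pos om) (fun x => G (ell x)) x = - \sum_i pd G i (ell x).
Proof.
move=> Ux HG; apply: (etrans (TH_ell _ Ux HG)); rewrite -sumrN; apply: eq_bigr => i _.
by rewrite g_posm rmorphN1 mulN1r; exact: erefl.
Qed.

Lemma TH_ell_negm G x : U x -> hol_at (ell x) G ->
  TH (neg om) (fun x => G (ell x)) x = - \sum_i pd G i (ell x).
Proof.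
move=> Ux HG; apply: (etrans (TH_ell _ Ux HG)); rewrite -sumrN; apply: eq_bigr => i _.
by rewrite g_negm rmorphN1 mulN1r; exact: erefl.
Qed.

Hypothesis Hgood : forall x, U x -> good (ell x).

Lemma GF_Eul I : Eul U (fun x => GF I (ell x)).
Proof.
have HG x : U x -> hol_at (ell x) (GF I) by move=> /Hgood; exact: good_hol.
have Hs x : U x -> \sum_i pd (GF I) i (ell x) = \sum_i TH (pos (lm i)) (fun x => GF I (ell x)) x.
  by move=> Ux; apply: eq_bigr => i _; exact: esym (TH_ell_pos i Ux (HG x Ux)).
split=> [x Ux|i x Ux|x Ux|x Ux].
- exact: ell_comp_hol (HG x Ux).
- exact: (etrans (TH_ell_neg i Ux (HG x Ux)) (esym (TH_ell_pos i Ux (HG x Ux)))).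
- exact: (etrans (TH_ell_posm Ux (HG x Ux)) (congr1 -%R (Hs x Ux))).
- exact: (etrans (TH_ell_negm Ux (HG x Ux)) (congr1 -%R (Hs x Ux))).
Qed.

(** On a pullback theta_i theta_-i acts as d_i^2 and theta_m theta_-m as (sum_j d_j)^2. The equation
    of G_I becomes the binomial equation after dividing by x_i x_-i, using e^(z_i) = x_i x_-i / (x_m
    x_-m). *)
Lemma GF_Box I : Box U (fun x => GF I (ell x)).
Proof.
move=> i x Ux; have HG y : U y -> hol_at (ell y) (GF I) by move=> /Hgood; exact: good_hol.
have HGp j y : U y -> hol_at (ell y) (pd (GF I) j) by move=> Uy; apply: hol_pd; exact: HG.
have [Hf _ _ _] := GF_Eul I; set f := fun x => _ in Hf *.
have E1 : TH (pos (lm i)) (TH (neg (lm i)) f) x = pd (pd (GF I) i) i (ell x).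
  apply: (etrans (TH_open _ oU (fun y Uy => TH_ell_neg i Uy (HG y Uy)) Ux)).
  exact: (TH_ell_pos i Ux (HGp i x Ux)).
have E2 : TH (pos om) (TH (neg om) f) x = \sum_j \sum_l pd (pd (GF I) l) j (ell x).
  apply: (etrans (TH_open _ oU (fun y Uy => TH_ell_negm Uy (HG y Uy)) Ux)).
  pose S z := \sum_l pd (GF I) l z.
  have HS z : (forall l, hol_at z (pd (GF I) l)) -> hol_at z S.
    by move=> H; apply: hol_sum => l _; exact: H.
  have HSx : hol_at (ell x) S by apply: HS => l; exact: HGp.
  have HNx : hol_at (ell x) (fun z => -1 * S z) by exact: hol_scale.
  have EN : TH (pos om) (fun y => - \sum_l pd (GF I) l (ell y)) x =
      TH (pos om) (fun y => -1 * S (ell y)) x.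
    by apply: (TH_open _ oU _ Ux) => y _; rewrite mulN1r; exact: erefl.
  apply: (etrans EN); apply: (etrans (TH_ell_posm Ux HNx)).
  rewrite -sumrN; apply: eq_bigr => j _.
  apply: (etrans (congr1 -%R (pdZ (-1) j HSx))); rewrite mulN1r opprK.
  exact: (pd_sum (index_enum _) (P := predT) j (fun l _ => HGp l x Ux)).
have E3 := good_system I i (Hgood Ux).
have F1 := TH_TH_neq oU Hf (negbT (pos_neg (lm i) (lm i))) Ux.
have F2 := TH_TH_neq oU Hf (negbT (pos_neg om om)) Ux.
have {}F1 := etrans (esym (etrans E1 E3)) F1; have {}F2 := etrans (esym E2) F2.
have alg (c S A B x1 x2 x3 x4 : C) : x1 != 0 -> x2 != 0 -> x3 != 0 -> x4 != 0 ->
    c = x1 * x2 / (x3 * x4) -> c * S = x1 * x2 * A -> S = x3 * x4 * B -> A = B.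
  move=> n1 n2 n3 n4 -> H1 H2; apply: (mulfI (_ : x1 * x2 != 0)); first by rewrite mulf_neq0.
  by rewrite -H1 H2; field; rewrite n3 n4.
exact: (alg _ _ _ _ _ _ _ _ (dom_neq0 _ Ux) (dom_neq0 _ Ux) (dom_neq0 _ Ux) (dom_neq0 _ Ux)
  (cexp_ell i Ux) F1 F2).
Qed.

End Pullback.

(** * From the convergence domain to good and regular points *)

Section Domain.
Variables (R : realType) (n : nat).
Local Notation C := R[i].
Local Notation N := (n.+1 + n.+1)%N.
Local Notation V := 'cV[C]_N.
Variables (U : set V) (lam : 'I_N -> V -> C).
Hypothesis HU : convergence_domain U lam.
Implicit Types (a x : V) (z w : 'cV[C]_n) (I : {set 'I_n}).
Local Notation lm := (lift ord_max).
Local Notation om := (ord_max : 'I_n.+1).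
Local Notation ell := (ell lam).

Let oU : open U. Proof. by case: HU => -[]. Qed.
Let HL : log_branches U lam. Proof. by case: HU. Qed.

(** Rescaling the coordinates x_i, i < m, alone already moves z freely. *)
Definition expo w (j : 'I_N) : C := \sum_i (j == pos (lm i))%:R * w i 0.

(* Moving along [scl w a] translates the logarithmic coordinates [ell] by [w]. *)
Definition scl w a : V := \col_j (a j 0 * cexp (expo w j)).

Lemma expo_hol j w : hol_at w (expo ^~ j).
Proof. by apply: hol_sum => i _; apply: hol_scale; exact: hol_coord. Qed.

Lemma expo0 j : expo 0 j = 0.
Proof. by rewrite /expo big1 // => i _; rewrite mxE mulr0. Qed.

Lemma scl_near a (r : R) : 0 < r ->
  exists2 d, 0 < d & forall w, close 0 d w -> close a r (scl w a).
Proof.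
move=> r0; suff [d d0 Hd] : exists2 d, 0 < d &
    forall j w, close 0 d w -> normc (scl w a j 0 - a j 0) <= r.
  by exists d => // w Hw j; exact: Hd.
apply: (@fin_radius R 'I_N (fun j d => forall w, close 0 d w -> normc (scl w a j 0 - a j 0) <= r)) => j.
pose f w := a j 0 * cexp (expo w j).
have cf : {for 0, continuous f}.
  by apply: hol_continuous; apply: hol_scale; apply: hol_cexp; exact: expo_hol.
have [d d0 Hd] := continuous_close r0 cf.
exists d => // d' _ dd w Hw; have := Hd w (close_le dd Hw).
by rewrite /f expo0 cexp0 mulr1 mxE => /ltW.
Qed.

(** A neighbourhood of [ell a] is thus attained from [U]. The branches follow the rescaling exactly:
    both [lam j] and the exponent vary by less than 1/2, so [cexp_eq1_small] excludes a jump by a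
    multiple of 2 pi i. *)
Lemma lift_domain a : U a -> exists2 d, 0 < d &
  forall w, close 0 d w -> U (scl w a) /\ ell (scl w a) = ell a + w.
Proof.
move=> Ua; have [r r0 Hr] := open_close oU Ua; have h12 : (0 : R) < 1 / 2 by rewrite divr_gt0.
have [r1 r10 Hr1] : exists2 r, 0 < r & forall j x, close a r x -> normc (lam j x - lam j a) < 1 / 2.
  apply: (@fin_radius R 'I_N (fun j r => forall x, close a r x -> normc (lam j x - lam j a) < 1 / 2)) => j; have [cj _] := HL j Ua.
  have [d d0 Hd] := continuous_close h12 cj.
  by exists d => // d' _ dd x Hx; apply: Hd; exact: close_le dd Hx.
have [d1 d10 Hd1] := scl_near a r0; have [d2 d20 Hd2] := scl_near a r10.
have [d3 d30 Hd3] : exists2 r, 0 < r & forall j w, close 0 r w -> normc (expo w j) < 1 / 2.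
  apply: (@fin_radius R 'I_N (fun j r => forall w, close 0 r w -> normc (expo w j) < 1 / 2)) => j.
  have [d d0 Hd] := continuous_close h12 (hol_continuous (expo_hol j 0)).
  exists d => // d' _ dd w Hw; have := Hd w (close_le dd Hw).
  by rewrite expo0 subr0.
pose d := Num.min d1 (Num.min d2 d3).
exists d => [|w Hw]; first by rewrite !lt_min d10 d20.
have [e1 e2 e3] : [/\ d <= d1, d <= d2 & d <= d3] by split; rewrite !ge_min lexx ?orbT.
have Ux : U (scl w a) by apply: Hr; apply: Hd1; exact: close_le Hw.
have E j : lam j (scl w a) = lam j a + expo w j.
  apply/eqP; rewrite -subr_eq0; apply/eqP; apply: cexp_eq1_small.
    rewrite cexpD cexpN cexpD (lam_cexp HL j Ux) (lam_cexp HL j Ua) mxE divff //.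
    by rewrite mulf_neq0 ?cexp_neq0 ?(dom_neq0 HL).
  rewrite opprD addrA; apply: le_lt_trans (le_normcD _ _) _; rewrite normcN.
  have := Hr1 j _ (Hd2 w (close_le e2 Hw)); have := Hd3 j w (close_le e3 Hw); lra.
split=> //; apply/colP => i; rewrite !ellE !mxE /elli !E.
have Ep j : j != pos (lm i) -> (forall i', j != pos (lm i')) -> expo w j = 0.
  by move=> _ H; rewrite /expo big1 // => i' _; rewrite (negbTE (H i')) mul0r.
have -> : expo w (pos (lm i)) = w i 0.
  rewrite /expo (bigD1 i) //= eqxx mul1r big1 ?addr0 // => i' /negbTE ii.
  by rewrite pos_eq (inj_eq (@lift_inj _ _)) eq_sym ii mul0r.
have En i' : expo w (neg i') = 0.
  by rewrite /expo big1 // => l _; rewrite neg_pos mul0r.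
have -> : expo w (pos om) = 0.
  by rewrite /expo big1 // => l _; rewrite pos_eq om_lm mul0r.
by rewrite !En; ring.
Qed.

(** The point of [U] whose logarithmic coordinates are shifted by the real vector (d, ..., d)
    provides the margin [d]; convergence there of the derivative along two distinct indices,
    available for 1 < n, is all that is used. *)
Lemma ell_good a : U a -> good (ell a).
Proof.
move=> Ua; have [n0|[n1|n2]] : n = 0%N \/ n = 1%N \/ (1 < n)%N by lia.
- exact: good_trivial.
- by left.
have [d d0 Hd] := lift_domain Ua.
pose i := Ordinal (ltnW n2); pose j := Ordinal n2; pose w : 'cV[C]_n := const_mx d%:C%C.
have /Hd[Ux E] : close 0 d w.
  by move=> l; rewrite !mxE subr0 normcR ger0_norm // ltW.
have [_ _ /(_ [set i; j]%SET _ Ux)/converges_absb[M HM]] := HU.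
apply: (@good_absb _ _ _ (ell (scl w a)) d M i j) => // [l|F].
  by rewrite E !mxE /= raddfD.
apply: le_trans (absb_inj (@Bu_inj n) HM F); rewrite le_eqVlt; apply/orP; left; apply/eqP.
apply: eq_bigr => k _; congr normc; apply/esym/dFterm_Bu => l.
by rewrite mxE (lam_cexp HL l Ux).
Qed.

Lemma dF_GF I x : U x -> dF lam I x = GF I (ell x).
Proof.
move=> Ux; apply: hs_sumE; apply: dFterm_hs; last exact: good_hs (ell_good Ux).
by move=> j; rewrite mxE (lam_cexp HL j Ux).
Qed.

Lemma solution_dF I : solution (Amx n) U (dF lam I).
Proof.
have [Hh Hw] := Eul_Box_solution oU (GF_Eul oU HL ell_good I) (GF_Box oU HL ell_good I).
split=> [|P HP x Ux].
  apply/holomorphicE => x Ux; have /holomorphicE/(_ x Ux) := Hh.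
  have [r r0 Hr] := open_close oU Ux; apply: (hol_near r0) => y Hy.
  by rewrite dF_GF //; exact: Hr.
apply: (etrans (weyl_act_open P oU (fun y Uy => dF_GF I Uy) Ux)); exact: Hw.
Qed.

Lemma regular1 (t : 'I_n -> C) : n = 1%N -> (forall i, t i != 1) -> regular t.
Proof.
move=> n1 t1 K phi _ Hu Hr w sw.
have one (i : 'I_n) : i = 0%N :> nat.
  by apply/eqP; have := ltn_ord i; rewrite [X in (_ < X)%N]n1 ltnS leqn0.
have eqI (i j : 'I_n) : i = j by apply: val_inj; rewrite /= !one.
case/lastP: w sw => [|w i] sw; first exact: Hu.
case/lastP: w sw => [|w j] sw; first exact: Hu.
move: sw; rewrite !size_rcons => sw; have := Hr i w sw; rewrite -!cats1 -catA (eqI j i) /=.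
have S1 (f : 'I_n -> C) : \sum_l f l = f i.
  by rewrite (bigD1 i) //= big1 ?addr0 // => l; rewrite (eqI l i) eqxx.
rewrite !S1 => E; apply/eqP; have : (1 - t i) * phi (w ++ [:: i; i]) == 0.
  by rewrite mulrBl mul1r -E subrr.
by rewrite mulf_eq0 subr_eq0 eq_sym (negbTE (t1 i)).
Qed.

Lemma regular_point : exists2 a, U a & regular (fun i => tq i a).
Proof.
have [[_ _ [a Ua]] _ _] := HU.
have [n1|n1] := eqVneq n 1%N; last first.
  exists a => //; have [/eqP|[eta [M cz]]] := ell_good Ua; first by rewrite (negbTE n1).
  apply: regular_small (conv_sum_lt1 cz) => i; first exact: expR_gt0.
  by rewrite -(cexp_ell HL i Ua) normc_cexp -expRM_natr; congr expR; field.
have [/forallP Ht|/forallPn[i Hi]] := boolP [forall i, tq i a != 1].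
  by exists a => //; exact: regular1.
(* Here [tq i a] is 1; the shift multiplies it by e^d with d > 0, which is not 1. *)
have [d d0 Hd] := lift_domain Ua; pose w : 'cV[C]_n := const_mx d%:C%C.
have /Hd[Ux E] : close 0 d w.
  by move=> l; rewrite !mxE subr0 normcR ger0_norm // ltW.
exists (scl w a) => //; apply: regular1 => // l.
have -> : l = i.
  have one (l' : 'I_n) : l' = 0%N :> nat.
    by apply/eqP; have := ltn_ord l'; rewrite [X in (_ < X)%N]n1 ltnS leqn0.
  by apply: val_inj; rewrite /= !one.
rewrite -(cexp_ell HL i Ux) E mxE cexpD (cexp_ell HL i Ua).
move: Hi; rewrite negbK => /eqP ->; rewrite mul1r mxE cexp_real.
rewrite -(rmorph1 (real_complex R)) (inj_eq (@complexI R)) -[X in _ != X]expR0.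
by rewrite (inj_eq (@expR_inj R)) gt_eqF.
Qed.

End Domain.

(** * Linear independence and spanning *)

Section Independence.
Variables (R : realType) (n : nat).
Local Notation C := R[i].
Implicit Types (z w : 'cV[C]_n) (I : {set 'I_n}) (c : {set 'I_n} -> C).

Definition strip z0 (e : R) : set 'cV[C]_n :=
  [set z | forall i, `|complex.Re (z i 0 - z0 i 0)| < e].

Lemma strip_open z0 e : open (strip z0 e).
Proof.
apply: close_open => z Hz.
have [r r0 Hr] : exists2 r, 0 < r & forall i, `|complex.Re (z i 0 - z0 i 0)| + r < e.
  apply: (@fin_radius R 'I_n (fun i r => `|complex.Re (z i 0 - z0 i 0)| + r < e)) => i.
  exists ((e - `|complex.Re (z i 0 - z0 i 0)|) / 2) => [|d d0 dr].
    by rewrite divr_gt0 // subr_gt0; exact: Hz.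
  by have := Hz i => /=; lra.
exists r => // x Hx i; have -> : x i 0 - z0 i 0 = (z i 0 - z0 i 0) + (x i 0 - z i 0) by ring.
rewrite raddfD; apply: le_lt_trans (ler_normD _ _) _; apply: le_lt_trans (Hr i).
by rewrite lerD2l; apply: le_trans (normc_Re _) (Hx i).
Qed.

Lemma strip_center z0 e : 0 < e -> strip z0 e z0.
Proof. by move=> e0 i; rewrite subrr raddf0 normr0. Qed.

Lemma strip_connected z0 e : 0 < e -> connected (strip z0 e).
Proof.
move=> e0; apply: (starshaped_connected (strip_center z0 e0)) => x t Hx t0 t1 i.
rewrite !mxE addrAC subrr add0r; have := Hx i; case: (x i 0 - z0 i 0) => u v /=.
rewrite mul0r subr0 normrM (ger0_norm t0) => h; apply: le_lt_trans h.
by rewrite ler_piMl.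
Qed.

Lemma strip_shift z0 e z i (t : R) : strip z0 e z ->
  strip z0 e (z + (0 +i* t)%C *: (delta_mx i 0 : 'cV[C]_n)).
Proof.
move=> Hz j; rewrite !mxE eqxx andbT addrAC; have := Hz j.
case: (z j 0 - z0 j 0) => u v.
by case: (j == i); rewrite ?mulr1 ?mulr0 ?addr0 //= addr0.
Qed.

(* Translating by [2 pi i] in direction [i] turns a relation into one between the
   [GF (I :\ i)], [i \in I], with fewer elements in the index sets. *)
Lemma GF_free_strip z0 (e : R) c : 0 < e -> (forall z, strip z0 e z -> good z) ->
  (forall z, strip z0 e z -> \sum_I c I * GF I z = 0) -> forall I, c I = 0.
Proof.
move=> e0 Hg; have Hz0 := strip_center z0 e0.
suff H m : forall c, (forall I, (m <= #|I|)%N -> c I = 0) ->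
    (forall z, strip z0 e z -> \sum_I c I * GF I z = 0) -> forall I, c I = 0.
  apply: (H n.+1) => I; have := max_card (mem I); rewrite card_ord => h1 h2.
  by have := leq_trans h2 h1; rewrite ltnn.
elim: m => [|m IH] {}c Hc Hs I; first exact: Hc.
have big (i : 'I_n) (J : {set 'I_n}) : i \in J -> c J = 0.
  (* Subtracting the relation from its translate in direction i and dividing by 2 pi i leaves the
     coefficient [c (i |: K)] at the sets K without i. *)
  move=> iJ; pose c' I := if i \in I then 0 else c (i |: I)%SET.
  have -> : c J = c' (J :\ i)%SET by rewrite /c' !inE eqxx /= finset.setD1K.
  apply: IH => [K mK|z Hz]; rewrite /c'.
    case: ifP => // iK; apply: Hc; by rewrite cardsU1 iK.
  have Hz' := strip_shift i (pi *+ 2) Hz; have := Hs _ Hz'.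
  under eq_bigr => K _ do rewrite (good_period K i (Hg z Hz)) mulrDr.
  rewrite big_split /= Hs // add0r => E.
  have c0 : (0 +i* (pi *+ 2))%C != 0 :> C.
    by rewrite eq_complex /= negb_and mulrn_eq0 /= (gt_eqF (pi_gt0 R)) orbT.
  apply: (mulfI c0); rewrite mulr0 -[RHS]E mulr_sumr.
  rewrite (bigID (fun K : {set 'I_n} => i \in K)) /= big1 ?add0r => [|K ->]; last by rewrite mul0r mulr0.
  rewrite [RHS](bigID (fun K : {set 'I_n} => i \in K)) /= [X in _ = _ + X]big1 ?addr0; last first.
    by move=> K /negbTE ->; rewrite mulr0.
  rewrite [RHS](reindex_onto (fun K => i |: K)%SET (fun K => K :\ i)%SET) /=; last first.
    by move=> K iK; rewrite finset.setD1K.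
  apply: eq_big => [K|K iK].
    rewrite !inE eqxx /=; apply/idP/eqP => [iK|<-]; last by rewrite !inE eqxx.
    by rewrite finset.setU1K.
  by rewrite (negbTE iK) !inE eqxx /= finset.setU1K // mulrCA.
have [->|[i iI]] := set_0Vmem I; last exact: big iI.
have := Hs _ Hz0; rewrite (bigD1 finset.set0) //= big1 ?addr0.
  by rewrite (good_set0 (Hg _ Hz0)) mulr1.
move=> J; have [->|[i iJ]] := set_0Vmem J; first by rewrite eqxx.
by rewrite (big i J iJ) mul0r.
Qed.

(** The relation is known only near [z0]; the identity theorem extends it to a strip, which is
    stable under the translations used in [GF_free_strip]. *)
Lemma GF_free z0 (d : R) c : good z0 -> 0 < d ->
  (forall w, close 0 d w -> \sum_I c I * GF I (z0 + w) = 0) -> forall I, c I = 0.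
Proof.
move=> /good_re[e e0 He] d0 H; apply: (GF_free_strip e0 He).
have Hhol : holU (strip z0 e) (fun z => \sum_I c I * GF I z).
  by move=> z Hz; apply: hol_sum => I _; apply: hol_scale; exact: good_hol (He z Hz).
apply: (identity_theorem (@strip_open z0 e) (strip_connected e0) Hhol (strip_center z0 e0)).
apply: (near0_flat d0) => z Hz; have -> : z = z0 + (z - z0) by rewrite addrC subrK.
apply: H => i; have := Hz i; by rewrite !mxE subr0.
Qed.

End Independence.

Lemma fin_solve (F : fieldType) (T : finType) (m : T -> T -> F) (b : T -> F) :
  (forall c, (forall s, \sum_t m s t * c t = 0) -> forall t, c t = 0) ->
  exists c, forall s, \sum_t m s t * c t = b s.
Proof.
move=> H; pose ev := @enum_val T predT; pose A := \matrix_(i, j) m (ev i) (ev j) : 'M[F]_#|T|.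
have evK t : ev (enum_rank t) = t by exact: enum_rankK.
have sumE (c : T -> F) s : \sum_t m s t * c t = (A *m \col_j c (ev j)) (enum_rank s) 0.
  rewrite mxE (reindex ev) /=; last by apply: onW_bij; exact: enum_val_bij.
  by apply: eq_bigr => j _; rewrite !mxE evK.
have Au : A \in unitmx.
  (* The hypothesis concerns columns while [kermx] consists of rows, hence the transpose. *)
  rewrite -unitmx_tr -row_free_unit -kermx_eq0; apply/eqP/row_matrixP => i; rewrite row0.
  set v := row i _; have vA : v *m A^T = 0 by rewrite /v -row_mul mulmx_ker row0.
  apply/rowP => j; rewrite [RHS]mxE.
  have -> : v 0 j = (fun t => v 0 (enum_rank t)) (ev j) by rewrite /= /ev enum_valK.
  apply: (H (fun t => v 0 (enum_rank t))) => s; rewrite sumE.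
  have -> : \col_j v 0 (enum_rank (ev j)) = v^T.
    by apply/colP => l; rewrite !mxE /ev enum_valK.
  by rewrite -[A]trmxK -trmx_mul vA !mxE.
pose x := invmx A *m \col_j b (ev j).
exists (fun t => x (enum_rank t) 0) => s; rewrite sumE.
have -> : \col_j x (enum_rank (ev j)) 0 = x by apply/colP => l; rewrite mxE /ev enum_valK.
by rewrite mulmxA mulmxV // mul1mx mxE evK.
Qed.

(** * The basis of solutions *)

Section Basis.
Variables (R : realType) (n : nat).
Local Notation C := R[i].
Local Notation N := (n.+1 + n.+1)%N.
Local Notation V := 'cV[C]_N.
Variables (U : set V) (lam : 'I_N -> V -> C).
Hypothesis HU : convergence_domain U lam.
Local Notation lm := (lift ord_max).

Let oU : open U. Proof. by case: HU => -[]. Qed.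
Let cU : connected U. Proof. by case: HU => -[]. Qed.
Let HL : log_branches U lam. Proof. by case: HU. Qed.

Lemma dF_free (c : {set 'I_n} -> C) :
  (forall x, U x -> \sum_I c I * dF lam I x = 0) -> forall I, c I = 0.
Proof.
move=> H; have [[_ _ [a Ua]] _ _] := HU; have [d d0 Hd] := lift_domain HU Ua.
apply: (GF_free (ell_good HU Ua) d0) => w /Hd[Ux <-].
by rewrite -[RHS](H _ Ux); apply: eq_bigr => I _; rewrite (dF_GF HU).
Qed.

Lemma solution_comb (c : {set 'I_n} -> C) f z : solution (Amx n) U f ->
  solution (Amx n) U (fun x => z * f x + \sum_I c I * dF lam I x).
Proof.
have hdF I : holU U (dF lam I) by have [/holomorphicE] := solution_dF HU I.
have H (s : seq {set 'I_n}) : solution (Amx n) U (fun x => \sum_(I <- s) c I * dF lam I x).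
  elim: s => [|I s [/holomorphicE IH1 IH2]].
    split=> [|P _ x _]; first by apply/holomorphicE => x _; apply: (hol_eq (f := fun=> 0)) (hol_cst _ _) => y; rewrite big_nil.
    have -> : (fun x => \sum_(I <- [::]) c I * dF lam I x) = (fun=> 0).
      by apply/funext => y; rewrite big_nil.
    exact: weyl_act0.
  have -> : (fun x => \sum_(J <- I :: s) c J * dF lam J x) =
      (fun x => c I * dF lam I x + \sum_(J <- s) c J * dF lam J x).
    by apply/funext => y; rewrite big_cons.
  have hI := hdF I; split=> [|P HP x Ux].
    by apply/holomorphicE => x Ux; apply: hol_add; [apply: hol_scale; exact: hI|exact: IH1].
  apply: (etrans (weyl_act_lin P (c I) oU hI IH1 Ux)).
  by rewrite (IH2 P HP x Ux) (proj2 (solution_dF HU I) P HP x Ux) mulr0 addr0.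
move=> [/holomorphicE Hf Hs]; have [/holomorphicE H1 H2] := H (index_enum _).
split=> [|P HP x Ux].
  by apply/holomorphicE => x Ux; apply: hol_add; [apply: hol_scale; exact: Hf|exact: H1].
apply: (etrans (weyl_act_lin P z oU Hf H1 Ux)).
by rewrite (H2 P HP x Ux) (Hs P HP x Ux) mulr0 addr0.
Qed.

(** Evaluated at a regular point, these are the 2^n functionals that separate solutions. *)
Definition thI (I : {set 'I_n}) := thW (R := R) (map (fun i => pos (lm i)) (enum I)).

Lemma solution_zero a f : U a -> regular (fun i => tq i a) -> solution (Amx n) U f ->
  (forall I, thI I f a = 0) -> forall x, U x -> f x = 0.
Proof.
move=> Ua Hr Hf H0; have Ef := solution_Eul oU Hf; have Bf := solution_Box oU Hf.
have [hf _ _ _] := Ef.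
apply: (identity_theorem oU cU hf Ua).
apply: (solution_determined oU Ua (dom_neq0 HL) Ef Bf Hr) => w uw.
rewrite -[RHS](H0 [set i in w]%SET); apply: (thW_perm oU hf _ Ua).
apply: perm_map; apply: uniq_perm => [//||i]; first exact: enum_uniq.
by rewrite mem_enum inE.
Qed.

Lemma dF_basis : solution_basis (Amx n) U (fun I => dF lam I).
Proof.
split; [exact: solution_dF HU|exact: dF_free|move=> f Sf].
have [a Ua Hr] := regular_point HU.
have hdF I : holU U (dF lam I) by have [/holomorphicE] := solution_dF HU I.
have hf : holU U f by have [/holomorphicE] := Sf.
have thc I c z : thI I (fun x => z * f x + \sum_J c J * dF lam J x) a =
    z * thI I f a + \sum_J thI I (dF lam J) a * c J.
  pose h (o : option {set 'I_n}) x := if o is Some J then c J * dF lam J x else z * f x.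
  have hh o : holU U (h o) by move=> x Ux; case: o => [J|]; apply: hol_scale; [exact: hdF|exact: hf].
  have E x : z * f x + \sum_J c J * dF lam J x = \sum_(o <- None :: map Some (index_enum _)) h o x.
    by rewrite big_cons big_map.
  rewrite /thI; apply: (etrans (thW_open _ oU (fun x _ => E x) Ua)).
  apply: (etrans (thW_sum _ _ oU hh Ua)); rewrite big_cons big_map.
  apply: congr2; first exact: (thWZ _ z oU hf Ua).
  apply: eq_bigr => J _; apply: (etrans (thWZ _ (c J) oU (hdF J) Ua)); exact: mulrC.
(* The matrix of the functionals on the series is injective: a combination killed by all of them is
   the zero solution, hence has zero coefficients by independence. Solving for the values of [f]
   gives a combination that agrees with [f] under every functional. *)
have [|c Hc] := @fin_solve C _ (fun I J => thI I (dF lam J) a) (fun I => thI I f a).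
  move=> c Hc; apply: dF_free; have Sc := solution_comb c 0 Sf => x Ux.
  have := solution_zero Ua Hr Sc _ Ux; rewrite mul0r add0r; apply => I.
  by rewrite thc mul0r add0r Hc.
exists c => x Ux; have := solution_zero Ua Hr (solution_comb c (-1) Sf) _ Ux.
have E : forall I, thI I (fun x => -1 * f x + \sum_J c J * dF lam J x) a = 0.
  by move=> I; rewrite thc Hc mulN1r addNr.
by move=> /(_ E)/eqP; rewrite mulN1r addrC subr_eq0 => /eqP <-.
Qed.

End Basis.

(** * A convergence domain *)

Section Existence.
Variables (R : realType) (n : nat).
Local Notation C := R[i].
Local Notation N := (n.+1 + n.+1)%N.
Local Notation V := 'cV[C]_N.
Implicit Types (a x : V) (z w : 'cV[C]_n) (I : {set 'I_n}) (k : 'cV[nat]_n).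
Local Notation lm := (lift ord_max).
Local Notation om := (ord_max : 'I_n.+1).

Lemma fact_le_exp m : m`!%:R <= (m%:R : R) ^+ m.
Proof.
have H j : (j <= m)%N -> (j`! <= m ^ j)%N.
  elim: j => [//|j IH] jm; rewrite factS expnS leq_mul // IH // ltnW //.
by rewrite -natrX ler_nat H.
Qed.

(* [K! <= K ^ K = \prod_i K ^ k_i] and [K ^ k_i / k_i! <= e ^ K]. *)
Lemma wt_le k : wt R k <= expR (2 * n%:R) ^+ deg k.
Proof.
have F0 : 0 < \prod_i (k i 0%R)`!%:R :> R.
  by apply: prodr_gt0 => i _; rewrite ltr0n fact_gt0.
have -> : expR (2 * n%:R) ^+ deg k = (expR (n%:R * (deg k)%:R) : R) ^+ 2.
  by rewrite -!expRM_natr; congr expR; ring.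
apply: lerXn2r; rewrite ?nnegrE ?expR_ge0 //; first by rewrite divr_ge0 // ltW.
rewrite ler_pdivrMr //; apply: le_trans (_ : (deg k)`!%:R <= _).
  by rewrite ler_nat; apply: leq_fact; exact: leq_pred.
apply: le_trans (fact_le_exp _) _.
have -> : expR (n%:R * (deg k)%:R) = \prod_(i < n) (expR (deg k)%:R : R).
  by rewrite prodr_const card_ord -expRM_natl.
rewrite -big_split /= {2}/deg -prodrXr; apply: ler_prod => i _.
rewrite exprn_ge0 //= -ler_pdivrMr ?ltr0n ?fact_gt0 //.
have := exp_coeff_le (k i 0%R).+1 (ler0n R (deg k)); rewrite big_nat_recr //=.
apply: le_trans; rewrite lerDr sumr_ge0 // => j _; by rewrite divr_ge0 ?exprn_ge0.
Qed.

(** The weights grow at most like e^(2n |k|) and the margin is 1, so Re z_i <= - (2n + 3) leaves the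
    ratio e^(-2) in each coordinate. *)
Lemma conv_small z : (forall i, complex.Re (z i 0) <= - (2 * n%:R + 3)) -> exists M, conv z 1 M.
Proof.
move=> Hz; pose q : R := expR (- 2).
have q1 : 0 <= q < 1 by rewrite expR_ge0 /= -expR0 ltr_expR; lra.
exists (\prod_(i < n) (1 - q)^-1); split=> // F.
apply: le_trans (_ : \sum_(k <- F) \prod_i q ^+ k i 0 <= _); last first.
  apply: (@sum_prod_le _ _ (fun _ j => q ^+ j) (fun=> (1 - q)^-1) F) => [_ j|_ K'].
    by rewrite exprn_ge0 // expR_ge0.
  exact: geom_sum_le.
apply: ler_sum => k _; apply: le_trans (ler_wpM2r _ (wt_le k)) _.
  by apply: prodr_ge0 => i _; exact: expR_ge0.
rewrite /deg -prodrXr -big_split /=; apply: ler_prod => i _.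
rewrite mulr_ge0 ?exprn_ge0 ?expR_ge0 //= [expR (_ * (k i 0%R)%:R)]expRM_natr -exprMn lerXn2r ?nnegrE ?mulr_ge0 ?expR_ge0 //.
by rewrite -expRD ler_expR; have := Hz i; lra.
Qed.

Lemma Re_log1 (u : C) : normc u < 1 / 2 ->
  -1 <= complex.Re (log1 u) /\ complex.Re (log1 u) <= 1 / 2.
Proof.
move=> Hu; have E : expR (complex.Re (log1 u)) = normc (1 + u).
  by rewrite -normc_cexp cexp_log1 //; apply: lt_trans Hu _; lra.
have h1 : normc (1 + u) <= 1 + normc u by apply: le_trans (le_normcD _ _) _; rewrite (normcR 1) normr1.
have h2 : 1 <= normc (1 + u) + normc u.
  have := le_normcD (1 + u) (- u); rewrite addrK normcN; by rewrite (normcR 1) normr1.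
split; rewrite -ler_expR E.
  rewrite expRN; have e2 : 2 <= expR 1 :> R by have := expR_ge1Dx (1 : R); lra.
  apply: le_trans (_ : 1 / 2 <= _); last by lra.
  by rewrite ler_pdivlMr // ler_pdivrMl ?expR_gt0 //; lra.
by have := expR_ge1Dx (1 / 2 : R); lra.
Qed.

Lemma log1_comp_hol (M : nat) (b : 'cV[C]_M) (v : 'cV[C]_M -> C) :
  hol_at b v -> normc (v b) < 1 -> hol_at b (fun u => log1 (v u)).
Proof.
move=> Hv v1; have -> : (fun u => log1 (v u)) =
    (fun u => (fun y : 'cV[C]_1 => log1 (y 0 0)) (\col_(i < 1) v u)).
  by apply/funext => u; rewrite mxE.
have H1 : normc ((\col_(i < 1) v b) 0 0) < 1 by rewrite mxE.
exact: (hol_comp (h := fun _ => v) (fun _ => Hv) (log1_hol H1).1).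
Qed.

Lemma convergence_domain_of_conv (U : set V) lam : domain U -> log_branches U lam ->
  (forall x, U x -> exists eta M, conv (ell lam x) eta M) -> convergence_domain U lam.
Proof.
move=> dU HL Hc; split=> // I x Ux; have [eta [M cz]] := Hc x Ux.
apply: hs_converges; apply: dFterm_hs; last exact: GF_hs [::] I cz.
by move=> j; rewrite mxE (lam_cexp HL j Ux).
Qed.

(** [U] is a polydisc around a real positive point whose coordinates i and -i, i < m, are small; on
    it [log1] supplies the branches with controlled real part. *)
Lemma exists_convergence_domain : exists (U : set V) lam, convergence_domain U lam.
Proof.
(* Two coordinates contribute - 2 (n + 3) to Re z_i, and the four logarithms add at most 1/2 + 1/2 +
   1 + 1 = 3, which gives the bound - (2n + 3) of [conv_small]. *)
pose al (j : 'I_N) : R := \sum_(i < n) ((j == pos (lm i))%:R + (j == neg (lm i))%:R) * - (n%:R + 3).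
pose e j : C := (expR (al j))%:C%C.
have e0 j : e j != 0 by rewrite /e -cexp_real cexp_neq0.
pose v j x : C := (e j)^-1 * x j 0 - 1.
pose U : set V := [set x | forall j, normc (v j x) < 1 / 2].
pose lam j x : C := (al j)%:C%C + log1 (v j x).
have v_hol j x : hol_at x (v j).
  by apply: hol_sub; [apply: hol_scale; exact: hol_coord|exact: hol_cst].
have h12 : (1 / 2 : R) < 1 by lra.
pose a : V := \col_j e j.
have va j : v j a = 0 by rewrite /v mxE mulVf // subrr.
have Ua : U a by move=> j; rewrite va normc0 divr_gt0.
have oU : open U.
  apply: close_open => x Ux; suff [r r0 Hr] : exists2 r, 0 < r &
      forall j y, close x r y -> normc (v j y) < 1 / 2.
    by exists r => // y Hy j; exact: Hr.
  apply: (@fin_radius R 'I_N (fun j r => forall y, close x r y -> normc (v j y) < 1 / 2)) => j.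
  have d0 : 0 < 1 / 2 - normc (v j x) by rewrite subr_gt0; exact: Ux.
  have [r r0 Hr] := continuous_close d0 (hol_continuous (v_hol j x)).
  exists r => // d _ dr y Hy; have h := Hr y (close_le dr Hy).
  have -> : v j y = v j x + (v j y - v j x) by rewrite addrC subrK.
  apply: le_lt_trans (le_normcD _ _) _; lra.
have cU : connected U.
  apply: (starshaped_connected Ua) => x t Ux t0 t1 j.
  have -> : v j (a + t%:C%C *: (x - a)) = t%:C%C * v j x.
    by rewrite /v !mxE; move: (e0 j); move: (e j) => w w0; field.
  rewrite normcM normcR ger0_norm //; apply: le_lt_trans (Ux j).
  by rewrite ler_piMl // normc_ge0.
have HL : log_branches U lam.
  move=> j x Ux; have v1 := lt_trans (Ux j) h12; split.
    apply: hol_continuous; apply: hol_add; first exact: hol_cst.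
    exact: log1_comp_hol.
  rewrite /lam cexpD cexp_real cexp_log1 // /v -/(e j).
  by move: (e0 j); move: (e j) => w w0; field.
have dU : domain U by split=> //; exists a.
exists U, lam; apply: (convergence_domain_of_conv dU HL) => x Ux.
exists 1; apply: conv_small => i; rewrite ellE mxE /elli /lam.
have alp : al (pos (lm i)) = - (n%:R + 3).
  rewrite /al (bigD1 i) //= big1 ?addr0 => [|i' ii]; rewrite !eq_posneg (inj_eq (@lift_inj _ _)).
    by rewrite eqxx addr0 mul1r.
  by rewrite eq_sym (negbTE ii) addr0 mul0r.
have aln : al (neg (lm i)) = - (n%:R + 3).
  rewrite /al (bigD1 i) //= big1 ?addr0 => [|i' ii]; rewrite !eq_posneg (inj_eq (@lift_inj _ _)).
    by rewrite eqxx add0r mul1r.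
  by rewrite eq_sym (negbTE ii) addr0 mul0r.
have alo : al (pos om) = 0 by rewrite /al big1 // => i' _; rewrite !eq_posneg om_lm addr0 mul0r.
have alno : al (neg om) = 0 by rewrite /al big1 // => i' _; rewrite !eq_posneg om_lm addr0 mul0r.
rewrite alp aln alo alno !raddfB !raddfD /=.
have [_ h1] := Re_log1 (Ux (pos (lm i))); have [_ h2] := Re_log1 (Ux (neg (lm i))).
have [h3 _] := Re_log1 (Ux (pos om)); have [h4 _] := Re_log1 (Ux (neg om)).
lra.
Qed.

End Existence.

(** The first conjunct provides a common domain of convergence, so that the second, over all such
    domains, is not vacuous. *)
Theorem corollary6p4 (R : realType) (n : nat) (w : 'cV[R]_(n.+1 + n.+1))
    (hw : decreasing_weight w) :
  (exists (U : set 'cV[R[i]]_(n.+1 + n.+1)) lam, convergence_domain U lam) /\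
  (forall (U : set 'cV[R[i]]_(n.+1 + n.+1)) lam, convergence_domain U lam ->
     solution_basis (Amx n) U (fun I : {set 'I_n} => dF lam I)).
Proof.
by split; [exact: exists_convergence_domain|move=> U lam; exact: dF_basis].
Qed.
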